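(* Let $n\ge1$ be an integer, $\sigma\ge 1$ a real number and $p,q>1$. Assume that $u_1,v_1\in L^1(\mathbb{R}^n)$ satisfy $$\int_{\mathbb{R}^n}u_1(x)\,dx>0\quad\text{and}\quad\int_{\mathbb{R}^n}v_1(x)\,dx>0.$$ Suppose further that either $n\le\sigma$, or $n>\sigma$ and $$\max\left\{\frac{2q+1}{pq+q-2},\ \frac{pq+p+1}{2pq-p-1}\right\}>\frac{n}{2\sigma}.$$ Then there is no global (in time) weak solution $$(u,v)\in\Big(\mathcal{C}([0,\infty),L^q(\mathbb{R}^n))\cap L^q([0,\infty)\times\mathbb{R}^n)\Big)\times\mathcal{C}([0,\infty),L^2(\mathbb{R}^n))$$ to the Cauchy problem $$\begin{cases} u_{tt}+(-\Delta)^\sigma u+(-\Delta)^\sigma u_t=|v|^p, & x\in\mathbb{R}^n,\ t>0,\\ v_{tt}+(-\Delta)^\sigma v+v_t=|u|^q, & x\in\mathbb{R}^n,\ t>0,\\ u(0,x)=0,\ u_t(0,x)=u_1(x), & x\in\mathbb{R}^n,\\ v(0,x)=0,\ v_t(0,x)=v_1(x), & x\in\mathbb{R}^n.\end{cases}$$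
   Context: $(-\Delta)^\sigma$ is the Fourier multiplier with symbol $|\xi|^{2\sigma}$. Weak solution: let $T\in(0,\infty]$. A pair $(u,v)\in\mathcal{C}([0,T),L^q(\mathbb{R}^n))\times\mathcal{C}([0,T),L^2(\mathbb{R}^n))$ is a local (in time) weak solution on $[0,T)$ if for all test functions $\Phi_j(t,x)=\eta(t)\varphi_j(x)$, $j=1,2$, with $\eta\in\mathcal{C}_0^\infty([0,T))$ (so $\eta$ need not vanish at $t=0$) and $\varphi_j\in\mathcal{C}^\infty(\mathbb{R}^n)$ having all derivatives (including order zero) in $L^1(\mathbb{R}^n)\cap L^\infty(\mathbb{R}^n)$, one has $$\int_0^T\!\!\int_{\mathbb{R}^n}|v|^p\Phi_2\,dx\,dt+\int_{\mathbb{R}^n}u_1(x)\Phi_2(0,x)\,dx=\int_0^T\!\!\int_{\mathbb{R}^n}u\,\big(\partial_t^2-\partial_t(-\Delta)^\sigma+(-\Delta)^\sigma\big)\Phi_2\,dx\,dt$$ and $$\int_0^T\!\!\int_{\mathbb{R}^n}|u|^q\Phi_1\,dx\,dt+\int_{\mathbb{R}^n}v_1(x)\Phi_1(0,x)\,dx=\int_0^T\!\!\int_{\mathbb{R}^n}v\,\big(\partial_t^2-\partial_t+(-\Delta)^\sigma\big)\Phi_1\,dx\,dt.$$ If $T=\infty$, $(u,v)$ is called a global (in time) weak solution. *)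

(* Defs.v *)
From HB Require Import structures.
From mathcomp Require Import all_boot all_order all_algebra.
From mathcomp Require Import all_classical all_reals all_analysis.
From mathcomp Require Import complex.

Set Implicit Arguments.
Unset Strict Implicit.
Unset Printing Implicit Defensive.

Import Order.TTheory GRing.Theory Num.Theory.
Import numFieldNormedType.Exports.

Local Open Scope classical_set_scope.
Local Open Scope ring_scope.

(* R^n is 'rV[R]_n with the sigma-algebra generated by the coordinates, that
   is, its Borel sets; this mirrors the library's instance on n.-tuple T. *)
Fact measure_rV_display : measure_display.
Proof. exact. Qed.

Section measurable_rV.
Context {R : realType}.
Variable n : nat.

Let coors : 'I_n -> 'rV[R]_n -> R := fun i x => x ord0 i.

Let rV_set0 : g_sigma_preimage coors set0.
Proof. exact: sigma_algebra0. Qed.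

Let rV_setC A : g_sigma_preimage coors A -> g_sigma_preimage coors (~` A).
Proof. exact: sigma_algebraC. Qed.

Let rV_bigcup (F : _^nat) : (forall i, g_sigma_preimage coors (F i)) ->
  g_sigma_preimage coors (\bigcup_i (F i)).
Proof. exact: sigma_algebra_bigcup. Qed.

HB.instance Definition _ := @isMeasurable.Build measure_rV_display
  'rV[R]_n (g_sigma_preimage coors) rV_set0 rV_setC rV_bigcup.

End measurable_rV.

Section measurable_rV_theory.
Context {R : realType}.

Lemma measurable_coord n (i : 'I_n) :
  measurable_fun [set: 'rV[R]_n] (fun x => x ord0 i).
Proof.
move=> _ Y mY; rewrite setTI; apply: sub_sigma_algebra => /=.
rewrite -bigcup_seq/=; exists i => /=; first by rewrite mem_index_enum.
by exists Y => //; rewrite setTI.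
Qed.

Lemma measurable_fun_rV d (T : measurableType d) n (f : T -> 'rV[R]_n) :
  (forall i, measurable_fun [set: T] (fun t => f t ord0 i)) ->
  measurable_fun [set: T] f.
Proof.
move=> mf _ A mA; rewrite setTI.
suff : g_sigma_preimage (fun i (x : 'rV[R]_n) => x ord0 i) `<=`
    [set B | measurable (f @^-1` B)] by apply.
apply: smallest_sub.
  split => [|B|F]/=.
  - by rewrite preimage_set0.
  - by move=> mB; rewrite setTD preimage_setC; exact: measurableC.
  - by move=> mF; rewrite preimage_bigcup; exact: bigcup_measurable.
case: n => [|n] in f mf A mA *; first by rewrite big_ord0.
rewrite -bigcup_mkord_ord; apply: bigcup_sub => i Ii B [C mC <-] /=.
by rewrite setTI -[X in measurable X]setTI; exact: mf.
Qed.

Definition rVcons n (z : measurableTypeR R * 'rV[R]_n) : 'rV[R]_n.+1 := row_mx z.1%:M z.2.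

Definition rVuncons n (x : 'rV[R]_n.+1) : measurableTypeR R * 'rV[R]_n :=
  (x ord0 ord0, \row_i x ord0 (lift ord0 i)).

Lemma rVcons0 n (z : R * 'rV[R]_n) : rVcons z ord0 ord0 = z.1.
Proof.
have -> : ord0 = lshift n (ord0 : 'I_1) :> 'I_(1 + n) by exact/val_inj.
by rewrite [LHS]row_mxEl mxE eqxx mulr1n.
Qed.

Lemma rVconsS n (z : R * 'rV[R]_n) i : rVcons z ord0 (lift ord0 i) = z.2 ord0 i.
Proof.
have -> : lift ord0 i = rshift 1 i :> 'I_(1 + n) by exact/val_inj.
by rewrite [LHS]row_mxEr.
Qed.

Lemma rVconsK n : cancel (@rVcons n) (@rVuncons n).
Proof.
case=> a x; rewrite /rVuncons rVcons0; congr pair.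
by apply/rowP => i; rewrite mxE rVconsS.
Qed.

Lemma measurable_rVcons n : measurable_fun [set: measurableTypeR R * 'rV[R]_n] (@rVcons n).
Proof.
apply: measurable_fun_rV => i; have [j ->|->] := unliftP ord0 i.
  under eq_fun do rewrite rVconsS.
  apply: (measurableT_comp (measurable_coord j)).
  exact: measurable_snd.
by under eq_fun do rewrite rVcons0; exact: measurable_fst.
Qed.

Lemma measurable_rVuncons n : measurable_fun [set: 'rV[R]_n.+1] (@rVuncons n).
Proof.
apply: measurable_fun_pair; first exact: measurable_coord.
apply: measurable_fun_rV => i; under eq_fun do rewrite mxE.
exact: measurable_coord.
Qed.

End measurable_rV_theory.

Section lebesgue_rV.
Context {R : realType}.

Section rVcons_measure.
Variables (n : nat) (mu : {sigma_finite_measure set 'rV[R]_n -> \bar R}).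

Definition rVcons_measure : set 'rV[R]_n.+1 -> \bar R :=
  pushforward (@lebesgue_measure R \x mu)%E (@rVcons R n).

Let m0 : rVcons_measure set0 = 0%E.
Proof. by rewrite /rVcons_measure /pushforward preimage_set0 measure0. Qed.

Let m_ge0 A : (0 <= rVcons_measure A)%E.
Proof. by rewrite /rVcons_measure /pushforward; exact: measure_ge0. Qed.

Let m_sigma_additive : semi_sigma_additive rVcons_measure.
Proof.
move=> F mF tF mUF; rewrite /rVcons_measure /pushforward preimage_bigcup.
have mpre A : measurable A -> measurable (@rVcons R n @^-1` A).
  by move=> mA; rewrite -[X in measurable X]setTI; exact: measurable_rVcons.
apply: measure_semi_sigma_additive.
- by move=> k; exact: mpre.
- apply/trivIsetP => /= i j _ _ ij; rewrite -preimage_setI.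
  by move/trivIsetP : tF => /(_ _ _ _ _ ij) ->//; rewrite preimage_set0.
- by rewrite -preimage_bigcup; exact: mpre.
Qed.

HB.instance Definition _ := isMeasure.Build _ _ _ rVcons_measure
  m0 m_ge0 m_sigma_additive.

Let m_sigma_finite : sigma_finite setT rVcons_measure.
Proof.
have /sigma_finiteP[F [TF ndF Foo]] := sigma_finiteT (@lebesgue_measure R).
have /sigma_finiteP[G [TG ndG Goo]] := sigma_finiteT mu.
exists (fun k => @rVuncons R n @^-1` (F k `*` G k)).
  rewrite -preimage_bigcup (_ : \bigcup_i _ = setT) ?preimage_setT//.
  apply/seteqP; split => // -[a x] _.
  have [i _ Fa] : (\bigcup_k F k) a by rewrite -TF.
  have [j _ Gx] : (\bigcup_k G k) x by rewrite -TG.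
  exists (maxn i j) => //; split => /=.
  - by move: a Fa; exact/subsetPset/ndF/leq_maxl.
  - by move: x Gx; exact/subsetPset/ndG/leq_maxr.
move=> k; have [mF muF] := Foo k; have [mG muG] := Goo k; split.
  rewrite -[X in measurable X]setTI; apply: measurable_rVuncons => //.
  exact: measurableX.
rewrite /rVcons_measure /pushforward -comp_preimage.
rewrite (_ : _ \o _ = id); last by apply/funext => z; exact: rVconsK.
by rewrite preimage_id product_measure1E// lte_mul_pinfty// ge0_fin_numE.
Qed.

HB.instance Definition _ := Measure_isSigmaFinite.Build _ _ _ rVcons_measure
  m_sigma_finite.

End rVcons_measure.

(* Lebesgue measure on R^n, by R^(n+1) = R x R^n and Tonelli; R^0 is a point. *)
Fixpoint lebesgue_rV n : {sigma_finite_measure set 'rV[R]_n -> \bar R} :=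
  if n is k.+1 then rVcons_measure (lebesgue_rV k) else \d_(0 : 'rV[R]_0).

Lemma lebesgue_rV_box n (A : 'I_n -> set R) :
  (forall i, measurable (A i)) ->
  lebesgue_rV n [set x : 'rV[R]_n | forall i, A i (x ord0 i)] =
  (\prod_(i < n) lebesgue_measure (A i))%E.
Proof.
have mbox k (B : 'I_k -> set R) : (forall i, measurable (B i)) ->
    measurable [set x : 'rV[R]_k | forall i, B i (x ord0 i)].
  move=> mB; rewrite [X in measurable X](_ : _ =
      \bigcap_(i in [set: 'I_k]) ((fun x : 'rV[R]_k => x ord0 i) @^-1` B i)).
    apply: fin_bigcap_measurable => // i _.
    by rewrite -[X in measurable X]setTI; exact: measurable_coord.
  by apply/seteqP; split => [x Bx i _|x Bx i]; exact: Bx.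
elim: n A => [|n IH] A mA.
  rewrite big_ord0 /= diracE mem_set//= => i; by case: i.
rewrite big_ord_recl -(IH (A \o lift ord0)); last by move=> i; exact: mA.
rewrite -product_measure1E//; first last.
- by apply: mbox => i; exact: mA.
- exact: (mA ord0).
rewrite /= /rVcons_measure /pushforward; congr (_ _).
apply/seteqP; split => -[a x]/=.
  move=> Aax; split => [|i]; first by have := Aax ord0; rewrite rVcons0.
  by have := Aax (lift ord0 i); rewrite rVconsS.
move=> [Aa Ax] i; have [j ->|->] := unliftP ord0 i; first by rewrite rVconsS.
by rewrite rVcons0.
Qed.

End lebesgue_rV.

Section test_functions.
Context {R : realType}.

Section space.
Variable n : nat.
Implicit Types (f : 'rV[R]_n -> R) (s : seq 'I_n).

Definition basis_rV (i : 'I_n) : 'rV[R]_n := delta_mx ord0 i.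

(* [:: i1; ...; ik] |-> d_{i1} ... d_{ik} f *)
Definition iter_partial s f : 'rV[R]_n -> R :=
  foldr (fun i g => fun x => 'D_(basis_rV i) g x) f s.

Definition smooth_rV f := forall s,
  continuous (iter_partial s f) /\
  forall i x, derivable (iter_partial s f) x (basis_rV i).

Definition space_test_function f := smooth_rV f /\ forall s,
  iter_partial s f \in Lfun (lebesgue_rV n) 1%E /\
  iter_partial s f \in Lfun (lebesgue_rV n) +oo%E.

End space.

Definition smooth_R (f : R -> R) := forall k x, derivable (derive1n k f) x 1.

Definition time_interval (T : \bar R) : set R :=
  [set t | 0 <= t /\ (t%:E < T)%E].

(* C_0^oo([0, T)): smooth up to t = 0, hence taken as a smooth function on R,
   whose values at negative times play no role; it vanishes near T. *)
Definition time_test_function (T : \bar R) (f : R -> R) :=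
  smooth_R f /\ exists2 M : R, (M%:E < T)%E & forall t, M <= t -> f t = 0.

End test_functions.

Section fractional_laplacian.
Context {R : realType} {n : nat}.
Implicit Types (x xi : 'rV[R]_n).
Local Open Scope complex_scope.

Definition dot_rV x xi : R := \sum_(i < n) x ord0 i * xi ord0 i.

Definition euclid_norm x : R := Num.sqrt (dot_rV x x).

Definition expi (r : R) : R[i] := cos r +i* sin r.

Definition integral_complex (f : 'rV[R]_n -> R[i]) : R[i] :=
  (\int[lebesgue_rV n]_x complex.Re (f x))%R +i*
  (\int[lebesgue_rV n]_x complex.Im (f x))%R.

Definition fourier (f : 'rV[R]_n -> R[i]) xi : R[i] :=
  integral_complex (fun x => expi (- dot_rV x xi) * f x).

Definition inverse_fourier (g : 'rV[R]_n -> R[i]) x : R[i] :=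
  (((2 * pi) ^+ n)^-1)%:C *
  integral_complex (fun xi => expi (dot_rV x xi) * g xi).

Definition fourier_multiplier (m : 'rV[R]_n -> R) (f : 'rV[R]_n -> R[i]) :=
  inverse_fourier (fun xi => (m xi)%:C * fourier f xi).

(* (-Delta)^sigma f for real f; taking the real part only changes the type, as
   the symbol is real and even. *)
Definition fractional_laplacian (sigma : R) (f : 'rV[R]_n -> R) x : R :=
  complex.Re (fourier_multiplier (fun xi => euclid_norm xi `^ (2 * sigma))
                                 (fun y => (f y)%:C) x).

End fractional_laplacian.

Section weak_solutions.
Context {R : realType} {n : nat}.
Implicit Types (T : \bar R) (w Phi : R -> 'rV[R]_n -> R).

Definition continuous_Lq T (q : R) w :=
  (forall t, time_interval T t -> w t \in Lfun (lebesgue_rV n) q%:E) /\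
  forall t0, time_interval T t0 ->
    Lnorm (lebesgue_rV n) q%:E (EFin \o (w t \- w t0))
      @[t --> within (time_interval T) (nbhs t0)] --> 0%E.

Definition spacetime T : set (measurableTypeR R * 'rV[R]_n) :=
  [set z | time_interval T z.1].

(* A curve t |-> w t of classes of functions modulo a.e. equality belongs to
   L^q([0, T) x R^n) when, for almost every t, w t is the class of the section
   at t of some U in L^q([0, T) x R^n). *)
Definition spacetime_Lq T (q : R) w :=
  exists U : measurableTypeR R * 'rV[R]_n -> R,
  [/\ measurable_fun (spacetime T) U,
      (\int[lebesgue_measure \x lebesgue_rV n]_(z in spacetime T)
         (`|U z| `^ q)%:E < +oo)%E &
      {ae lebesgue_measure, forall t, time_interval T t ->
        {ae lebesgue_rV n, forall x, U (t, x) = w t x}}].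

Definition dt Phi : R -> 'rV[R]_n -> R := fun t x => derive1 (Phi ^~ x) t.

Definition frac_lap_x (sigma : R) Phi : R -> 'rV[R]_n -> R :=
  fun t => fractional_laplacian sigma (Phi t).

Definition tensor (eta : R -> R) (phi : 'rV[R]_n -> R) : R -> 'rV[R]_n -> R :=
  fun t x => eta t * phi x.

(* The integrals are extended-real valued. The right-hand sides are finite for
   such u, v and test functions, and +oo - +oo = -oo, so each identity includes
   the convergence of its left-hand side. *)
Definition weak_solution (sigma p q : R) (u1 v1 : 'rV[R]_n -> R) T
    (u v : R -> 'rV[R]_n -> R) :=
  [/\ continuous_Lq T q u, continuous_Lq T 2 v &
  forall (eta : R -> R) (phi1 phi2 : 'rV[R]_n -> R),
    time_test_function T eta ->
    space_test_function phi1 -> space_test_function phi2 ->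
    let Phi1 := tensor eta phi1 in
    let Phi2 := tensor eta phi2 in
    (\int[lebesgue_measure]_(t in time_interval T) \int[lebesgue_rV n]_x
        (`|v t x| `^ p * Phi2 t x)%:E
     + \int[lebesgue_rV n]_x (u1 x * Phi2 0%R x)%:E
     = \int[lebesgue_measure]_(t in time_interval T) \int[lebesgue_rV n]_x
        (u t x * (dt (dt Phi2) t x - dt (frac_lap_x sigma Phi2) t x
                  + frac_lap_x sigma Phi2 t x))%:E)%E /\
    (\int[lebesgue_measure]_(t in time_interval T) \int[lebesgue_rV n]_x
        (`|u t x| `^ q * Phi1 t x)%:E
     + \int[lebesgue_rV n]_x (v1 x * Phi1 0%R x)%:E
     = \int[lebesgue_measure]_(t in time_interval T) \int[lebesgue_rV n]_x
        (v t x * (dt (dt Phi1) t x - dt Phi1 t x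
                  + frac_lap_x sigma Phi1 t x))%:E)%E].

Definition global_weak_solution (sigma p q : R) (u1 v1 : 'rV[R]_n -> R) :=
  weak_solution sigma p q u1 v1 +oo%E.

End weak_solutions.

(* Main.v *)
(* The test function is eta(t/T) phi(x), phi(x) = (1 + k |x|^2)^(-(n+1)/2) with
   k a negative power of T, and eta(s) = exp(-1/(1-s)). Both weights dominate
   their own images: |eta'|, |eta''| <= C eta^(1/r) for every r > 1, and
   |(-Delta)^sigma phi| <= C k^sigma phi. For the latter, phi is a mixture of
   Gaussians, so its Fourier transform is a mixture of Gaussians exp(-a |xi|^2);
   writing |xi|^(2 sigma) as a multiple of the integral over v of
   |v|^(-1-2 sigma) (1 - exp(-v^2 |xi|^2))^m, the product with exp(-a |xi|^2) is an
   m-th finite difference in a, and the inverse transform becomes an integral of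
   m-th differences of the heat kernel in time.
   Young's inequality in both equations then gives, with N = n / (2 sigma),
   1/q + 1/q' = 1 and I = int int |v|^p Phi_2,
     I + c <= C T^A (1 + ||u||_q^q),           A = -2 + (1 + 2 N) / q',
     c <= d I + C d^(1 - p') T^(-p' + 1 + N)   for every d > 0,
   where the first bound uses that u is in L^q of space-time. The hypothesis on n
   makes A negative or lets d = T^(-e) send both terms of the second bound to 0.
   The integrals in time are treated as suprema over simple functions from below,
   so no measurability of t |-> u(t) or t |-> v(t) is needed. *)

From HB Require Import structures.
Require Import Defs.
From mathcomp Require Import all_boot all_order all_algebra.
From mathcomp Require Import all_classical all_reals all_analysis.
From mathcomp Require Import measurable_realfun ess_sup_inf.
From mathcomp Require Import complex ring lra.

Set Implicit Arguments.
Unset Strict Implicit.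
Unset Printing Implicit Defensive.

Import Order.TTheory GRing.Theory Num.Theory.
Import numFieldNormedType.Exports.

Local Open Scope classical_set_scope.
Local Open Scope ring_scope.
Import HBNNSimple.

(** * Integrals of nonmeasurable functions, dilations and Fubini *)

(** For noninteger sigma the operator (-Delta)^sigma is nonlocal: it spreads a compactly supported
    function over the whole space, so such a function cannot dominate its image, and a weight with
    polynomial decay is used. The exponent n + 1 is above n, for integrability, below n + 2 sigma,
    the decay to be expected of the image, and is exactly the one produced by integrating |u|^n
    exp(-u^2 a^2) over u. Two space scales occur. In the equation for u, k^sigma = T^(-2), so that
    (-Delta)^sigma balances two time derivatives; in the equation for v, k^sigma = T^(-1), so that
    it balances the damping v_t. The weights differ, but the profile decreases in k: for T >= 1 the
    integral of |v|^p at the second scale is at most I, which is at the first, and the two bounds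
    can be chained. The differences have order m with 2 m >= 1 + 2 sigma because a first difference
    represents |xi|^(2 sigma) only when sigma < 1. *)

Lemma ge0_le_integral_nomeas d (T : measurableType d) (R : realType)
    (mu : {measure set T -> \bar R}) (D : set T) (f g : T -> \bar R) :
  (forall x, D x -> (0 <= f x)%E) -> (forall x, D x -> (f x <= g x)%E) ->
  (\int[mu]_(x in D) f x <= \int[mu]_(x in D) g x)%E.
Proof.
move=> f0 fg.
have g0 x : D x -> (0 <= g x)%E by move=> Dx; exact: le_trans (f0 _ Dx) (fg _ Dx).
rewrite !ge0_integralE//; apply: ereal_sup_le => _ [h /= hf <-].
exists (h : {nnsfun T >-> R}) => // x; apply: (le_trans (hf x)).
by rewrite !patchE; case: ifPn => // /set_mem Dx; exact: fg.
Qed.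

(** The integral of f is at most that of its positive part, even when both parts have infinite
    integral, because +oo - +oo = -oo. *)
Lemma le_integral_pos_nomeas d (T : measurableType d) (R : realType)
    (mu : {measure set T -> \bar R}) (D : set T) (f g : T -> \bar R) :
  (forall x, D x -> (0 <= g x)%E) -> (forall x, D x -> (f x <= g x)%E) ->
  (\int[mu]_(x in D) f x <= \int[mu]_(x in D) g x)%E.
Proof.
move=> g0 fg; rewrite integralE.
apply: (@le_trans _ _ (\int[mu]_(x in D) f^\+ x)%E).
  have /= := @integral_ge0 _ _ _ mu D (f^\-)%E (fun x _ => funeneg_ge0 f x).
  case: (\int[mu]_(x in D) f^\+ x)%E (\int[mu]_(x in D) f^\- x)%E => [a||] [b||]//=.
    by rewrite !lee_fin lerBlDr lerDl.
  by rewrite addeNy leNye.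
apply: ge0_le_integral_nomeas => // x Dx; rewrite funeposE ge_max fg//=.
exact: g0.
Qed.

(** A supremum over simple functions from below is in general only superadditive. The reverse
    inequality comes from the measurability of g: if h is simple and below f + g, then max(h - g, 0)
    is measurable and below f. *)
Lemma ge0_integralD_nomeas d (T : measurableType d) (R : realType)
    (mu : {measure set T -> \bar R}) (f : T -> \bar R) (g : T -> R) :
  (forall x, (0 <= f x)%E) -> (forall x, 0 <= g x) ->
  measurable_fun setT g ->
  (\int[mu]_x (f x + (g x)%:E) <= \int[mu]_x f x + \int[mu]_x (g x)%:E)%E.
Proof.
move=> f0 g0 mg; rewrite [X in (X <= _)%E]ge0_integralTE; last first.
  by move=> x; rewrite adde_ge0 ?lee_fin.
apply: ub_ereal_sup => _ [h /= hfg <-].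
rewrite -integralT_nnsfun.
pose k x := Num.max (h x - g x) 0.
have mk : measurable_fun setT k.
  apply: measurable_maxr => //; apply: measurable_funB => //.
have k0 x : 0 <= k x by rewrite le_max lexx orbT.
apply: (@le_trans _ _ (\int[mu]_x ((k x)%:E + (g x)%:E))%E).
  apply: ge0_le_integral_nomeas => x _; first by rewrite lee_fin.
  by rewrite -EFinD lee_fin -lerBlDr le_max lexx.
rewrite ge0_integralD//; last 4 first.
- by move=> x _; rewrite lee_fin.
- exact/measurable_EFinP.
- by move=> x _; rewrite lee_fin.
- exact/measurable_EFinP.
rewrite leeD2r// ge0_le_integral_nomeas// => x _; first by rewrite lee_fin.
by rewrite /k EFin_max ge_max f0 andbT EFinB leeBlDr.
Qed.

Lemma ge0_integralZl_nomeas d (T : measurableType d) (R : realType)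
    (mu : {measure set T -> \bar R}) (f : T -> \bar R) (k : R) :
  (forall x, (0 <= f x)%E) -> 0 < k ->
  (\int[mu]_x (k%:E * f x) <= k%:E * \int[mu]_x f x)%E.
Proof.
move=> f0 k0; rewrite [X in (X <= _)%E]ge0_integralTE; last first.
  by move=> x; rewrite mule_ge0// lee_fin ltW.
apply: ub_ereal_sup => _ [h /= hfg <-].
rewrite -integralT_nnsfun.
have -> : (\int[mu]_x (h x)%:E = k%:E * \int[mu]_x (k^-1 * h x)%:E)%E.
  under [in RHS]eq_integral do rewrite EFinM.
  rewrite ge0_integralZl//; last 3 first.
  - exact/measurable_EFinP.
  - by move=> x _; rewrite lee_fin.
  - by rewrite lee_fin invr_ge0 ltW.
  by rewrite muleA -EFinM divff ?gt_eqF// mul1e.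
rewrite lee_pmul2l//; apply: ge0_le_integral_nomeas => x _.
  by rewrite lee_fin mulr_ge0// invr_ge0 ltW.
have kh : h x = k * (k^-1 * h x) by rewrite mulrA divff ?mul1r ?gt_eqF.
by rewrite -(@lee_pmul2l _ k%:E)// -EFinM -kh.
Qed.
(** Since f may fail to be measurable, the exceptional set is absorbed by g: raising g to +oo on a
    measurable null set N keeps its integral and makes the inequality hold everywhere on D. *)
Lemma ge0_ae_le_integral_nomeas d (T : measurableType d) (R : realType)
    (mu : {measure set T -> \bar R}) (D : set T) (f g : T -> \bar R) :
  measurable D -> measurable_fun D g ->
  (forall x, D x -> (0 <= f x)%E) -> (forall x, D x -> (0 <= g x)%E) ->
  {ae mu, forall x, D x -> (f x <= g x)%E} ->
  (\int[mu]_(x in D) f x <= \int[mu]_(x in D) g x)%E.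
Proof.
move=> mD mg f0 g0 [N [mN N0 fgN]].
pose h x := (g x + +oo * (\1_N x : R)%:E)%E.
apply: (@le_trans _ _ (\int[mu]_(x in D) h x)%E).
  apply: ge0_le_integral_nomeas => // x Dx; rewrite /h indicE.
  have [xN|xN] := boolP (x \in N).
    by rewrite mule1 addey ?leey// gt_eqF// (lt_le_trans _ (g0 _ Dx)).
  rewrite mule0 adde0; apply: contrapT => nfg; move/negP: xN; apply; rewrite inE.
  by apply: fgN => /= /(_ Dx).
have m1 : measurable_fun D (fun x => +oo * (\1_N x : R)%:E)%E.
  by apply: measurable_funeM; exact/measurable_EFinP/measurable_indic.
rewrite ge0_integralD//.
rewrite [X in (_ + X)%E](_ : _ = 0%E) ?adde0//.
rewrite ge0_integralZl// ?integral_indic//; last exact/measurable_EFinP/measurable_indic.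
by rewrite (@subset_measure0 _ _ _ mu (N `&` D) N) ?mule0//; exact: measurableI.
Qed.

Definition dilation (R : realType) (a : R) : measurableTypeR R -> measurableTypeR R :=
  fun x => a * x.

Lemma lebesgue_measureZ (R : realType) (a : R) (A : set R) : 0 < a -> measurable A ->
  (a%:E * pushforward lebesgue_measure (dilation a) A)%E =
  (lebesgue_measure A : \bar R).
Proof.
move=> a0 mA.
have mf : measurable_fun setT (dilation a).
  exact: measurable_funM.
apply/esym.
apply: (@lebesgue_measure_unique _ (mscale (NngNum (ltW a0)) (pushforward lebesgue_measure (dilation a)))) => //.
move=> _ [[b c]] _ <- /=.
rewrite /mscale/= /pushforward.
rewrite (_ : _ @^-1` _ = `]b / a, c / a]%classic); last first.
  by apply/seteqP; split => x /=; rewrite !in_itv/= ltr_pdivrMr// ler_pdivlMr// mulrC.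
rewrite !lebesgue_measure_itv/= !lte_fin ltr_pM2r ?invr_gt0//.
case: ifPn => _; last by rewrite mule0.
by rewrite -!EFinD -EFinM; congr EFin; field; rewrite gt_eqF.
Qed.

Lemma ge0_integral_scale (R : realType) (a : R) (f : R -> \bar R) : 0 < a ->
  measurable_fun setT f -> (forall x, 0 <= f x)%E ->
  (\int[lebesgue_measure]_x f x = a%:E * \int[lebesgue_measure]_x f (a * x)%R)%E.
Proof.
move=> a0 mf f0.
have mg : measurable_fun setT (dilation a).
  exact: measurable_funM.
rewrite (_ : (\int[lebesgue_measure]_x f (a * x)%R)%E = (\int[pushforward lebesgue_measure (dilation a)]_x f x)%E); last first.
  by rewrite ge0_integral_pushforward.
rewrite -(@ge0_integral_mscale _ _ _ (pushforward lebesgue_measure (dilation a)) setT measurableT (NngNum (ltW a0))) //.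
by apply: eq_measure_integral => //= A mA _; rewrite -(lebesgue_measureZ a0).
Qed.

(** The hypotheses are those that explicit kernels provide: an integrable majorant of the inner
    absolute integrals in one order, and integrability of every section, not almost every one, in
    the other. Real and extended inner integrals then agree at every point. *)
Lemma Rfubini d1 d2 (T1 : measurableType d1) (T2 : measurableType d2) (R : realType)
    (m1 : {sigma_finite_measure set T1 -> \bar R})
    (m2 : {sigma_finite_measure set T2 -> \bar R}) (f : T1 * T2 -> R) (g : T1 -> R) :
  measurable_fun setT f ->
  (forall x, (\int[m2]_y `|f (x, y)|%:E <= (g x)%:E)%E) ->
  m1.-integrable setT (EFin \o g) ->
  (forall y, m1.-integrable setT (EFin \o (fun x => f (x, y)))) ->
  [/\ \int[m1]_x \int[m2]_y f (x, y) = \int[m2]_y \int[m1]_x f (x, y),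
    m1.-integrable setT (EFin \o (fun x => \int[m2]_y f (x, y))) &
    m2.-integrable setT (EFin \o (fun y => \int[m1]_x f (x, y)))].
Proof.
move=> mf fg ig i1.
have mEf : measurable_fun setT (EFin \o f) by exact/measurable_EFinP.
have i2 x : m2.-integrable setT (EFin \o (fun y => f (x, y))).
  apply/integrableP; split.
    by apply/measurable_EFinP; exact: measurableT_comp.
  by apply: le_lt_trans (fg x) _; rewrite ltry.
have If : (m1 \x m2)%E.-integrable setT (EFin \o f).
  apply/integrable12ltyP => //.
  apply: (@le_lt_trans _ _ (\int[m1]_x (g x)%:E)%E).
    by apply: ge0_le_integral_nomeas => x _; [exact: integral_ge0|exact: fg].
  by have := integrable_lty measurableT ig.
have F1 x : (\int[m2]_y f (x, y))%:E = (\int[m2]_y (f (x, y))%:E)%E.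
  by rewrite fineK// integrable_fin_num//; exact: i2.
have F2 y : (\int[m1]_x f (x, y))%:E = (\int[m1]_x (f (x, y))%:E)%E.
  by rewrite fineK// integrable_fin_num//; exact: i1.
split.
- congr fine; under eq_integral do rewrite F1.
  by under [RHS]eq_integral do rewrite F2; exact: (Fubini If).
- by rewrite (_ : _ \o _ = (fun x => \int[m2]_y (f (x, y))%:E)%E); [exact: (integrable_fubini_F If)|exact/funext/F1].
- rewrite (_ : _ \o _ = (fun y => \int[m1]_x (f (x, y))%:E)%E); last exact/funext/F2.
  have mfs : measurable_fun setT (fun z : T2 * T1 => f (z.2, z.1)).
    by apply: measurableT_comp mf _; exact: measurable_fun_pair measurable_snd measurable_fst.
  apply: (@integrable_fubini_F _ _ _ _ _ m2 m1 (fun z : T2 * T1 => (f (z.2, z.1))%:E)).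
  apply/integrable12ltyP; first exact/measurable_EFinP.
  have /integrable12ltyP-/(_ mEf) := If.
  have mabs : measurable_fun setT (abse \o (EFin \o f)) by exact: measurableT_comp mEf.
  by have /= -> := @fubini_tonelli _ _ _ _ _ m1 m2 (abse \o (EFin \o f)) mabs (fun=> abse_ge0 _).
Qed.

(** * Measurability and derivatives by syntax *)

Lemma expR_measurable d (T : measurableType d) (R : realType) (f : T -> R) :
  measurable_fun setT f -> measurable_fun setT (fun x => expR (f x)).
Proof. by move=> mf; exact: (measurableT_comp (@measurable_expR R)). Qed.

Lemma sin_measurable d (T : measurableType d) (R : realType) (f : T -> R) :
  measurable_fun setT f -> measurable_fun setT (fun x => sin (f x)).
Proof.
by move=> mf; apply: (measurableT_comp _ mf); exact: continuous_measurable_fun (@continuous_sin R).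
Qed.

Lemma cos_measurable d (T : measurableType d) (R : realType) (f : T -> R) :
  measurable_fun setT f -> measurable_fun setT (fun x => cos (f x)).
Proof.
by move=> mf; apply: (measurableT_comp _ mf); exact: continuous_measurable_fun (@continuous_cos R).
Qed.

Lemma sqrt_measurable d (T : measurableType d) (R : realType) (f : T -> R) :
  measurable_fun setT f -> measurable_fun setT (fun x => Num.sqrt (f x)).
Proof.
by move=> mf; apply: (measurableT_comp _ mf); exact: continuous_measurable_fun (@sqrt_continuous R).
Qed.

Lemma powR_measurable d (T : measurableType d) (R : realType) (f : T -> R) (p : R) :
  measurable_fun setT f -> measurable_fun setT (fun x => f x `^ p).
Proof. by move=> mf; apply: (measurableT_comp (measurable_powR _) mf). Qed.

Lemma norm_measurable d (T : measurableType d) (R : realType) (f : T -> R) :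
  measurable_fun setT f -> measurable_fun setT (fun x => `|f x|).
Proof. by move=> mf; apply: (measurableT_comp _ mf). Qed.

Lemma opp_measurable d (T : measurableType d) (R : realType) (f : T -> R) :
  measurable_fun setT f -> measurable_fun setT (fun x => - f x).
Proof.
move=> mf; rewrite (_ : (fun x => _) = (fun x => 0 - f x)).
  exact: measurable_funB.
by apply/funext => x; rewrite sub0r.
Qed.

Lemma inv_measurable d (T : measurableType d) (R : realType) (f : T -> R) :
  measurable_fun setT f -> measurable_fun setT (fun x => (f x)^-1).
Proof.
(* The identity also holds at the zeros of f, where the inverse is 0 by convention. *)
move=> mf; have -> : (fun x => (f x)^-1) = (fun x => f x * (`|f x| `^ (-1)) ^+ 2).
  apply/funext => x; have [->|fx0] := eqVneq (f x) 0; first by rewrite invr0 mul0r.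
  rewrite powR_inv1// exprVn -normrX ger0_norm ?sqr_ge0//.
  by field.
apply: measurable_funM => //; apply: measurable_funX; apply: powR_measurable; exact: norm_measurable.
Qed.

Lemma dot_measurable (R : realType) n (xi : 'rV[R]_n) d (T : measurableType d) (f : T -> 'rV[R]_n) :
  measurable_fun setT f -> measurable_fun setT (fun x => dot_rV xi (f x)).
Proof.
move=> mf; apply: measurable_sum => i; apply: measurable_funM => //.
exact: (measurableT_comp (measurable_coord i)).
Qed.

Lemma dotr_measurable (R : realType) n (xi : 'rV[R]_n) d (T : measurableType d) (f : T -> 'rV[R]_n) :
  measurable_fun setT f -> measurable_fun setT (fun x => dot_rV (f x) xi).
Proof.
move=> mf; apply: measurable_sum => i; apply: measurable_funM => //.
exact: (measurableT_comp (measurable_coord i)).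
Qed.

Lemma dotxx_measurable (R : realType) n d (T : measurableType d) (f : T -> 'rV[R]_n) :
  measurable_fun setT f -> measurable_fun setT (fun x => dot_rV (f x) (f x)).
Proof.
move=> mf; apply: measurable_sum => i; apply: measurable_funM => //;
exact: (measurableT_comp (measurable_coord i)).
Qed.

Ltac solve_measurable := repeat first [ exact: measurable_cst | exact: measurable_id
  | exact: measurable_fst | exact: measurable_snd | assumption
  | apply: expR_measurable | apply: sin_measurable | apply: cos_measurable | apply: sqrt_measurable | apply: powR_measurable | apply: norm_measurable
  | apply: inv_measurable | apply: dotxx_measurable | apply: dot_measurable | apply: dotr_measurable
  | apply: measurable_funX | apply: measurable_funB | apply: measurable_funD
  | apply: measurable_funM | apply: opp_measurable ].

Lemma cst_is_derive (R : realType) (x c : R) : is_derive x (1 : R) (fun=> c) 0.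
Proof. exact: is_derive_cst. Qed.

Lemma id_is_derive (R : realType) (x : R) : is_derive x (1 : R) (fun y : R => y) 1.
Proof. exact: is_derive_id. Qed.

Lemma add_is_derive (R : realType) (f g : R -> R) (x a b : R) :
  is_derive x (1 : R) f a -> is_derive x (1 : R) g b ->
  is_derive x (1 : R) (fun y => f y + g y) (a + b).
Proof. by move=> df dg; exact: is_deriveD. Qed.

Lemma opp_is_derive (R : realType) (f : R -> R) (x a : R) :
  is_derive x (1 : R) f a -> is_derive x (1 : R) (fun y => - f y) (- a).
Proof. by move=> df; exact: is_deriveN. Qed.

Lemma mul_is_derive (R : realType) (f g : R -> R) (x a b : R) :
  is_derive x (1 : R) f a -> is_derive x (1 : R) g b ->
  is_derive x (1 : R) (fun y => f y * g y) (f x * b + g x * a).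
Proof. by move=> df dg; exact: is_deriveM. Qed.

Lemma expn_is_derive (R : realType) (f : R -> R) (x a : R) (n : nat) :
  is_derive x (1 : R) f a ->
  is_derive x (1 : R) (fun y => f y ^+ n) (n%:R * f x ^+ n.-1 * a).
Proof.
move=> df; have := is_deriveX n df; rewrite (_ : f ^+ n = fun y => f y ^+ n)//.
by apply/funext => y; rewrite fctE.
Qed.

Lemma compR_is_derive (R : realType) (h f : R -> R) (x a b : R) :
  is_derive (f x) (1 : R) h b -> is_derive x (1 : R) f a ->
  is_derive x (1 : R) (fun y => h (f y)) (b * a).
Proof. exact: is_derive1_comp. Qed.

Lemma expR_is_derive (R : realType) (f : R -> R) (x a : R) :
  is_derive x (1 : R) f a -> is_derive x (1 : R) (fun y => expR (f y)) (expR (f x) * a).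
Proof. by apply: (compR_is_derive (h := @expR R)); exact: is_derive_expR. Qed.

Lemma sin_is_derive (R : realType) (f : R -> R) (x a : R) :
  is_derive x (1 : R) f a -> is_derive x (1 : R) (fun y => sin (f y)) (cos (f x) * a).
Proof. by apply: (compR_is_derive (h := @sin R)); exact: is_derive_sin. Qed.

Lemma cos_is_derive (R : realType) (f : R -> R) (x a : R) :
  is_derive x (1 : R) f a -> is_derive x (1 : R) (fun y => cos (f y)) (- sin (f x) * a).
Proof. by apply: (compR_is_derive (h := @cos R)); exact: is_derive_cos. Qed.

Lemma inv_is_derive (R : realType) (f : R -> R) (x a : R) : f x != 0 ->
  is_derive x (1 : R) f a -> is_derive x (1 : R) (fun y => (f y)^-1) (- (f x) ^- 2 * a).
Proof. by move=> fx0 df; have := is_deriveV fx0 df. Qed.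

Lemma sqrt_is_derive (R : realType) (f : R -> R) (x a : R) : 0 < f x ->
  is_derive x (1 : R) f a ->
  is_derive x (1 : R) (fun y => Num.sqrt (f y)) ((2 * Num.sqrt (f x))^-1 * a).
Proof. by move=> fx0; apply: (compR_is_derive (h := @Num.sqrt R)); exact: is_derive1_sqrt. Qed.

Lemma ln_is_derive (R : realType) (f : R -> R) (x a : R) : 0 < f x ->
  is_derive x (1 : R) f a -> is_derive x (1 : R) (fun y => ln (f y)) ((f x)^-1 * a).
Proof. by move=> fx0; apply: (compR_is_derive (h := @ln R)); exact: is_derive1_ln. Qed.

Ltac solve_derive := eapply is_derive_eq; [repeat first [ eassumption | eapply cst_is_derive | eapply id_is_derive
  | eapply expR_is_derive | eapply sin_is_derive | eapply cos_is_derive | eapply expn_is_derive | eapply opp_is_derive | eapply mul_is_derive | eapply add_is_derive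
  | eapply inv_is_derive | eapply sqrt_is_derive | eapply ln_is_derive ] | rewrite /= ].

Lemma is_derive_continuous (R : realType) (f : R -> R) (x a : R) :
  is_derive x (1 : R) f a -> {for x, continuous f}.
Proof.
move=> df; apply: differentiable_continuous; apply/derivable1_diffP; exact: ex_derive.
Qed.

Lemma expR_ge_pow (R : realType) (k : nat) (x : R) : 0 <= x -> x ^+ k <= k`!%:R * expR x.
Proof.
move=> x0; case: k => [|k]; first by rewrite expr0 mul1r -expR0 ler_expR// .
have := expR_ge1Dxn k x0; rewrite -(@ler_pM2l _ (k.+1)`!%:R) ?ltr0n ?fact_gt0//.
apply: le_trans; rewrite mulrDr mulr1 mulrC mulrVK ?unitfE ?pnatr_eq0 -?lt0n ?fact_gt0//.
by rewrite lerDr.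
Qed.

(** * The Fourier transform of a Gaussian *)

(** Half of the exponent absorbs the power: |x|^k <= 1 + (x^2)^k, and y^k <= k! exp(y) is applied to
    y = (s / 2) x^2. *)
Lemma gauss_dom (R : realType) (s : R) (k : nat) (x : R) : 0 < s ->
  `|x| ^+ k * expR (- (s * x ^+ 2)) <=
  (1 + (2 / s) ^+ k * k`!%:R) * expR (- (s / 2 * x ^+ 2)).
Proof.
move=> s0.
have xk : `|x| ^+ k <= 1 + (x ^+ 2) ^+ k.
  have [x1|x1] := leP `|x| 1.
    rewrite (@le_trans _ _ 1)//; first exact: exprn_ile1.
    by rewrite lerDl exprn_ge0// sqr_ge0.
  rewrite -normrX -(real_normK (num_real x)) exprAC -[leLHS]add0r lerD//.
  rewrite normrX; have : 1 <= `|x| ^+ k by rewrite exprn_ege1// ltW.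
  by move=> h; rewrite expr2 ler_peMl// exprn_ge0.
have e2 : (x ^+ 2) ^+ k <= (2 / s) ^+ k * k`!%:R * expR (s / 2 * x ^+ 2).
  have y0 : 0 <= s / 2 * x ^+ 2 by rewrite mulr_ge0// ?sqr_ge0// divr_ge0// ltW.
  have := expR_ge_pow k y0.
  rewrite -(@ler_pM2l _ ((2 / s) ^+ k)) ?exprn_gt0 ?divr_gt0// => h.
  rewrite -[leRHS]mulrA; apply: le_trans h; rewrite -exprMn (_ : 2 / s * _ = x ^+ 2)//.
  by field; rewrite gt_eqF.
have -> : expR (- (s * x ^+ 2)) = expR (- (s / 2 * x ^+ 2)) * expR (- (s / 2 * x ^+ 2)).
  by rewrite -expRD; congr expR; field.
rewrite mulrA ler_pM2r ?expR_gt0//.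
rewrite [leRHS](_ : _ = (1 + (2 / s) ^+ k * k`!%:R) * expR (s / 2 * x ^+ 2) * expR (- (s / 2 * x ^+ 2))); last first.
  by rewrite -mulrA -expRD subrr expR0 mulr1.
rewrite ler_pM2r ?expR_gt0// (le_trans xk)// mulrDl mul1r lerD//.
by rewrite -expR0 ler_expR mulr_ge0// ?sqr_ge0// divr_ge0// ltW.
Qed.

Lemma integral_gauss (R : realType) (s : R) : 0 < s ->
  (\int[lebesgue_measure]_x (expR (- (s * x ^+ 2)))%:E = (Num.sqrt (pi / s))%:E)%E.
Proof.
move=> s0; have q0 : 0 < Num.sqrt s by rewrite sqrtr_gt0.
have := @integralT_gauss R; rewrite (ge0_integral_scale q0); last 2 first.
- by apply/measurable_EFinP; exact: measurable_gauss_fun.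
- by move=> x; rewrite lee_fin gauss_fun_ge0.
have -> : (fun x : R => (gauss_fun (Num.sqrt s * x))%:E) = (fun x => (expR (- (s * x ^+ 2)))%:E).
  by apply/funext => x; rewrite /gauss_fun exprMn sqr_sqrtr// ltW.
move=> h.
have : ((Num.sqrt s)^-1%:E * ((Num.sqrt s)%:E * \int[lebesgue_measure]_x (expR (- (s * x ^+ 2)))%:E) = (Num.sqrt s)^-1%:E * (Num.sqrt pi)%:E)%E.
  by rewrite h.
rewrite muleA -EFinM mulVf ?gt_eqF// mul1e => ->.
by rewrite -EFinM sqrtrM ?pi_ge0// sqrtrV ?ltW// mulrC.
Qed.

Lemma integrable_gauss (R : realType) (s : R) (k : nat) : 0 < s ->
  lebesgue_measure.-integrable setT (EFin \o (fun x : R => `|x| ^+ k * expR (- (s * x ^+ 2)))).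
Proof.
move=> s0.
have g0 r : 0 < r -> lebesgue_measure.-integrable setT (EFin \o (fun x : R => expR (- (r * x ^+ 2)))).
  move=> r0; apply/integrableP; split; first by apply/measurable_EFinP; solve_measurable.
  under eq_integral do rewrite /= ger0_norm ?expR_ge0//.
  by rewrite integral_gauss// ltry.
have s20 : 0 < s / 2 by rewrite divr_gt0.
apply: (le_integrable measurableT _ _ (integrableZl measurableT (1 + (2 / s) ^+ k * k`!%:R) (g0 _ s20))).
  by apply/measurable_EFinP; solve_measurable.
move=> x _ /=; rewrite lee_fin.
rewrite [leLHS]ger0_norm; last by rewrite mulr_ge0// ?expR_ge0// exprn_ge0.
by apply: le_trans (ler_norm _); exact: gauss_dom.
Qed.

(** The fundamental theorem of calculus on [-(n+1), n+1], followed by dominated convergence; the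
    shift by one keeps the interval nondegenerate at n = 0. *)
Lemma integral_derive_eq0 (R : realType) (F f : R -> R) :
  (forall x, is_derive x (1 : R) F (f x)) -> continuous f ->
  lebesgue_measure.-integrable setT (EFin \o f) ->
  F x @[x --> +oo%R] --> (0 : R) -> F x @[x --> -oo%R] --> (0 : R) ->
  \int[lebesgue_measure]_x f x = 0.
Proof.
move=> dF cf intf Fp Fm.
have cF x : {for x, continuous F} by apply: is_derive_continuous; exact: dF.
pose I (n : nat) : set R := `[- n.+1%:R, n.+1%:R]%classic.
pose g (n : nat) : R -> \bar R := (EFin \o f) \_ (I n).
have mf : measurable_fun setT (EFin \o f).
  by apply/measurable_EFinP; exact: continuous_measurable_fun.
have mg n : measurable_fun setT (g n).
  apply/(measurable_restrictT _ _).1 => //.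
    exact: measurable_itv.
  exact: measurable_funTS.
have gf : {ae (@lebesgue_measure R), forall x, setT x -> g n x @[n --> \oo] --> (EFin \o f) x}.
  apply: aeW => x _; apply: cvg_near_cst; near=> n.
  rewrite /g patchE mem_set//= /I/= in_itv/= -ler_norml.
  have : `|x| <= n%:R by near: n; exact: nbhs_infty_ger.
  by move/le_trans; apply; rewrite ler_nat.
have gd : {ae (@lebesgue_measure R), forall x n, setT x -> (`|g n x| <= (abse \o (EFin \o f)) x)%E}.
  by apply: aeW => x n _; rewrite /g patchE; case: ifPn => //= _; rewrite normr0 lee_fin.
have h : (\int[lebesgue_measure]_x g n x @[n --> \oo] --> \int[lebesgue_measure]_x (EFin \o f) x)%E.
  by have [] := @dominated_convergence _ _ _ lebesgue_measure _ measurableT _ _ _ mg mf gf (integrable_abse intf) gd.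
have gE n : (\int[lebesgue_measure]_x g n x = (F n.+1%:R - F (- n.+1%:R))%:E)%E.
  rewrite /g -integral_mkcond /I.
  rewrite (@continuous_FTC2 _ f F) ?EFinB//.
  - by rewrite -subr_gt0 opprK addr_gt0// ltr0n.
  - exact: continuous_subspaceT.
  - split => [x _||]; first by have dx := dF x; exact: ex_derive.
    + by apply: cvg_at_right_filter; exact: cF.
    + by apply: cvg_at_left_filter; exact: cF.
  - by move=> x _; rewrite derive1E; have dx := dF x; exact: derive_val.
have h0 : (\int[lebesgue_measure]_x g n x @[n --> \oo] --> (0 : R)%:E)%E.
  under eq_fun do rewrite gE.
  apply: cvg_EFin; first exact: nearW.
  rewrite -[X in _ --> X](subrr 0); apply: cvgB.
  - apply: (cvg_comp (fun n : nat => n.+1%:R : R) F _ Fp).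
    by apply/cvgryPge => A; near=> n; rewrite (@le_trans _ _ n%:R) ?ler_nat//; near: n; exact: nbhs_infty_ger.
  - apply: (cvg_comp (fun n : nat => - n.+1%:R : R) F _ Fm).
    by apply/cvgrNyPle => A; near=> n; rewrite lerNl (@le_trans _ _ n%:R) ?ler_nat//; near: n; exact: nbhs_infty_ger.
have hE : (\int[lebesgue_measure]_x (EFin \o f) x = (0 : R)%:E)%E.
  by apply: cvg_unique h h0; exact: ereal_hausdorff.
by rewrite /Rintegral hE.
Unshelve. all: by end_near. Qed.

Lemma cvg_gauss_pinfty (R : realType) (s : R) : 0 < s ->
  expR (- (s * x ^+ 2)) @[x --> +oo%R] --> (0 : R).
Proof.
move=> s0; apply: (cvg_comp (fun x : R => s * x ^+ 2) (fun y => expR (- y)) _ (@cvgr_expR R)).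
apply: gt0_cvgMry => //; exact: cvgr_expr2.
Qed.

Lemma cvg_gauss_ninfty (R : realType) (s : R) : 0 < s ->
  expR (- (s * x ^+ 2)) @[x --> -oo%R] --> (0 : R).
Proof.
move=> s0; apply/cvgNy_compNP; rewrite (_ : _ \o _ = fun x => expR (- (s * x ^+ 2))).
  exact: cvg_gauss_pinfty.
by apply/funext => x /=; rewrite sqrrN.
Qed.

Lemma integrable_dom (R : realType) d (T : measurableType d) (mu : {measure set T -> \bar R})
    (f g : T -> R) : measurable_fun setT f -> (forall x, `|f x| <= g x) ->
  mu.-integrable setT (EFin \o g) -> mu.-integrable setT (EFin \o f).
Proof.
move=> mf fg; apply: (le_integrable measurableT); first exact/measurable_EFinP.
by move=> x _ /=; rewrite lee_fin (le_trans (fg x))// ler_norm.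
Qed.

(** Differentiation under the integral sign brings down a factor -x. Integration by parts trades it
    for a multiple of xi: the x-derivative of sin(x xi) exp(-s x^2) contains both expressions and
    has integral 0. *)
Lemma gauss_fourier_deriv (R : realType) (s xi : R) : 0 < s ->
  is_derive xi (1 : R)
    (fun xi : R => \int[lebesgue_measure]_x (cos (x * xi) * expR (- (s * x ^+ 2))))
    (- (xi / (2 * s)) * \int[lebesgue_measure]_x (cos (x * xi) * expR (- (s * x ^+ 2)))).
Proof.
move=> s0.
pose F := fun y x : R => cos (x * y) * expR (- (s * x ^+ 2)).
have i0 := integrable_gauss 0 s0; have i1 := integrable_gauss 1 s0.
have e0 (x : R) := expR_ge0 (- (s * x ^+ 2)).
have intF y : lebesgue_measure.-integrable setT (EFin \o F y).
  apply: (integrable_dom _ _ i0); first by rewrite /F; solve_measurable.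
  by move=> x; rewrite /F expr0 mul1r normrM (ger0_norm (e0 x)) ler_piMl// cos_max.
have dF y x : is_derive y (1 : R) (F ^~ x) (- x * sin (x * y) * expR (- (s * x ^+ 2))).
  by rewrite /F; solve_derive; ring.
have DF y x : partial1of2 F y x = - x * sin (x * y) * expR (- (s * x ^+ 2)).
  by rewrite partial1of2E; have := dF y x => /@derive_val.
have dom x y : `]xi - 1, xi + 1[%classic x -> setT y -> `|partial1of2 F x y| <= `|y| ^+ 1 * expR (- (s * y ^+ 2)).
  move=> _ _; rewrite DF expr1 !normrM normrN (ger0_norm (e0 y)) ler_pM2r ?expR_gt0//.
  by rewrite ler_piMr// sin_max.
have Ixi : `]xi - 1, xi + 1[%classic xi by rewrite /= in_itv/= ltrBlDr !ltrDl ltr01.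
have G0 (y : R) : 0 <= `|y| ^+ 1 * expR (- (s * y ^+ 2)) by rewrite mulr_ge0.
have dF' x y : `]xi - 1, xi + 1[%classic x -> setT y -> derivable (F ^~ y) x 1.
  by move=> _ _; exact: ex_derive.
have H1 := derivable_under_integral measurableT Ixi (fun y _ => intF y) dF' G0 i1 dom.
have H2 := differentiation_under_integral measurableT Ixi (fun y _ => intF y) dF' G0 i1 dom.
apply: DeriveDef => //.
rewrite -derive1E H2.
under eq_Rintegral do rewrite DF.
pose g x := sin (x * xi) * expR (- (s * x ^+ 2)).
have dg (x : R) : is_derive x (1 : R) g (xi * F xi x + (2 * s) * (- x * sin (x * xi) * expR (- (s * x ^+ 2)))).
  by rewrite /g /F; solve_derive; ring.
have is1 : lebesgue_measure.-integrable setT (EFin \o (fun x => - x * sin (x * xi) * expR (- (s * x ^+ 2)))).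
  apply: (integrable_dom _ _ i1); first by solve_measurable.
  move=> x; rewrite expr1 !normrM normrN (ger0_norm (e0 x)) ler_pM2r ?expR_gt0//.
  by rewrite ler_piMr// sin_max.
have ia := integrableZl measurableT xi (intF xi).
have ib := integrableZl measurableT (2 * s) is1.
have gb (x : R) : - expR (- (s * x ^+ 2)) <= g x <= expR (- (s * x ^+ 2)).
  by rewrite -ler_norml /g normrM (ger0_norm (e0 x)) ler_piMl// sin_max.
have h : xi * \int[lebesgue_measure]_x F xi x + 2 * s *
    \int[lebesgue_measure]_x (- x * sin (x * xi) * expR (- (s * x ^+ 2))) = 0.
  have <- : \int[lebesgue_measure]_x (xi * F xi x) = xi * \int[lebesgue_measure]_x F xi x.
    exact: RintegralZl.
  rewrite -RintegralZl// -RintegralD//.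
  apply: (integral_derive_eq0 dg).
  - move=> x; eapply is_derive_continuous; rewrite /F; solve_derive; reflexivity.
  - exact: (integrableD measurableT ia ib).
  - apply: (@squeeze_cvgr _ _ _ _ (fun x => - expR (- (s * x ^+ 2)))
      (fun x => expR (- (s * x ^+ 2)))); first exact: nearW.
      by rewrite -oppr0; apply: cvgN; exact: cvg_gauss_pinfty.
    exact: cvg_gauss_pinfty.
  - apply: (@squeeze_cvgr _ _ _ _ (fun x => - expR (- (s * x ^+ 2)))
      (fun x => expR (- (s * x ^+ 2)))); first exact: nearW.
      by rewrite -oppr0; apply: cvgN; exact: cvg_gauss_ninfty.
    exact: cvg_gauss_ninfty.
apply: (@mulfI _ (2 * s)); first by rewrite mulf_neq0// gt_eqF.
rewrite -/(F xi) (_ : 2 * s * (- _ * _) = - (xi * \int[lebesgue_measure]_x F xi x)); last first.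
  by rewrite /F; field; rewrite gt_eqF.
by apply/eqP; rewrite -addr_eq0 addrC h.
Qed.

(** The linear differential equation in xi is solved with the integrating factor exp(xi^2 / (4 s));
    the value at xi = 0 is the Gaussian integral. *)
Lemma gauss_fourier1 (R : realType) (s xi : R) : 0 < s ->
  \int[lebesgue_measure]_x (cos (x * xi) * expR (- (s * x ^+ 2))) =
  Num.sqrt (pi / s) * expR (- (xi ^+ 2 / (4 * s))).
Proof.
move=> s0.
pose f (xi : R) := \int[lebesgue_measure]_x (cos (x * xi) * expR (- (s * x ^+ 2))).
have df y : is_derive y (1 : R) (fun y => f y * expR (y ^+ 2 / (4 * s))) 0.
  have d1 := gauss_fourier_deriv y s0; rewrite -/(f y) -/f in d1.
  by solve_derive; rewrite -/f -/(f y); field; rewrite gt_eqF.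
have fc := is_derive_0_is_cst _ _ df.
have f0 : f 0 = Num.sqrt (pi / s).
  rewrite /f /Rintegral; under eq_integral do rewrite mulr0 cos0 mul1r.
  by rewrite integral_gauss.
rewrite -/(f xi) expRN -f0; apply: (@mulIf _ (expR (xi ^+ 2 / (4 * s)))).
  by rewrite gt_eqF ?expR_gt0.
rewrite (fc xi 0) expr0n mul0r expR0 mulr1 -mulrA mulVf ?mulr1//.
by rewrite gt_eqF ?expR_gt0.
Qed.

Lemma gauss_fourier1_sin (R : realType) (s xi : R) : 0 < s ->
  \int[lebesgue_measure]_x (sin (x * xi) * expR (- (s * x ^+ 2))) = 0.
Proof.
move=> s0.
have e0 (x : R) := expR_ge0 (- (s * x ^+ 2)).
have i : lebesgue_measure.-integrable setT (EFin \o (fun x : R => sin (x * xi) * expR (- (s * x ^+ 2)))).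
  apply: (integrable_dom _ _ (integrable_gauss 0 s0)); first by solve_measurable.
  by move=> x; rewrite expr0 mul1r normrM (ger0_norm (e0 x)) ler_piMl// sin_max.
suff : \int[lebesgue_measure]_x (sin (x * xi) * expR (- (s * x ^+ 2))) =
     - \int[lebesgue_measure]_x (sin (x * xi) * expR (- (s * x ^+ 2))).
  by move=> /eqP; rewrite -addr_eq0 -mulr2n mulrn_eq0/= => /eqP.
rewrite -mulN1r -RintegralZl//.
congr fine.
have mN : measurable_fun setT (-%R : R -> measurableTypeR R) by apply: (@opp_measurable _ _ R id); exact: measurable_id.
transitivity (\int[pushforward lebesgue_measure (-%R : R -> measurableTypeR R)]_x (sin (x * xi) * expR (- (s * x ^+ 2)))%:E)%E.
  by apply: eq_measure_integral => //= A mA _; rewrite -lebesgue_measureN.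
have NE : (EFin \o (fun x : R => sin (x * xi) * expR (- (s * x ^+ 2)))) \o -%R =
    (fun x => (-1 * (sin (x * xi) * expR (- (s * x ^+ 2))))%:E).
  by apply/funext => x /=; rewrite (mulNr x xi) sinN sqrrN mulN1r mulNr.
rewrite integral_pushforward//; last 2 first.
- by apply/measurable_EFinP; solve_measurable.
- by rewrite preimage_setT NE; exact: (integrableZl measurableT (-1) i).
by rewrite preimage_setT NE.
Qed.

Lemma rVunconsK (R : realType) n : cancel (@rVuncons R n) (@rVcons R n).
Proof.
move=> x; apply/rowP => i; have [j ->|->] := unliftP ord0 i; first by rewrite rVconsS/= mxE.
by rewrite rVcons0.
Qed.

Lemma integral_rVS_prod (R : realType) n (g : R -> R) (h : 'rV[R]_n -> R) (f : 'rV[R]_n.+1 -> R) :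
  (forall a y, f (rVcons (a, y)) = g a * h y) ->
  lebesgue_measure.-integrable setT (EFin \o g) ->
  (lebesgue_rV n).-integrable setT (EFin \o h) ->
  (lebesgue_rV n.+1).-integrable setT (EFin \o f) /\
  \int[lebesgue_rV n.+1]_x f x = (\int[lebesgue_measure]_a g a) * (\int[lebesgue_rV n]_y h y).
Proof.
move=> fE ig ih.
have mg : measurable_fun setT g by case/integrableP : ig => /measurable_EFinP.
have mh : measurable_fun setT h by case/integrableP : ih => /measurable_EFinP.
pose k (z : measurableTypeR R * 'rV[R]_n) := g z.1 * h z.2.
have mk : measurable_fun setT k.
  by apply: measurable_funM; [exact: measurableT_comp mg _|exact: measurableT_comp mh _].
have fk : f = k \o (@rVuncons R n).
  by apply/funext => x; rewrite -[in LHS](rVunconsK x) /comp /k; case: (rVuncons x) => a y; rewrite fE.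
have kf : k = f \o (@rVcons R n) by apply/funext => -[a y]; rewrite /= fE.
have mf : measurable_fun setT f.
  by rewrite fk; exact: measurableT_comp mk (@measurable_rVuncons R n).
have hfin := integrable_fin_num measurableT ih.
have ik : (lebesgue_measure \x lebesgue_rV n)%E.-integrable setT (EFin \o k).
  apply/integrable12ltyP; first exact/measurable_EFinP.
  have ih' := integrable_fin_num measurableT (integrable_norm ih).
  have E a : (\int[lebesgue_rV n]_y `|(EFin \o k) (a, y)| =
      (fine (\int[lebesgue_rV n]_y `|h y|%:E))%:E * `|g a|%:E)%E.
    rewrite (_ : (fun y => _) = fun y => (`|g a|%:E * `|h y|%:E)%E); last first.
      by apply/funext => y; rewrite /= /k normrM EFinM.
    by rewrite fineK// muleC ge0_integralZl//; apply/measurable_EFinP; exact: norm_measurable.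
  under eq_integral do rewrite E.
  rewrite ge0_integralZl//; last 2 first.
  - by apply/measurable_EFinP; exact: norm_measurable.
  - by rewrite lee_fin fine_ge0// integral_ge0.
  rewrite lte_mul_pinfty//.
  - by rewrite lee_fin fine_ge0// integral_ge0.
  - by have := integrable_lty measurableT (integrable_norm ig).
split.
  have := @integrable_pushforward _ _ _ _ _ _ (@measurable_rVcons R n) (lebesgue_measure \x lebesgue_rV n)%E setT (EFin \o f).
  rewrite preimage_setT; apply => //.
  - exact/measurable_EFinP.
  - by rewrite -compA -kf.
rewrite /Rintegral.
transitivity (fine (\int[pushforward (lebesgue_measure \x lebesgue_rV n)%E (@rVcons R n)]_x (f x)%:E)).
  by congr fine; apply: eq_measure_integral.
rewrite integral_pushforward//; first last.
- by rewrite preimage_setT -compA -kf.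
- exact/measurable_EFinP.
- exact: measurable_rVcons.
rewrite preimage_setT (_ : _ \o _ = EFin \o k); last by rewrite -compA -kf.
rewrite -integral12_prod_meas1//= /fubini_F.
have E a : (\int[lebesgue_rV n]_y (EFin \o k) (a, y) =
    (fine (\int[lebesgue_rV n]_y (EFin \o h) y))%:E * (g a)%:E)%E.
  rewrite (_ : (fun y => _) = fun y => ((g a)%:E * (h y)%:E)%E); last first.
    by apply/funext => y; rewrite /= /k EFinM.
  by rewrite fineK// muleC integralZl.
under eq_integral do rewrite E.
rewrite integralZl//= fineM//; last exact: integrable_fin_num.
by rewrite mulrC.
Qed.

Lemma dot_rVS (R : realType) n a (y : 'rV[R]_n) b (z : 'rV[R]_n) :
  dot_rV (rVcons (a, y)) (rVcons (b, z)) = a * b + dot_rV y z.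
Proof.
rewrite /dot_rV big_ord_recl !rVcons0; congr (_ + _).
by apply: eq_bigr => i _; rewrite !rVconsS.
Qed.

Lemma dot_rV_ge0 (R : realType) n (x : 'rV[R]_n) : 0 <= dot_rV x x.
Proof. by apply: sumr_ge0 => i _; rewrite -expr2 sqr_ge0. Qed.

(** Cosine and sine are carried together because the addition formulas couple them in the induction
    on n. Since the sine integrals vanish, only the product of the cosine integrals survives. *)
Lemma gauss_fourier (R : realType) n (s : R) (xi : 'rV[R]_n) : 0 < s ->
  [/\ (lebesgue_rV n).-integrable setT
        (EFin \o (fun x => cos (dot_rV x xi) * expR (- (s * dot_rV x x)))),
      (lebesgue_rV n).-integrable setT
        (EFin \o (fun x => sin (dot_rV x xi) * expR (- (s * dot_rV x x)))),
      \int[lebesgue_rV n]_x (cos (dot_rV x xi) * expR (- (s * dot_rV x x))) =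
        Num.sqrt (pi / s) ^+ n * expR (- (dot_rV xi xi / (4 * s))) &
      \int[lebesgue_rV n]_x (sin (dot_rV x xi) * expR (- (s * dot_rV x x))) = 0].
Proof.
move=> s0; elim: n xi => [|n IH] xi.
  have d0 (x y : 'rV[R]_0) : dot_rV x y = 0 by rewrite /dot_rV big_ord0.
  have E1 : (fun x => cos (dot_rV x xi) * expR (- (s * dot_rV x x))) = cst 1.
    by apply/funext => x; rewrite !d0 cos0 mulr0 oppr0 expR0 mulr1.
  have E2 : (fun x => sin (dot_rV x xi) * expR (- (s * dot_rV x x))) = cst 0.
    by apply/funext => x; rewrite !d0 sin0 mul0r.
  have m1 : lebesgue_rV 0 [set: 'rV[R]_0] = 1%:E by rewrite /= diracT.
  have RC (c : R) : \int[lebesgue_rV 0]_x (cst c) x = c.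
    by rewrite Rintegral_cst// (_ : fine _ = 1) ?mulr1// [X in fine X]m1.
  rewrite E1 E2 d0 mul0r oppr0 expR0 expr0 mulr1 !RC; split => //.
  - by apply: finite_measure_integrable_cst => //; rewrite m1 ltry.
  - by apply: finite_measure_integrable_cst => //; rewrite m1 ltry.
rewrite -(rVunconsK xi); case: (rVuncons xi) => b z {xi}.
have [i1 i2 h1 h2] := IH z.
have j1 : lebesgue_measure.-integrable setT (EFin \o (fun x : R => cos (x * b) * expR (- (s * x ^+ 2)))).
  apply: (integrable_dom _ _ (integrable_gauss 0 s0)); first by solve_measurable.
  by move=> x; rewrite expr0 mul1r normrM (ger0_norm (expR_ge0 _)) ler_piMl ?expR_ge0// cos_max.
have j2 : lebesgue_measure.-integrable setT (EFin \o (fun x : R => sin (x * b) * expR (- (s * x ^+ 2)))).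
  apply: (integrable_dom _ _ (integrable_gauss 0 s0)); first by solve_measurable.
  by move=> x; rewrite expr0 mul1r normrM (ger0_norm (expR_ge0 _)) ler_piMl ?expR_ge0// sin_max.
have P (g : R -> R) (h : 'rV[R]_n -> R) := @integral_rVS_prod R n g h (fun x => g (rVuncons x).1 * h (rVuncons x).2)
  (fun a y => congr2 (fun u v => g u * h v) (congr1 fst (rVconsK (a, y))) (congr1 snd (rVconsK (a, y)))).
have [k1 l1] := P _ _ j1 i1; have [k2 l2] := P _ _ j2 i2.
have [k3 l3] := P _ _ j1 i2; have [k4 l4] := P _ _ j2 i1.
have dE x : dot_rV x x = (rVuncons x).1 ^+ 2 + dot_rV (rVuncons x).2 (rVuncons x).2.
  by rewrite -{1 2}(rVunconsK x); case: (rVuncons x) => a y; rewrite dot_rVS expr2.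
have dE' x : dot_rV x (rVcons (b, z)) = (rVuncons x).1 * b + dot_rV (rVuncons x).2 z.
  by rewrite -{1}(rVunconsK x); case: (rVuncons x) => a y; rewrite dot_rVS.
have eE x : expR (- (s * dot_rV x x)) =
    expR (- (s * (rVuncons x).1 ^+ 2)) * expR (- (s * dot_rV (rVuncons x).2 (rVuncons x).2)).
  by rewrite -expRD dE; congr expR; ring.
have cE : (fun x => cos (dot_rV x (rVcons (b, z))) * expR (- (s * dot_rV x x))) =
  (fun x => (cos ((rVuncons x).1 * b) * expR (- (s * (rVuncons x).1 ^+ 2))) *
            (cos (dot_rV (rVuncons x).2 z) * expR (- (s * dot_rV (rVuncons x).2 (rVuncons x).2))) -
            (sin ((rVuncons x).1 * b) * expR (- (s * (rVuncons x).1 ^+ 2))) *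
            (sin (dot_rV (rVuncons x).2 z) * expR (- (s * dot_rV (rVuncons x).2 (rVuncons x).2)))).
  by apply/funext => x; rewrite eE dE' cosD; ring.
have sE : (fun x => sin (dot_rV x (rVcons (b, z))) * expR (- (s * dot_rV x x))) =
  (fun x => (sin ((rVuncons x).1 * b) * expR (- (s * (rVuncons x).1 ^+ 2))) *
            (cos (dot_rV (rVuncons x).2 z) * expR (- (s * dot_rV (rVuncons x).2 (rVuncons x).2))) +
            (cos ((rVuncons x).1 * b) * expR (- (s * (rVuncons x).1 ^+ 2))) *
            (sin (dot_rV (rVuncons x).2 z) * expR (- (s * dot_rV (rVuncons x).2 (rVuncons x).2)))).
  by apply/funext => x; rewrite eE dE' sinD; ring.
rewrite cE sE; split.
- exact: (integrableB measurableT k1 k2).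
- exact: (integrableD measurableT k4 k3).
- rewrite RintegralB// l1 l2 h1 h2 gauss_fourier1// mulr0 subr0 dot_rVS mulrACA -expRD -exprS.
  by congr (_ * expR _); field; rewrite gt_eqF.
- by rewrite RintegralD// l3 l4 h2 gauss_fourier1_sin// mul0r mulr0 addr0.
Qed.

(** * Subordination and finite differences *)

Lemma ge0_EintegralZl d (T : measurableType d) (R : realType)
    (mu : {measure set T -> \bar R}) (f : T -> R) (k : R) :
  0 <= k -> measurable_fun setT f -> (forall x, 0 <= f x) ->
  (\int[mu]_x (k * f x)%:E = k%:E * \int[mu]_x (f x)%:E)%E.
Proof.
move=> k0 mf f0; under eq_integral do rewrite EFinM.
rewrite ge0_integralZl//; first exact/measurable_EFinP.
by move=> x _; rewrite lee_fin.
Qed.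

Lemma integrable_gaussr (R : realType) (s : R) (k : nat) : 0 < s ->
  lebesgue_measure.-integrable setT (EFin \o (fun x : R => `|x| ^+ k * expR (- (x ^+ 2 * s)))).
Proof.
move=> s0; rewrite (_ : (fun x => _) = fun x : R => `|x| ^+ k * expR (- (s * x ^+ 2))).
  exact: integrable_gauss.
by apply/funext => x; rewrite [x ^+ 2 * _]mulrC.
Qed.

Lemma Rintegral_scale (R : realType) (a : R) (f : R -> R) : 0 < a ->
  measurable_fun setT f -> (forall x, 0 <= f x) ->
  \int[lebesgue_measure]_x f x = a * \int[lebesgue_measure]_x f (a * x).
Proof.
move=> a0 mf f0; rewrite /Rintegral (ge0_integral_scale a0)//; last exact/measurable_EFinP.
have : (0 <= \int[lebesgue_measure]_x (f (a * x)%R)%:E)%E by apply: integral_ge0 => x _; rewrite lee_fin.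
(* An infinite integral is sent to 0 by [fine] on both sides. *)
by case: (\int[_]_x _)%E => //=; rewrite ?mulr0// gt0_muley ?lte_fin//= mulr0.
Qed.

Lemma integrable_scale (R : realType) (a : R) (f : R -> R) : 0 < a ->
  lebesgue_measure.-integrable setT (EFin \o f) ->
  lebesgue_measure.-integrable setT (EFin \o (fun x => f (a * x))).
Proof.
move=> a0 /integrableP[/measurable_EFinP mf foo].
have ma : measurable_fun setT (fun x : R => f (a * x)).
  by apply: (measurableT_comp mf); exact: measurable_funM.
apply/integrableP; split; first exact/measurable_EFinP.
rewrite (ge0_integral_scale a0) in foo; last 2 first.
- by apply: (measurableT_comp (@abse_measurable R setT)); exact/measurable_EFinP.
- by move=> x; exact: abse_ge0.
move: foo; set I := (\int[_]_x _)%E.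
have : (0 <= I)%E by apply: integral_ge0 => x _; exact: abse_ge0.
rewrite -[X in _ -> _ -> (X < _)%E]/I; case: I => [r| |]//=.
  by move=> _ _; exact: ltry.
by rewrite gt0_muley ?lte_fin.
Qed.

Lemma Rintegral_gt0 (R : realType) (f : R -> R) (c : R) :
  lebesgue_measure.-integrable setT (EFin \o f) -> (forall x, 0 <= f x) ->
  0 < c -> (forall x, 1 <= x <= 2 -> c <= f x) -> 0 < \int[lebesgue_measure]_x f x.
Proof.
move=> intf f0 c0 cf.
have i1 : lebesgue_measure.-integrable setT (EFin \o (\1_(`[1, 2]%classic : set R) : R -> R)).
  exact: integrable_indic_itv.
have ii : lebesgue_measure.-integrable setT (EFin \o (fun x : R => c * \1_(`[1, 2]%classic : set R) x)).
  exact: (integrableZl measurableT c i1).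
apply: (@lt_le_trans _ _ (\int[lebesgue_measure]_x (c * \1_(`[1, 2]%classic : set R) x))); last first.
  apply: le_Rintegral => // x _; rewrite indicE.
  have [|_] := boolP (x \in _); last by rewrite mulr0.
  by rewrite inE/= in_itv/= mulr1; exact: cf.
have E : lebesgue_measure (`[1, 2]%classic : set R) = 1%:E.
  by rewrite lebesgue_measure_itv/= lte_fin ltr1n/= -EFinD; congr EFin; ring.
rewrite RintegralZl// mulr_gt0// /Rintegral integral_indic// setIT [X in fine X]E.
exact: ltr01.
Qed.

(** This is Gamma((n + 1) / 2), the constant that normalises the Gaussian mixture; it enters only
    through its positivity and the scaling identity for it. *)
HB.lock Definition subord (R : realType) (n : nat) : R :=
  \int[lebesgue_measure]_u (`|u| ^+ n * expR (- u ^+ 2)).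

Lemma subord_gt0 (R : realType) n : 0 < subord R n.
Proof.
have i := @integrable_gauss R 1 n ltr01.
have E : (fun x : R => `|x| ^+ n * expR (- (1 * x ^+ 2))) = (fun x => `|x| ^+ n * expR (- x ^+ 2)).
  by apply/funext => x; rewrite mul1r.
rewrite E in i.
rewrite subord.unlock; apply: (@Rintegral_gt0 _ _ (expR (- 4%:R)) i).
- by move=> x; rewrite mulr_ge0// ?expR_ge0// exprn_ge0.
- exact: expR_gt0.
- move=> x /andP[x1 x2]; rewrite -[leLHS]mul1r ler_pM ?expR_ge0 ?ler01//.
    by rewrite exprn_ege1// ger0_norm// (le_trans _ x1).
  by rewrite ler_expR lerN2 (_ : 4%:R = 2 ^+ 2) ?ler_sqr ?nnegrE// ?(le_trans _ x1)// expr2; ring.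
Qed.

(** Read from right to left with a = sqrt(1 + k |x|^2), this writes the profile as a mixture of
    Gaussians in x. *)
Lemma subord_scale (R : realType) n (a : R) : 0 < a ->
  \int[lebesgue_measure]_u (`|u| ^+ n * expR (- (u ^+ 2 * a ^+ 2))) = subord R n * (a^-1) ^+ n.+1.
Proof.
move=> a0; have mf : measurable_fun setT (fun u : R => `|u| ^+ n * expR (- u ^+ 2)) by solve_measurable.
have f0 (u : R) : 0 <= `|u| ^+ n * expR (- u ^+ 2) by rewrite mulr_ge0// ?expR_ge0// exprn_ge0.
rewrite subord.unlock [X in _ = X * _](Rintegral_scale a0 mf f0).
have -> : (fun x : R => `|a * x| ^+ n * expR (- (a * x) ^+ 2)) =
   (fun x => a ^+ n * (`|x| ^+ n * expR (- (x ^+ 2 * a ^+ 2)))).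
  by apply/funext => x; rewrite normrM (gtr0_norm a0) !exprMn -[LHS]mulrA; congr (_ * (_ * expR (- _))); rewrite mulrC.
rewrite RintegralZl//; last first.
  exact: integrable_gaussr (exprn_gt0 _ a0).
rewrite mulrA -exprS mulrAC -exprMn divff ?gt_eqF// expr1n mul1r//.
Qed.

(** The subordination formula with exponent 1 writes the function as a mixture of Gaussians. By
    Tonelli, the x-integral of the slice at u is sqrt(pi) exp(-u^2) for u != 0; the slice u = 0,
    where the Gaussian degenerates, is killed by the factor |u|. *)
Lemma integrable_cauchy (R : realType) :
  lebesgue_measure.-integrable setT (EFin \o (fun x : R => (1 + x ^+ 2)^-1)).
Proof.
pose k (z : measurableTypeR R * measurableTypeR R) : R := `|z.2| ^+ 1 * expR (- (z.2 ^+ 2 * Num.sqrt (1 + z.1 ^+ 2) ^+ 2)).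
have p1 (x : R) : 0 < 1 + x ^+ 2 by rewrite ltr_pwDl// sqr_ge0.
have s1 (x : R) : 0 < Num.sqrt (1 + x ^+ 2) by rewrite sqrtr_gt0.
have mk : measurable_fun setT (EFin \o k) by apply/measurable_EFinP; rewrite /k; solve_measurable.
have k0 z : (0 <= (EFin \o k) z)%E by rewrite lee_fin mulr_ge0// ?expR_ge0// exprn_ge0.
have k1 (x : R) : (\int[lebesgue_measure]_u (k (x, u))%:E)%E = (subord R 1 * (1 + x ^+ 2)^-1)%:E.
  rewrite -[X in (_ * X)%:E](_ : (Num.sqrt (1 + x ^+ 2))^-1 ^+ 2 = _); last first.
    by rewrite exprVn sqr_sqrtr// ltW.
  rewrite -subord_scale// fineK// integrable_fin_num//.
  exact: integrable_gaussr (exprn_gt0 _ (s1 x)).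
have k2 (u : R) : (\int[lebesgue_measure]_x (k (x, u))%:E <= (Num.sqrt pi * expR (- u ^+ 2))%:E)%E.
  have [->|u0] := eqVneq u 0.
    rewrite integral0_eq ?lee_fin ?mulr_ge0 ?sqrtr_ge0 ?expR_ge0//.
    by move=> x _; rewrite /k/= normr0 expr1 mul0r.
  rewrite (_ : (fun x => _) = (fun x => (`|u| * expR (- u ^+ 2) * expR (- (u ^+ 2 * x ^+ 2)))%:E)); last first.
    apply/funext => x; rewrite /k/= expr1 sqr_sqrtr ?ltW//; congr EFin.
    by rewrite -[RHS]mulrA -expRD; congr (_ * expR _); ring.
  have u2 : 0 < u ^+ 2 by rewrite lt_neqAle sqr_ge0 eq_sym sqrf_eq0 u0.
  have mE : measurable_fun setT (fun x : R => expR (- (u ^+ 2 * x ^+ 2))) by solve_measurable.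
  have -> : (\int[lebesgue_measure]_x (`|u| * expR (- u ^+ 2) * expR (- (u ^+ 2 * x ^+ 2)))%:E =
      (`|u| * expR (- u ^+ 2))%:E * \int[lebesgue_measure]_x (expR (- (u ^+ 2 * x ^+ 2)))%:E)%E.
    by apply: ge0_EintegralZl => [||x] //; rewrite ?mulr_ge0 ?expR_ge0.
  rewrite integral_gauss// -EFinM lee_fin sqrtrM ?pi_ge0// sqrtrV ?sqr_ge0// sqrtr_sqr.
  by rewrite mulrC mulrA mulrVK ?unitfE ?normr_eq0// mulrC.
have pi0 (x : R) : 0 <= (1 + x ^+ 2)^-1 by rewrite invr_ge0 (ltW (p1 x)).
have sn0 : subord R 1 != 0 by rewrite gt_eqF// subord_gt0.
have := @fubini_tonelli _ _ _ _ _ (@lebesgue_measure R) (@lebesgue_measure R) _ mk k0.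
rewrite /= => F.
have mc : measurable_fun setT (fun x : R => (1 + x ^+ 2)^-1) by solve_measurable.
suff : lebesgue_measure.-integrable setT (EFin \o (fun x : R => subord R 1 * (1 + x ^+ 2)^-1)).
  move=> i; apply: (@integrable_dom R _ _ (@lebesgue_measure R) _ (fun x : R => (subord R 1)^-1 * (subord R 1 * (1 + x ^+ 2)^-1))).
  - by solve_measurable.
  - move=> x.
    rewrite (ger0_norm (pi0 x)).
    have -> : (subord R 1)^-1 * (subord R 1 * (1 + x ^+ 2)^-1) = (1 + x ^+ 2)^-1.
      move: (subord R 1) sn0 => c c0.
      by rewrite mulKf.
    exact: lexx.
  - exact: (integrableZl measurableT (subord R 1)^-1 i).
have sc0 (x : R) : 0 <= subord R 1 * (1 + x ^+ 2)^-1.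
  exact: mulr_ge0 (ltW (subord_gt0 _ _)) (pi0 x).
apply/integrableP; split; first by apply/measurable_EFinP; exact: measurable_funM.
under eq_integral => x _ do rewrite /= (ger0_norm (sc0 x)) -k1.
rewrite F; apply: (@le_lt_trans _ _ (\int[lebesgue_measure]_u (Num.sqrt pi * expR (- u ^+ 2))%:E)%E).
  apply: ge0_le_integral_nomeas => u _; last exact: k2.
  by apply: integral_ge0 => x _; exact: (k0 (x, u)).
have mE : measurable_fun setT (fun u : R => expR (- u ^+ 2)) by solve_measurable.
have -> : (\int[lebesgue_measure]_u (Num.sqrt pi * expR (- (u : R) ^+ 2))%:E =
    (Num.sqrt pi)%:E * \int[lebesgue_measure]_u (expR (- (u : R) ^+ 2))%:E)%E.
  by apply: ge0_EintegralZl => [||x] //; rewrite ?sqrtr_ge0 ?expR_ge0.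
under eq_integral do rewrite -[X in - X]mul1r.
rewrite (integral_gauss ltr01) -EFinM; exact: ltry.
Qed.

(** The sign is such that one step multiplies a -> exp(-a l) by 1 - exp(-h l), which is nonnegative
    for h, l >= 0. *)
Fixpoint fdiff (R : realType) (h : R) (m : nat) (f : R -> R) (a : R) : R :=
  if m is k.+1 then fdiff h k f a - fdiff h k f (a + h) else f a.

Lemma fdiff_eq (R : realType) (h : R) m (f g : R -> R) (a : R) : 0 <= h -> 0 < a ->
  (forall r, 0 < r -> f r = g r) -> fdiff h m f a = fdiff h m g a.
Proof.
move=> h0 + fg; elim: m a => [|m IH] a a0 /=; first exact: fg.
by rewrite !IH// ltr_wpDr.
Qed.

Lemma fdiffZ (R : realType) (h : R) m (f : R -> R) (a c : R) :
  fdiff h m (fun r => c * f r) a = c * fdiff h m f a.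
Proof. by elim: m a => [|m IH] a //=; rewrite !IH mulrBr. Qed.

Lemma fdiff_exp (R : realType) (h : R) m (a l : R) :
  fdiff h m (fun r => expR (- (r * l))) a = (1 - expR (- (h * l))) ^+ m * expR (- (a * l)).
Proof.
elim: m a => [|m IH] a /=; first by rewrite expr0 mul1r.
rewrite !IH exprS mulrDl opprD expRD; ring.
Qed.

Lemma fdiff_le (R : realType) (h M : R) m (f : R -> R) (a : R) : 0 <= h ->
  (forall r, a <= r <= a + m%:R * h -> `|f r| <= M) -> `|fdiff h m f a| <= 2 ^+ m * M.
Proof.
move=> h0; elim: m a => [|m IH] a fM /=.
  by rewrite expr0 mul1r fM// mul0r addr0 !lexx.
rewrite exprS -mulrA mulrDl mul1r (le_trans (ler_normB _ _))// lerD// IH// => r /andP[ar rb].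
  by apply: fM; rewrite ar (le_trans rb)// lerD2l ler_wpM2r// ler_nat.
apply: fM; rewrite (le_trans _ ar) ?lerDl// (le_trans rb)//.
by rewrite -addrA lerD2l mulrSr mulrDl mul1r addrC.
Qed.

Lemma fdiff_derive (R : realType) (h : R) m (F : nat -> R -> R) k (r : R) : 0 <= h ->
  (forall k (r : R), 0 < r -> is_derive r (1 : R) (F k) (F k.+1 r)) -> 0 < r ->
  is_derive r (1 : R) (fdiff h m (F k)) (fdiff h m (F k.+1) r).
Proof.
move=> h0 dF; elim: m r => [|m IH] r r0 /=; first exact: dF.
apply: add_is_derive; first exact: IH.
apply: opp_is_derive; rewrite -[X in is_derive _ _ _ X]mulr1.
apply: (compR_is_derive (h := fdiff h m (F k)) (f := fun y => y + h)).
  by apply: IH; rewrite ltr_wpDr.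
by solve_derive; rewrite addr0.
Qed.

(** The mean value theorem removes one difference at the price of a factor h and one more
    derivative. F lists the successive derivatives, so the induction moves the index k while k + m
    stays fixed. *)
Lemma fdiff_bound (R : realType) (h M : R) m (F : nat -> R -> R) k (a : R) : 0 <= h -> 0 < a ->
  (forall k (r : R), 0 < r -> is_derive r (1 : R) (F k) (F k.+1 r)) ->
  (forall r, a <= r <= a + m%:R * h -> `|F (k + m)%N r| <= M) ->
  `|fdiff h m (F k) a| <= h ^+ m * M.
Proof.
move=> h0 + dF; elim: m k a => [|m IH] k a a0 FM /=.
  by rewrite expr0 mul1r -[k]addn0 FM// mul0r addr0 !lexx.
move: h0; rewrite le_eqVlt => /predU1P[h00|h0].
  by rewrite -h00 addr0 subrr normr0 expr0n mul0r.
have dG (r : R) : 0 < r -> is_derive r (1 : R) (fdiff h m (F k)) (fdiff h m (F k.+1) r).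
  by move=> r0; apply: fdiff_derive => //; exact: ltW.
have aah : a < a + h by rewrite ltrDl.
have [||c] := @MVT _ (fdiff h m (F k)) (fdiff h m (F k.+1)) a (a + h) aah.
- move=> x; rewrite in_itv/= => /andP[ax _]; apply: dG; exact: lt_trans ax.
- apply/continuous_in_subspaceT => x; rewrite inE/= in_itv/= => /andP[ax _].
  by apply: (is_derive_continuous (dG _ _)); exact: lt_le_trans ax.
rewrite in_itv/= => /andP[ac cah] E.
rewrite distrC E (addrC a) addrK normrM (gtr0_norm h0) mulrC exprS -mulrA ler_pM2l//.
apply: IH; first exact: lt_trans ac.
move=> r /andP[cr rc]; rewrite addSnnS; apply: FM.
rewrite (le_trans _ cr) ?(ltW ac)//= (le_trans rc)//.
by rewrite mulrSr mulrDl mul1r addrA addrAC lerD2r ltW.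
Qed.

Lemma fdiff_integral (R : realType) d (T : measurableType d) (mu : {measure set T -> \bar R})
    (h : R) m (f : R -> T -> R) (a : R) : 0 <= h -> 0 < a ->
  (forall r, 0 < r -> mu.-integrable setT (EFin \o f r)) ->
  mu.-integrable setT (EFin \o (fun x => fdiff h m (f ^~ x) a)) /\
  \int[mu]_x fdiff h m (f ^~ x) a = fdiff h m (fun r => \int[mu]_x f r x) a.
Proof.
move=> h0 + intf; elim: m a => [|m IH] a a0 /=; first by split => //; exact: intf.
have [i1 E1] := IH _ a0; have [i2 E2] := IH (a + h) (ltr_wpDr h0 a0).
split; first exact: (integrableB measurableT i1 i2).
by rewrite RintegralB// E1 E2.
Qed.

Lemma horner_is_derive (R : realType) (p : {poly R}) (f : R -> R) (x a : R) :
  is_derive x (1 : R) f a -> is_derive x (1 : R) (fun y => p.[f y]) (p^`().[f x] * a).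
Proof.
apply: (compR_is_derive (h := horner p)); rewrite derivE derive1E; apply: DeriveDef => //; exact: derivable_horner.
Qed.

Lemma poly_exp_bound (R : realType) (p : {poly R}) (N : nat) :
  exists2 C : R, 0 < C & forall y, 0 <= y ->
    `|p.[y]| * Num.sqrt (1 + y) ^+ N * expR (- y) <= C.
Proof.
pose S := \sum_(i < size p) `|p`_i|.
exists (S * ((size p + N)`!%:R * expR 1) + 1).
  by rewrite ltr_wpDl// mulr_ge0 ?sumr_ge0// mulr_ge0// expR_ge0.
move=> y y0; have y1 : 1 <= 1 + y by rewrite lerDl.
have pS : `|p.[y]| <= S * (1 + y) ^+ size p.
  rewrite horner_coef (le_trans (ler_norm_sum _ _ _))// mulr_suml ler_sum// => i _.
  rewrite normrM ler_wpM2l// normrX (ger0_norm y0).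
  rewrite (@le_trans _ _ ((1 + y) ^+ i))//.
    by rewrite lerXn2r ?nnegrE ?addr_ge0// lerDr.
  by rewrite ler_weXn2l// ltnW.
have sy : Num.sqrt (1 + y) <= 1 + y.
  have y2 : 0 <= 1 + y by rewrite addr_ge0.
  by rewrite -{2}(ger0_norm y2) -sqrtr_sqr ler_sqrt ?sqr_ge0// expr2 ler_peMl.
have e1 : (1 + y) ^+ (size p + N) * expR (- y) <= (size p + N)`!%:R * expR 1.
  have h := expR_ge_pow (size p + N) (le_trans ler01 y1).
  have := ler_wpM2r (expR_ge0 (- y)) h.
  by rewrite -(mulrA _ (expR _)) -expRD addrK.
apply: (@le_trans _ _ (S * ((1 + y) ^+ (size p + N) * expR (- y)))).
  rewrite [leRHS]mulrA ler_wpM2r ?expR_ge0// exprD mulrA ler_pM ?exprn_ge0 ?sqrtr_ge0//.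
  by rewrite lerXn2r ?nnegrE ?sqrtr_ge0// addr_ge0.
by rewrite ler_wpDr// ler_wpM2l// sumr_ge0.
Qed.

(** The polynomials P_k such that the k-th r-derivative of r^(-n/2) exp(-Y/r) is r^(-k) P_k(Y/r)
    r^(-n/2) exp(-Y/r). The three terms of the recursion come from the powers of r, from Y/r inside
    P_k and from the exponential. *)
Fixpoint heatpoly (R : realType) (n k : nat) : {poly R} :=
  if k is j.+1 then
    - (j%:R + n%:R / 2)%:P * heatpoly R n j - 'X * (heatpoly R n j)^`() + 'X * heatpoly R n j
  else 1.

(** The factor r^(-n/2) is put into the exponential through [ln], which lets the elementary
    derivative rules apply for r > 0. *)
Definition heatder (R : realType) (n : nat) (Y : R) (k : nat) (r : R) : R :=
  r^-1 ^+ k * (heatpoly R n k).[Y / r] * expR (- (n%:R / 2) * ln r - Y / r).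

Lemma heatderP (R : realType) (n : nat) (Y : R) (k : nat) (r : R) : 0 < r ->
  is_derive r (1 : R) (heatder n Y k) (heatder n Y k.+1 r).
Proof.
move=> r0; rewrite /heatder.
have rn0 : r != 0 by rewrite gt_eqF.
have dY : is_derive r (1 : R) (fun r => Y / r) (- (Y / r) / r).
  by solve_derive => //; field.
have dp := horner_is_derive (heatpoly R n k) dY.
have dr : is_derive r (1 : R) (fun r => r^-1 ^+ k) (- k%:R * r^-1 ^+ k.+1).
  case: k {dp} => [|k]; first by rewrite oppr0 mul0r; exact: cst_is_derive.
  have -> : - k.+1%:R * r^-1 ^+ k.+2 = k.+1%:R * r^-1 ^+ k * (- r ^- 2 * 1).
    by rewrite !exprSr; field.
  by apply: expn_is_derive; apply: inv_is_derive => //; exact: id_is_derive.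
have de : is_derive r (1 : R) (fun r => expR (- (n%:R / 2) * ln r - Y / r))
   (expR (- (n%:R / 2) * ln r - Y / r) * ((- (n%:R / 2) + Y / r) / r)).
  by apply: expR_is_derive; solve_derive => //; field.
apply: (is_derive_eq (mul_is_derive (mul_is_derive dr dp) de)) => /=.
rewrite !(hornerD, hornerN, hornerM, hornerX, hornerC) exprS.
by field.
Qed.

(** * Bounds on the heat kernel *)

(** With y = Y/r one has r + Y = r (1 + y), and exp(-y) absorbs P_k(y) (1 + y)^((n+1)/2). The factor
    sqrt r makes up for using n + 1 where the heat kernel has n; n + 1 is the decay that the profile
    needs. *)
Lemma heatder_bound (R : realType) (n k : nat) : exists2 C : R, 0 < C &
  forall Y r, 0 <= Y -> 0 < r ->
    `|heatder n Y k r| <= C * r^-1 ^+ k * Num.sqrt r * (Num.sqrt (r + Y))^-1 ^+ n.+1.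
Proof.
have [C C0 HC] := poly_exp_bound (heatpoly R n k) n.+1.
exists C => // Y r Y0 r0; have yr : 0 <= Y / r by rewrite divr_ge0// ltW.
have := HC _ yr; rewrite /heatder.
set w := Num.sqrt r; have w0 : 0 < w by rewrite sqrtr_gt0.
have rE : r = w ^+ 2 by rewrite sqr_sqrtr// ltW.
set z := Num.sqrt (1 + Y / r); have z0 : 0 < z by rewrite sqrtr_gt0 ltr_pwDl.
have -> : Num.sqrt (r + Y) = w * z.
  rewrite /w /z -sqrtrM ?(ltW r0)//; congr Num.sqrt.
  by rewrite mulrDr mulr1 mulrCA divff ?mulr1// gt_eqF.
have -> : expR (- (n%:R / 2) * ln r - Y / r) = w^-1 ^+ n * expR (- (Y / r)).
  rewrite expRD; congr (_ * _); rewrite {1}rE lnXn// -[w in RHS]lnK ?posrE//.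
  by rewrite -expRN -expRM_natl -mulr_natl; congr expR; field.
move=> h; rewrite !normrM (ger0_norm (expR_ge0 _)) normrX (gtr0_norm (_ : 0 < r^-1)) ?invr_gt0//.
rewrite normrX (gtr0_norm (_ : 0 < w^-1)) ?invr_gt0//.
rewrite invfM exprMn.
have -> : C * r^-1 ^+ k * w * (w^-1 ^+ n.+1 * z^-1 ^+ n.+1) = r^-1 ^+ k * w^-1 ^+ n * (C * z^-1 ^+ n.+1).
  by rewrite (exprS w^-1); field; rewrite gt_eqF.
rewrite -!mulrA ler_pM2l ?exprn_gt0 ?invr_gt0// mulrCA ler_pM2l ?exprn_gt0 ?invr_gt0//.
rewrite exprVn ler_pdivlMr ?exprn_gt0//.
by rewrite mulrAC.
Qed.

Lemma fdiff_measurable (R : realType) d (T : measurableType d) (f : R -> R) (g h : T -> R) m :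
  measurable_fun setT f -> measurable_fun setT g -> measurable_fun setT h ->
  measurable_fun setT (fun x => fdiff (g x) m f (h x)).
Proof.
move=> mf mg; elim: m h => [|m IH] h mh /=; first exact: measurableT_comp.
by apply: measurable_funB; apply: IH => //; exact: measurable_funD.
Qed.

(** For Y = |x|^2 / 4 this is the Fourier transform of xi -> exp(-r |xi|^2) at x. *)
Definition heat (R : realType) (n : nat) (Y r : R) : R :=
  Num.sqrt (pi / r) ^+ n * expR (- (Y / r)).

Lemma heatE (R : realType) (n : nat) (Y r : R) : 0 < r ->
  heat n Y r = Num.sqrt pi ^+ n * heatder n Y 0 r.
Proof.
move=> r0; rewrite /heat /heatder expr0 mul1r hornerC mul1r.
set w := Num.sqrt r; have w0 : 0 < w by rewrite sqrtr_gt0.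
have rE : r = w ^+ 2 by rewrite sqr_sqrtr// ltW.
have -> : expR (- (n%:R / 2) * ln r - Y / r) = w^-1 ^+ n * expR (- (Y / r)).
  rewrite expRD; congr (_ * _); rewrite {1}rE lnXn// -[w in RHS]lnK ?posrE//.
  by rewrite -expRN -expRM_natl -mulr_natl; congr expR; field.
by rewrite sqrtrM ?pi_ge0// sqrtrV ?(ltW r0)// exprMn mulrA.
Qed.

(** Size of an m-th difference of the heat kernel with step v^2, in terms of w = v / sqrt a: m
    derivatives give w^(2m) for small steps, and for large ones the factor sqrt r of the termwise
    bound gives |w|. *)
Definition small_large (R : realType) (m : nat) (w : R) : R :=
  if w ^+ 2 <= 1 then (w ^+ 2) ^+ m else `|w|.

(** Near 0 the singularity is compensated because 2 m >= 1 + 2 sigma; at infinity |w|^(-2 sigma) <=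
    |w|^(-2) because sigma >= 1. The Cauchy function covers both regimes. *)
Lemma small_large_bound (R : realType) m (sigma w : R) : 1 <= sigma -> 1 + 2 * sigma <= (2 * m)%:R ->
  `|w| `^ (- 1 - 2 * sigma) * small_large m w <= 2 * (1 + w ^+ 2)^-1.
Proof.
move=> s1 sm; have p0 : 0 < 1 + w ^+ 2 by rewrite ltr_pwDl// sqr_ge0.
(* At w = 0 the left-hand side is 0: [powR] sends the base 0 to 0 for a nonzero exponent, even a
   negative one. *)
have [->|w0] := eqVneq w 0.
  rewrite normr0 powR0 ?mul0r ?mulr_ge0 ?invr_ge0//; last by rewrite lt_eqF//; lra.
have nw0 : 0 < `|w| by rewrite normr_gt0.
rewrite ler_pdivlMr// /small_large; case: ifPn => [w1|].
  have nw1 : `|w| <= 1.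
    by rewrite -(@ler_pXn2r _ 2) ?nnegrE// expr1n -normrX ger0_norm// sqr_ge0.
  have -> : (w ^+ 2) ^+ m = `|w| `^ (2 * m)%:R.
    by rewrite -exprM powR_mulrn ?normr_ge0// -normrX ger0_norm// exprM exprn_ge0// sqr_ge0.
  rewrite -powRD ?(gt_eqF nw0) ?implybT//.
  rewrite -[leRHS]mul1r ler_pM ?powR_ge0 ?(ltW p0)//; last by rewrite -[leRHS]/(1 + 1 : R) lerD2l.
  rewrite -[leRHS](powRr0 `|w|) ger_powR ?nw0//; lra.
rewrite -ltNge => w1.
have nw1 : 1 <= `|w|.
  by rewrite -(@ler_pXn2r _ 2) ?nnegrE// expr1n -normrX ger0_norm ?sqr_ge0// ltW.
rewrite -{2}(powRr1 (ltW nw0)) -powRD ?(gt_eqF nw0) ?implybT//.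
apply: (@le_trans _ _ (`|w| `^ (- 2%:R) * (1 + w ^+ 2))).
  by rewrite ler_pM2r// ler_powR//; lra.
rewrite powRN powR_mulrn ?normr_ge0// -normrX (ger0_norm (sqr_ge0 w)) ler_pdivrMl; last by rewrite exprn_even_gt0.
by lra.
Qed.

Lemma integrable_domR (R : realType) (f g : R -> R) : measurable_fun setT f ->
  (forall x, `|f x| <= g x) -> lebesgue_measure.-integrable setT (EFin \o g) ->
  lebesgue_measure.-integrable setT (EFin \o f).
Proof. by move=> mf fg; apply: (@integrable_dom R _ _ (@lebesgue_measure R) f g). Qed.

(** The substitution v -> v / l extracts l^(2 sigma). For sigma >= 1 a single factor 1 - exp(-v^2
    l^2), of order v^2 at 0, leaves |v|^(1 - 2 sigma), which is not integrable there; the m-th power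
    repairs this. *)
Lemma laplace_power (R : realType) (m : nat) (sigma : R) : 1 <= sigma -> 1 + 2 * sigma <= (2 * m)%:R ->
  (0 < m)%N ->
  exists2 C : R, 0 < C & forall l : R, 0 <= l ->
    lebesgue_measure.-integrable setT
      (EFin \o (fun v : R => `|v| `^ (- 1 - 2 * sigma) * (1 - expR (- (v ^+ 2 * l ^+ 2))) ^+ m)) /\
    \int[lebesgue_measure]_v (`|v| `^ (- 1 - 2 * sigma) * (1 - expR (- (v ^+ 2 * l ^+ 2))) ^+ m) =
    l `^ (2 * sigma) * C.
Proof.
move=> s1 sm m0.
pose f (v : R) := `|v| `^ (- 1 - 2 * sigma) * (1 - expR (- v ^+ 2)) ^+ m.
have e0 (v : R) : 0 <= 1 - expR (- v ^+ 2) by rewrite subr_ge0 -expR0 ler_expR oppr_le0 sqr_ge0.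
have e1 (v : R) : 1 - expR (- v ^+ 2) <= 1 by rewrite gerDl oppr_le0 expR_ge0.
have e2 (v : R) : 1 - expR (- v ^+ 2) <= v ^+ 2.
  by rewrite lerBlDr -lerBlDl expR_ge1Dx.
have f0 v : 0 <= f v by rewrite mulr_ge0 ?powR_ge0// exprn_ge0.
have mf : measurable_fun setT f.
  by rewrite /f; solve_measurable.
have fq v : f v <= 2 * (1 + v ^+ 2)^-1.
  apply: le_trans (small_large_bound v s1 sm).
  rewrite ler_wpM2l ?powR_ge0// /small_large; case: ifPn => v1.
    by rewrite lerXn2r ?nnegrE ?sqr_ge0.
  rewrite (@le_trans _ _ 1)//; first exact: exprn_ile1.
  rewrite -(@ler_pXn2r _ 2) ?nnegrE// expr1n -normrX ger0_norm ?sqr_ge0//.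
  by rewrite ltW// ltNge.
have intf : lebesgue_measure.-integrable setT (EFin \o f).
  apply: (integrable_domR (g := fun v : R => 2 * (1 + v ^+ 2)^-1) mf).
    by move=> v; rewrite ger0_norm.
  exact: (integrableZl measurableT 2 (integrable_cauchy R)).
exists (\int[lebesgue_measure]_v f v).
  apply: (@Rintegral_gt0 _ _ (2 `^ (- 1 - 2 * sigma) * (1 - expR (- 1)) ^+ m) intf f0).
  - by rewrite mulr_gt0 ?powR_gt0// exprn_gt0// subr_gt0 -expR0 ltr_expR ltrN10.
  move=> x /andP[x1 x2]; have x0 : 0 < x by exact: lt_le_trans x1.
  have h1 : 0 <= 1 - expR (- 1) :> R by rewrite subr_ge0 -[leRHS]expR0 ler_expR oppr_le0.
  rewrite /f (gtr0_norm x0) ler_pM ?powR_ge0 ?exprn_ge0//.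
  - rewrite /powR !gt_eqF// ler_expR ler_wnM2l ?ler_ln ?posrE//; lra.
  - rewrite lerXn2r ?nnegrE//.
    by rewrite lerD2l lerN2 ler_expR lerN2 exprn_ege1.
move=> l; rewrite le_eqVlt => /predU1P[<-|l0].
  have E : (fun v : R => `|v| `^ (- 1 - 2 * sigma) * (1 - expR (- (v ^+ 2 * 0 ^+ 2))) ^+ m) = cst 0.
    by apply/funext => v; rewrite expr0n mulr0 oppr0 expR0 subrr expr0n eqn0Ngt m0 mulr0.
  rewrite E powR0 ?mul0r; last by rewrite gt_eqF//; lra.
  by split; [exact: integrable0|rewrite Rintegral_cst ?mul0r].
have E : (fun v : R => `|v| `^ (- 1 - 2 * sigma) * (1 - expR (- (v ^+ 2 * l ^+ 2))) ^+ m) =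
    (fun v => l `^ (1 + 2 * sigma) * f (l * v)).
  have h : l `^ (1 + 2 * sigma) * l `^ (- 1 - 2 * sigma) = 1.
    by rewrite -powRD ?(gt_eqF l0) ?implybT// (_ : _ + _ = 0) ?powRr0//; ring.
  apply/funext => v; rewrite /f normrM (gtr0_norm l0) powRM ?normr_ge0 ?ltW//.
  have -> : (l * v) ^+ 2 = v ^+ 2 * l ^+ 2 by ring.
  have aux (U V Q P : R) : U * (V * Q * P) = U * V * (Q * P) by ring.
  by rewrite aux h mul1r.
have il := integrable_scale l0 intf.
rewrite E; split; first exact: (integrableZl measurableT _ il).
have -> : \int[lebesgue_measure]_v (l `^ (1 + 2 * sigma) * f (l * v)) =
    l `^ (1 + 2 * sigma) * \int[lebesgue_measure]_v f (l * v).
  by apply: RintegralZl; [exact: measurableT|exact: il].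
rewrite [in RHS](Rintegral_scale l0 mf f0) mulrA; congr (_ * _).
by rewrite -{3}(powRr1 (ltW l0)) -powRD ?(gt_eqF l0) ?implybT//; congr powR; ring.
Qed.

(** The factor (r + Y)^(-(n+1)/2) of the heat bounds decreases in r, and all sample points of the
    difference are at least a, so it comes out of the integral as (a + Y)^(-(n+1)/2). In the
    variable w = v / sqrt a a Cauchy integral remains, and the power of a is the one left by this
    substitution. *)
Lemma heat_kernel_bound (R : realType) (n m : nat) (sigma : R) :
  1 <= sigma -> 1 + 2 * sigma <= (2 * m)%:R ->
  exists2 C : R, 0 < C & forall a Y : R, 0 < a -> 0 <= Y ->
    lebesgue_measure.-integrable setT
      (EFin \o (fun v : R => `|v| `^ (- 1 - 2 * sigma) * fdiff (v ^+ 2) m (heat n Y) a)) /\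
    \int[lebesgue_measure]_v `| `|v| `^ (- 1 - 2 * sigma) * fdiff (v ^+ 2) m (heat n Y) a| <=
      C * Num.sqrt a `^ (1 - 2 * sigma) * (Num.sqrt (a + Y))^-1 ^+ n.+1.
Proof.
move=> s1 sm.
have [C0 C00 HC0] := heatder_bound R n 0; have [Cm Cm0 HCm] := heatder_bound R n m.
pose c := Num.sqrt pi ^+ n : R.
have c0 : 0 < c by rewrite exprn_gt0// sqrtr_gt0 pi_gt0.
(* Every sample point r of the difference satisfies r <= a + m v^2 <= (m + 1) max(a, v^2), hence
   sqrt r <= d max(sqrt a, |v|). *)
pose d := Num.sqrt (m.+1)%:R : R.
have d0 : 0 < d by rewrite sqrtr_gt0 ltr0n.
pose K := c * d * (Cm + 2 ^+ m * C0).
have K0 : 0 < K by rewrite !mulr_gt0// addr_gt0// mulr_gt0// exprn_gt0.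
pose Pi := \int[lebesgue_measure]_w (1 + (w : R) ^+ 2)^-1.
have Pi0 : 0 <= Pi by apply: Rintegral_ge0 => w _; rewrite invr_ge0 addr_ge0// sqr_ge0.
exists (K * 2 * (Pi + 1)); first by rewrite mulr_gt0 ?ltr_wpDl// mulr_gt0.
move=> a Y a0 Y0.
pose b := Num.sqrt a; have b0 : 0 < b by rewrite sqrtr_gt0.
have b2 : b ^+ 2 = a by rewrite sqr_sqrtr// ltW.
pose S := (Num.sqrt (a + Y))^-1 ^+ n.+1.
have aY : 0 < a + Y by rewrite ltr_pwDl.
have S0 : 0 < S by rewrite exprn_gt0// invr_gt0 sqrtr_gt0.
(* The finite difference is controlled by the m-th derivative for small steps and termwise for large ones. *)
have main v : `|fdiff (v ^+ 2) m (heat n Y) a| <= K * b * S * small_large m (b^-1 * v).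
  have v0 : 0 <= v ^+ 2 by exact: sqr_ge0.
  have -> : fdiff (v ^+ 2) m (heat n Y) a = c * fdiff (v ^+ 2) m (heatder n Y 0) a.
    by rewrite -fdiffZ; apply: fdiff_eq => // r r0; rewrite heatE.
  have SS r : a <= r -> (Num.sqrt (r + Y))^-1 ^+ n.+1 <= S.
    move=> ar; have r0 : 0 < r by exact: lt_le_trans ar.
    rewrite /S lerXn2r ?nnegrE ?invr_ge0 ?sqrtr_ge0// lef_pV2 ?posrE ?sqrtr_gt0 ?ltr_pwDl//.
    by apply: ler_wsqrtr; rewrite lerD2r.
  have vE : (b^-1 * v) ^+ 2 = v ^+ 2 / a by rewrite exprMn exprVn b2 mulrC.
  rewrite normrM (gtr0_norm c0) /small_large vE ler_pdivrMr// mul1r (mulrC c).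
  case: ifPn => va.
    have sq r : r <= a + m%:R * v ^+ 2 -> Num.sqrt r <= d * b.
      move=> ra; rewrite /d /b -sqrtrM ?ler0n//; apply: ler_wsqrtr; rewrite (le_trans ra)//.
      by rewrite mulrSr mulrDl mul1r addrC lerD2r ler_wpM2l.
    have bnd : `|fdiff (v ^+ 2) m (heatder n Y 0) a| <= (v ^+ 2) ^+ m * (Cm * a^-1 ^+ m * (d * b) * S).
      apply: fdiff_bound => //; first by move=> k r; exact: heatderP.
      move=> r /andP[ar ra]; have r0 : 0 < r by exact: lt_le_trans ar.
      rewrite add0n (le_trans (HCm _ _ Y0 r0))//.
      rewrite ler_pM ?SS ?mulr_ge0 ?exprn_ge0 ?invr_ge0 ?sqrtr_ge0// ?(ltW Cm0) ?(ltW r0)//.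
      rewrite ler_pM ?sq ?mulr_ge0 ?exprn_ge0 ?invr_ge0 ?sqrtr_ge0// ?(ltW Cm0) ?(ltW r0)//.
      rewrite ler_pM2l// lerXn2r ?nnegrE ?invr_ge0 ?(ltW r0) ?(ltW a0)//.
      by rewrite lef_pV2 ?posrE.
    apply: (@le_trans _ _ ((v ^+ 2) ^+ m * (Cm * a^-1 ^+ m * (d * b) * S) * c)).
      by rewrite ler_pM2r.
    rewrite (_ : _ * c = c * d * Cm * (b * S * (v ^+ 2 / a) ^+ m)); last first.
      have aux (U W S' c' d' b' C' : R) :
        U * (C' * W * (d' * b') * S') * c' = c' * d' * C' * (b' * S' * (U * W)) by ring.
      by rewrite (exprMn _ (v ^+ 2)) aux.
    rewrite (_ : K * b * S * _ = K * (b * S * (v ^+ 2 / a) ^+ m)); last by rewrite !mulrA.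
    rewrite ler_wpM2r ?mulr_ge0 ?exprn_ge0 ?divr_ge0 ?(ltW b0) ?(ltW S0) ?(ltW a0)//.
    by rewrite ler_pM2l ?mulr_gt0// lerDl mulr_ge0// ?exprn_ge0// ltW.
  rewrite -ltNge in va.
  have sq r : r <= a + m%:R * v ^+ 2 -> Num.sqrt r <= d * `|v|.
    move=> ra; rewrite -(sqrtr_sqr v) /d -sqrtrM ?ler0n//; apply: ler_wsqrtr.
    by rewrite (le_trans ra)// mulrSr mulrDl mul1r addrC lerD2l ltW.
  have bnd : `|fdiff (v ^+ 2) m (heatder n Y 0) a| <= 2 ^+ m * (C0 * (d * `|v|) * S).
    apply: fdiff_le => // r /andP[ar ra]; have r0 : 0 < r by exact: lt_le_trans ar.
    rewrite (le_trans (HC0 _ _ Y0 r0))// expr0 mulr1.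
    rewrite ler_pM ?SS ?mulr_ge0 ?exprn_ge0 ?invr_ge0 ?sqrtr_ge0// ?(ltW C00)//.
    by rewrite ler_pM2l// sq.
  apply: (@le_trans _ _ (2 ^+ m * (C0 * (d * `|v|) * S) * c)).
    by rewrite ler_pM2r.
  rewrite (_ : _ * c = c * d * (2 ^+ m * C0) * (`|v| * S)); last first.
    have aux (U V S' c' d' C' : R) :
      U * (C' * (d' * V) * S') * c' = c' * d' * (U * C') * (V * S') by ring.
    by rewrite aux.
  rewrite normrM (gtr0_norm (_ : 0 < b^-1)) ?invr_gt0//.
  rewrite (_ : K * b * S * _ = K * (`|v| * S)); last by field; rewrite gt_eqF.
  rewrite ler_wpM2r ?mulr_ge0 ?(ltW S0)//.
  by rewrite ler_pM2l ?mulr_gt0// lerDr ltW.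
pose f (v : R) := `|v| `^ (- 1 - 2 * sigma) * fdiff (v ^+ 2) m (heat n Y) a.
pose g (v : R) := K * b * S * b `^ (- 1 - 2 * sigma) * 2 * (1 + (b^-1 * v) ^+ 2)^-1.
have fg v : `|f v| <= g v.
  rewrite /f normrM (ger0_norm (powR_ge0 _ _)).
  apply: (@le_trans _ _ (`|v| `^ (- 1 - 2 * sigma) * (K * b * S * small_large m (b^-1 * v)))).
    by rewrite ler_wpM2l ?powR_ge0.
  have -> : `|v| `^ (- 1 - 2 * sigma) = b `^ (- 1 - 2 * sigma) * `|b^-1 * v| `^ (- 1 - 2 * sigma).
    rewrite -powRM ?(ltW b0)// normrM (gtr0_norm (_ : 0 < b^-1)) ?invr_gt0// mulVKf// gt_eqF//.
  have := small_large_bound (b^-1 * v) s1 sm.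
  rewrite /g; set B := b `^ _; set W := `|b^-1 * v| `^ _ => h.
  rewrite (_ : B * W * _ = K * b * S * B * (W * small_large m (b^-1 * v))); last by ring.
  rewrite -[leRHS]mulrA ler_wpM2l// mulr_ge0 ?powR_ge0// mulr_ge0 ?(ltW S0)//.
  by rewrite mulr_ge0 ?(ltW b0) ?(ltW K0).
have mf : measurable_fun setT f.
  apply: measurable_funM; first by solve_measurable.
  by apply: fdiff_measurable; [rewrite /heat|idtac|idtac]; solve_measurable.
have i1 : lebesgue_measure.-integrable setT (EFin \o (fun v : R => (1 + (b^-1 * v) ^+ 2)^-1)).
  by apply: (integrable_scale (f := fun v => (1 + v ^+ 2)^-1)); [rewrite invr_gt0|exact: integrable_cauchy].
have ig : lebesgue_measure.-integrable setT (EFin \o g).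
  exact: (integrableZl measurableT (K * b * S * b `^ (- 1 - 2 * sigma) * 2) i1).
split; first exact: (integrable_domR mf fg ig).
apply: (@le_trans _ _ (\int[lebesgue_measure]_v g v)).
  apply: le_Rintegral => //; last by move=> v _; exact: fg.
  exact: (integrable_norm (integrable_domR mf fg ig)).
have -> : \int[lebesgue_measure]_v g v = K * b * S * b `^ (- 1 - 2 * sigma) * 2 * (b * Pi).
  rewrite RintegralZl//; congr (_ * _).
  have bV : 0 < b^-1 by rewrite invr_gt0.
  have mc : measurable_fun setT (fun v : R => (1 + v ^+ 2)^-1) by solve_measurable.
  have pc (v : R) : 0 <= (1 + v ^+ 2)^-1 by rewrite invr_ge0 addr_ge0// sqr_ge0.
  by rewrite /Pi (Rintegral_scale bV mc pc) mulVKf// gt_eqF.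
have -> : b `^ (1 - 2 * sigma) = b * b * b `^ (- 1 - 2 * sigma).
  rewrite -{2 3}(powRr1 (ltW b0)) -!powRD ?(gt_eqF b0) ?implybT//; congr powR; ring.
rewrite -/b -/S; set B := b `^ _.
rewrite (_ : _ * (b * Pi) = K * 2 * (b * b * B * S) * Pi); last by ring.
rewrite [leRHS](_ : _ = K * 2 * (b * b * B * S) * (Pi + 1)); last by ring.
have B0 : 0 <= B by exact: powR_ge0.
apply: ler_wpM2l; last by rewrite lerDl.
apply: mulr_ge0; first by apply: mulr_ge0 => //; exact: ltW.
apply: mulr_ge0; last exact: ltW.
by apply: mulr_ge0 => //; apply: mulr_ge0; exact: ltW.
Qed.

(** * The fractional Laplacian of the profile *)

Lemma dot_rV0 (R : realType) n (x : 'rV[R]_n) : dot_rV x 0 = 0.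
Proof. by rewrite /dot_rV big1// => i _; rewrite mxE mulr0. Qed.

Lemma dot_rVC (R : realType) n (x y : 'rV[R]_n) : dot_rV x y = dot_rV y x.
Proof. by rewrite /dot_rV; apply: eq_bigr => i _; rewrite mulrC. Qed.

Lemma integrable_gaussn (R : realType) n (s : R) : 0 < s ->
  (lebesgue_rV n).-integrable setT (EFin \o (fun x => expR (- (s * dot_rV x x)))) /\
  \int[lebesgue_rV n]_x expR (- (s * dot_rV x x)) = Num.sqrt (pi / s) ^+ n.
Proof.
move=> s0; have [i1 _ e1 _] := gauss_fourier (0 : 'rV[R]_n) s0.
have E : (fun x : 'rV[R]_n => cos (dot_rV x 0) * expR (- (s * dot_rV x x))) =
    (fun x => expR (- (s * dot_rV x x))).
  by apply/funext => x; rewrite dot_rV0 cos0 mul1r.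
by rewrite E dot_rV0 mul0r oppr0 expR0 mulr1 in i1 e1 *.
Qed.

Lemma Rintegral_EFin d (T : measurableType d) (R : realType) (mu : {measure set T -> \bar R})
    (f : T -> R) : mu.-integrable setT (EFin \o f) ->
  (\int[mu]_x (f x)%:E = (\int[mu]_x f x)%:E)%E.
Proof. by move=> i; rewrite fineK// integrable_fin_num. Qed.

Lemma eq_RintegralT d (T : measurableType d) (R : realType) (mu : {measure set T -> \bar R})
    (f g : T -> R) : (forall x, f x = g x) -> \int[mu]_x f x = \int[mu]_x g x.
Proof. by move=> fg; apply: eq_Rintegral => x _. Qed.

Definition profile (R : realType) n (k : R) (x : 'rV[R]_n) : R :=
  (Num.sqrt (1 + k * dot_rV x x))^-1 ^+ n.+1.

Lemma profile_base_gt0 (R : realType) n (k : R) (x : 'rV[R]_n) : 0 < k ->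
  0 < Num.sqrt (1 + k * dot_rV x x).
Proof. by move=> k0; rewrite sqrtr_gt0 ltr_pwDl// mulr_ge0 ?dot_rV_ge0// ltW. Qed.

Lemma profile_gt0 (R : realType) n (k : R) (x : 'rV[R]_n) : 0 < k -> 0 < profile k x.
Proof. by move=> k0; rewrite exprn_gt0// invr_gt0 profile_base_gt0. Qed.

Lemma profile_subord (R : realType) n (k : R) (x : 'rV[R]_n) : 0 < k ->
  \int[lebesgue_measure]_u (`|u| ^+ n * expR (- (u ^+ 2 * (1 + k * dot_rV x x)))) =
  subord R n * profile k x.
Proof.
move=> k0; have b0 := profile_base_gt0 x k0.
rewrite /profile -(subord_scale n b0) sqr_sqrtr; last by rewrite ltW// -sqrtr_gt0.
exact: erefl.
Qed.

(** The mixture weight |u|^n times the total mass of exp(-k u^2 |x|^2). It is constant in u away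
    from 0; at u = 0 it is 0 when n > 0, so the slice on which the Gaussian is not integrable
    contributes nothing. *)
Definition mixweight (R : realType) (n : nat) (k u : R) : R :=
  `|u| ^+ n * Num.sqrt (pi / (k * u ^+ 2)) ^+ n.

Lemma mixweightE (R : realType) (n : nat) (k u : R) : 0 < k -> u != 0 ->
  mixweight n k u = Num.sqrt (pi / k) ^+ n.
Proof.
move=> k0 u0; rewrite /mixweight -exprMn; congr (_ ^+ _).
rewrite -sqrtr_sqr -sqrtrM ?sqr_ge0//; congr Num.sqrt; field.
by rewrite u0 gt_eqF.
Qed.

Lemma mixweight_le (R : realType) (n : nat) (k u : R) : (0 < n)%N -> 0 < k ->
  0 <= mixweight n k u <= Num.sqrt (pi / k) ^+ n.
Proof.
move=> n0 k0; have [->|u0] := eqVneq u 0.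
  by rewrite /mixweight normr0 expr0n eqn0Ngt n0 mul0r lexx exprn_ge0// sqrtr_ge0.
by rewrite mixweightE// lexx exprn_ge0// sqrtr_ge0.
Qed.

(** The function [cs] stands for the cosine or the sine. The assumption n > 0 makes |u|^n vanish on
    the slice u = 0, where the Gaussian in x has no finite integral. *)
Lemma profile_fubini (R : realType) n (k : R) (cs : R -> R) (xi : 'rV[R]_n) : (0 < n)%N -> 0 < k ->
  measurable_fun setT cs -> (forall r, `|cs r| <= 1) ->
  (lebesgue_rV n).-integrable setT (EFin \o (fun x => cs (dot_rV x xi) * profile k x)) /\
  subord R n * \int[lebesgue_rV n]_x (cs (dot_rV x xi) * profile k x) =
  \int[lebesgue_measure]_u (`|u| ^+ n * expR (- u ^+ 2) *
    \int[lebesgue_rV n]_x (cs (dot_rV x xi) * expR (- (k * u ^+ 2 * dot_rV x x)))).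
Proof.
move=> n0 k0 mcs cs1.
pose K (z : measurableTypeR R * 'rV[R]_n) : R :=
  `|z.1| ^+ n * expR (- z.1 ^+ 2) * (cs (dot_rV z.2 xi) * expR (- (k * z.1 ^+ 2 * dot_rV z.2 z.2))).
have mK : measurable_fun setT K.
  rewrite /K; apply: measurable_funM; first by solve_measurable.
  by apply: measurable_funM; [apply: (measurableT_comp mcs)|]; solve_measurable.
have ig : lebesgue_measure.-integrable setT (EFin \o (fun u : R => Num.sqrt (pi / k) ^+ n * expR (- u ^+ 2))).
  have := integrable_gaussr 0 (@ltr01 R).
  rewrite (_ : (fun x => _) = (fun u : R => expR (- u ^+ 2))); last first.
    by apply/funext => u; rewrite expr0 mul1r mulr1.
  exact: (integrableZl measurableT (Num.sqrt (pi / k) ^+ n)).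
have dom u : (\int[lebesgue_rV n]_x `|K (u, x)|%:E <= (Num.sqrt (pi / k) ^+ n * expR (- u ^+ 2))%:E)%E.
  have [->|u0] := eqVneq u 0.
    rewrite integral0_eq ?lee_fin ?mulr_ge0 ?exprn_ge0 ?sqrtr_ge0 ?expR_ge0// => x _.
    by rewrite /K/= normr0 expr0n eqn0Ngt n0 !mul0r normr0.
  have ku : 0 < k * u ^+ 2 by rewrite mulr_gt0// exprn_even_gt0.
  have [ign Ign] := integrable_gaussn n ku.
  apply: (@le_trans _ _ (\int[lebesgue_rV n]_x
      (`|u| ^+ n * expR (- u ^+ 2) * expR (- (k * u ^+ 2 * dot_rV x x)))%:E)%E).
    apply: ge0_le_integral_nomeas => x _; rewrite lee_fin//.
    rewrite /K/= !normrM (ger0_norm (expR_ge0 _)) normrX normr_id.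
    rewrite ler_wpM2l ?mulr_ge0 ?exprn_ge0 ?expR_ge0// (ger0_norm (expR_ge0 _)).
    by rewrite ler_piMl ?expR_ge0.
  have -> : (\int[lebesgue_rV n]_x (`|u| ^+ n * expR (- u ^+ 2) * expR (- (k * u ^+ 2 * dot_rV x x)))%:E =
      (`|u| ^+ n * expR (- u ^+ 2))%:E * \int[lebesgue_rV n]_x (expR (- (k * u ^+ 2 * dot_rV x x)))%:E)%E.
    apply: ge0_EintegralZl => [||x]; [|by solve_measurable|exact: expR_ge0].
    by rewrite mulr_ge0 ?exprn_ge0 ?expR_ge0.
  rewrite Rintegral_EFin// Ign -EFinM lee_fin mulrAC -(mixweightE _ k0 u0)//.
have iu x : lebesgue_measure.-integrable setT (EFin \o (fun u => K (u, x))).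
  apply: (integrable_domR (g := fun u : R => `|u| ^+ n * expR (- (u ^+ 2 * 1)))).
  - by rewrite /K/=; solve_measurable.
  - move=> u; rewrite /K/= !normrM (ger0_norm (expR_ge0 _)) normrX normr_id mulr1.
    rewrite ler_piMr ?mulr_ge0 ?exprn_ge0 ?expR_ge0// (ger0_norm (expR_ge0 _)).
    rewrite -[leRHS]mulr1 ler_pM// ?expR_ge0// -[leRHS]expR0 ler_expR oppr_le0.
    exact: mulr_ge0 (mulr_ge0 (ltW k0) (sqr_ge0 _)) (dot_rV_ge0 _).
  - exact: integrable_gaussr.
have [E _ i2] := Rfubini mK dom ig iu.
have Ex x : \int[lebesgue_measure]_u K (u, x) = subord R n * (cs (dot_rV x xi) * profile k x).
  have c0 : 0 < 1 + k * dot_rV x x by rewrite ltr_pwDl// mulr_ge0 ?dot_rV_ge0// ltW.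
  have ii := integrable_gaussr n c0.
  rewrite mulrCA -(profile_subord x k0).
  transitivity (\int[lebesgue_measure]_u (cs (dot_rV x xi) *
      (`|u| ^+ n * expR (- (u ^+ 2 * (1 + k * dot_rV x x)))))); last first.
    by apply: RintegralZl; [exact: measurableT|exact: ii].
  apply: eq_RintegralT => u; rewrite /K/= [LHS]mulrCA -!mulrA -expRD.
  by congr (_ * (_ * expR _)); ring.
have s0 : subord R n != 0 by rewrite gt_eqF// subord_gt0.
have i3 : (lebesgue_rV n).-integrable setT (EFin \o (fun x => cs (dot_rV x xi) * profile k x)).
  have := integrableZl measurableT (subord R n)^-1 i2.
  rewrite (_ : (fun x => _) = EFin \o (fun x => cs (dot_rV x xi) * profile k x))//.
  by apply/funext => x; rewrite /= Ex -EFinM mulKf.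
split => //.
rewrite -RintegralZl// -(eq_RintegralT _ Ex) -E.
apply: eq_Rintegral => u _; rewrite /K/=.
have [->|u0] := eqVneq u 0.
  rewrite normr0 expr0n eqn0Ngt n0 !mul0r.
  by under eq_Rintegral do rewrite !mul0r; rewrite Rintegral_cst ?mul0r.
have ku : 0 < k * u ^+ 2 by rewrite mulr_gt0// exprn_even_gt0.
rewrite RintegralZl//.
apply: (integrable_dom _ _ (integrable_gaussn n ku).1).
  by apply: measurable_funM; [apply: (measurableT_comp mcs)|]; solve_measurable.
by move=> x; rewrite normrM (ger0_norm (expR_ge0 _)) ler_piMl ?expR_ge0.
Qed.

(** The domination required by Fubini comes from x = 0: there the kernel is nonnegative, it
    dominates the kernels for all other x since |cos| <= 1, and its xi-integral is itself a finite
    difference of the heat kernel, at Y = 0. The bound on the result uses Y = |x|^2 / 4. *)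
Lemma riesz_heat (R : realType) (n : nat) (sigma : R) : 1 <= sigma ->
  exists2 C : R, 0 < C & forall (a : R) (x : 'rV[R]_n), 0 < a ->
    (lebesgue_rV n).-integrable setT (EFin \o (fun xi : 'rV[R]_n =>
      euclid_norm xi `^ (2 * sigma) * (cos (dot_rV xi x) * expR (- (a * dot_rV xi xi))))) /\
    `|\int[lebesgue_rV n]_xi (euclid_norm xi `^ (2 * sigma) *
        (cos (dot_rV xi x) * expR (- (a * dot_rV xi xi))))| <=
    C * Num.sqrt a `^ (1 - 2 * sigma) * (Num.sqrt (a + dot_rV x x / 4))^-1 ^+ n.+1.
Proof.
(* As truncn sigma + 1 > sigma, this gives 2 m >= 2 sigma + 2. *)
move=> s1; pose m := (Num.truncn sigma).+2.
have sm : 1 + 2 * sigma <= (2 * m)%:R.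
  have := ltW (truncnS_gt sigma); rewrite natrM /m [in X in _ -> X]mulrSr => h; lra.
have [C1 C10 H1] := laplace_power s1 sm (isT : (0 < m)%N).
have [C2 C20 H2] := heat_kernel_bound n s1 sm.
exists (C1^-1 * C2); first by rewrite mulr_gt0// invr_gt0.
move=> a x a0.
pose K (z : measurableTypeR R * 'rV[R]_n) : R := `|z.1| `^ (- 1 - 2 * sigma) *
  ((1 - expR (- (z.1 ^+ 2 * dot_rV z.2 z.2))) ^+ m * (cos (dot_rV z.2 x) * expR (- (a * dot_rV z.2 z.2)))).
have mK : measurable_fun setT K by rewrite /K; solve_measurable.
have Y0 : 0 <= dot_rV x x / 4 by rewrite divr_ge0// dot_rV_ge0.
have [ig _] := H2 a 0 a0 (lexx _).
have [ih bh] := H2 a _ a0 Y0.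
have E0 (v : R) : (lebesgue_rV n).-integrable setT (EFin \o (fun xi : 'rV[R]_n =>
    (1 - expR (- (v ^+ 2 * dot_rV xi xi))) ^+ m * expR (- (a * dot_rV xi xi)))) /\
  \int[lebesgue_rV n]_xi ((1 - expR (- (v ^+ 2 * dot_rV xi xi))) ^+ m * expR (- (a * dot_rV xi xi))) =
  fdiff (v ^+ 2) m (heat n 0) a.
  have [i E] := fdiff_integral m (sqr_ge0 v) a0 (fun r r0 => (@integrable_gaussn R n r r0).1).
  split.
    rewrite (_ : (fun xi => _) = (fun xi : 'rV[R]_n => fdiff (v ^+ 2) m (fun r => expR (- (r * dot_rV xi xi))) a))//.
    by apply/funext => xi; rewrite fdiff_exp.
  transitivity (\int[lebesgue_rV n]_xi fdiff (v ^+ 2) m (fun r => expR (- (r * dot_rV xi xi))) a).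
    by apply: eq_Rintegral => xi _; rewrite fdiff_exp.
  rewrite E; apply: fdiff_eq => //; first exact: sqr_ge0.
  by move=> r r0; rewrite (integrable_gaussn n r0).2 /heat mul0r oppr0 expR0 mulr1.
have Ex (v : R) : \int[lebesgue_rV n]_xi K (v, xi) =
    `|v| `^ (- 1 - 2 * sigma) * fdiff (v ^+ 2) m (heat n (dot_rV x x / 4)) a.
  have gi r : 0 < r -> (lebesgue_rV n).-integrable setT
      (EFin \o (fun xi : 'rV[R]_n => cos (dot_rV xi x) * expR (- (r * dot_rV xi xi)))).
    by move=> r0; have [] := gauss_fourier x r0.
  have [i E] := fdiff_integral m (sqr_ge0 v) a0 gi.
  have FE (xi : 'rV[R]_n) : fdiff (v ^+ 2) m (fun r => cos (dot_rV xi x) * expR (- (r * dot_rV xi xi))) a =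
    (1 - expR (- (v ^+ 2 * dot_rV xi xi))) ^+ m * (cos (dot_rV xi x) * expR (- (a * dot_rV xi xi))).
    by rewrite fdiffZ fdiff_exp mulrCA.
  have -> : fdiff (v ^+ 2) m (heat n (dot_rV x x / 4)) a =
      \int[lebesgue_rV n]_xi fdiff (v ^+ 2) m (fun r => cos (dot_rV xi x) * expR (- (r * dot_rV xi xi))) a.
    rewrite E; apply: fdiff_eq => //; first exact: sqr_ge0.
    move=> r r0; have [_ _ -> _] := gauss_fourier x r0; rewrite /heat.
    by congr (_ * expR (- _)); field; rewrite gt_eqF.
  rewrite -RintegralZl//; apply: eq_Rintegral => xi _.
  by rewrite FE.
have dom v : (\int[lebesgue_rV n]_xi `|K (v, xi)|%:E <=
    (`|v| `^ (- 1 - 2 * sigma) * fdiff (v ^+ 2) m (heat n 0) a)%:E)%E.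
  have [i <-] := E0 v.
  rewrite EFinM -Rintegral_EFin// -ge0_EintegralZl ?powR_ge0//; last 2 first.
  - by solve_measurable.
  - move=> xi; rewrite mulr_ge0 ?expR_ge0// exprn_ge0// subr_ge0 -[leRHS]expR0 ler_expR oppr_le0.
    exact: mulr_ge0 (sqr_ge0 _) (dot_rV_ge0 _).
  apply: ge0_le_integral_nomeas => xi _; rewrite lee_fin//.
  have e0 : 0 <= (1 - expR (- (v ^+ 2 * dot_rV xi xi))) ^+ m.
    rewrite exprn_ge0// subr_ge0 -[leRHS]expR0 ler_expR oppr_le0.
    exact: mulr_ge0 (sqr_ge0 _) (dot_rV_ge0 _).
  rewrite /K/= normrM (ger0_norm (powR_ge0 _ _)) ler_wpM2l ?powR_ge0//.
  rewrite normrM (ger0_norm e0) ler_wpM2l// normrM (ger0_norm (expR_ge0 _)).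
  by rewrite ler_piMl ?expR_ge0// ler_norml cos_geN1 cos_le1.
have lE (xi : 'rV[R]_n) : dot_rV xi xi = euclid_norm xi ^+ 2.
  by rewrite sqr_sqrtr// dot_rV_ge0.
have l0 (xi : 'rV[R]_n) : 0 <= euclid_norm xi by exact: sqrtr_ge0.
have iv xi : lebesgue_measure.-integrable setT (EFin \o (fun v => K (v, xi))).
  have [i _] := H1 _ (l0 xi).
  have := integrableZl measurableT (cos (dot_rV xi x) * expR (- (a * dot_rV xi xi))) i.
  congr (_.-integrable _ _); apply/funext => v; rewrite /K/= -EFinM; congr EFin.
  by rewrite lE; ring.
have Ey xi : \int[lebesgue_measure]_v K (v, xi) =
    C1 * (euclid_norm xi `^ (2 * sigma) * (cos (dot_rV xi x) * expR (- (a * dot_rV xi xi)))).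
  have [i E] := H1 _ (l0 xi).
  transitivity ((cos (dot_rV xi x) * expR (- (a * dot_rV xi xi))) * (euclid_norm xi `^ (2 * sigma) * C1)).
    rewrite -E -RintegralZl//; apply: eq_Rintegral => v _; rewrite /K/= lE.
    by move: (expR _) (_ `^ _) (cos _) (_ ^+ m) => A B D F; ring.
  by move: (expR _) (_ `^ _) (cos _) => A B D; ring.
have [E _ i2] := Rfubini mK dom ig iv.
have i3 : (lebesgue_rV n).-integrable setT (EFin \o (fun xi : 'rV[R]_n =>
      euclid_norm xi `^ (2 * sigma) * (cos (dot_rV xi x) * expR (- (a * dot_rV xi xi))))).
  have := integrableZl measurableT C1^-1 i2.
  congr (_.-integrable _ _); apply/funext => xi; rewrite /= Ey -EFinM mulKf//.
  by rewrite gt_eqF.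
split => //.
have -> : \int[lebesgue_rV n]_xi (euclid_norm xi `^ (2 * sigma) * (cos (dot_rV xi x) * expR (- (a * dot_rV xi xi)))) =
    C1^-1 * \int[lebesgue_measure]_v (`|v| `^ (- 1 - 2 * sigma) * fdiff (v ^+ 2) m (heat n (dot_rV x x / 4)) a).
  transitivity (C1^-1 * \int[lebesgue_measure]_v \int[lebesgue_rV n]_xi K (v, xi)).
    by rewrite E (eq_RintegralT _ Ey) RintegralZl// mulKf// gt_eqF.
  by congr (_ * _); exact: eq_RintegralT.
rewrite normrM (gtr0_norm (_ : 0 < C1^-1)) ?invr_gt0// -!mulrA ler_pM2l ?invr_gt0// !mulrA.
exact: le_trans (le_normr_Rintegral measurableT ih) bh.
Qed.

Lemma Rintegral_eq0 d (T : measurableType d) (R : realType) (mu : {measure set T -> \bar R})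
    (f : T -> R) : (forall x, f x = 0) -> \int[mu]_x f x = 0.
Proof. by move=> f0; rewrite (eq_RintegralT _ f0) /Rintegral integral0. Qed.

Lemma integrable_pow1_gauss (R : realType) (N : nat) :
  lebesgue_measure.-integrable setT (EFin \o (fun u : R => (1 + `|u|) ^+ N * expR (- u ^+ 2))).
Proof.
have i0 := integrable_gaussr 0 (@ltr01 R); have iN := integrable_gaussr N (@ltr01 R).
have i : lebesgue_measure.-integrable setT (EFin \o (fun u : R => 2 ^+ N *
    (`|u| ^+ 0 * expR (- (u ^+ 2 * 1)) + `|u| ^+ N * expR (- (u ^+ 2 * 1))))).
  exact: (integrableZl measurableT (2 ^+ N) (integrableD measurableT i0 iN)).
apply: (integrable_domR _ _ i) => [|u]; first by solve_measurable.
rewrite ger0_norm; last by rewrite mulr_ge0 ?expR_ge0// exprn_ge0// addr_ge0.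
rewrite expr0 mulr1 -mulrDl mulrA ler_wpM2r ?expR_ge0//.
have [u1|u1] := leP `|u| 1.
  rewrite -[leLHS]mulr1 ler_pM ?exprn_ge0 ?addr_ge0 ?lerDl ?exprn_ge0//.
  by rewrite lerXn2r ?nnegrE ?addr_ge0 ?lerD2l.
apply: (@le_trans _ _ ((2 * `|u|) ^+ N)).
  by rewrite lerXn2r ?nnegrE ?addr_ge0 ?mulr_ge0// mulrDl mul1r lerD2r ltW.
by rewrite exprMn ler_wpM2l ?exprn_ge0// lerDr.
Qed.

(** Replacing k U^2 by k costs a factor growing only linearly in U, which the Gaussian weight in u
    can absorb. After squaring and clearing denominators the difference is a polynomial with
    nonnegative coefficients. *)
Lemma shift_profile_le (R : realType) (k U Y : R) : 0 < k -> 0 < U -> 0 <= Y ->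
  U * (Num.sqrt (1 + k * U ^+ 2 * Y))^-1 <= (1 + U) * (Num.sqrt (1 + k * Y))^-1.
Proof.
move=> k0 U0 Y0.
have p1 : 0 < 1 + k * U ^+ 2 * Y.
  by rewrite ltr_pwDl// mulr_ge0// mulr_ge0 ?sqr_ge0// ltW.
have p2 : 0 < 1 + k * Y by rewrite ltr_pwDl// mulr_ge0// ltW.
rewrite ler_pdivrMr ?sqrtr_gt0// mulrAC ler_pdivlMr ?sqrtr_gt0//.
have U1 : 0 < 1 + U by rewrite addr_gt0.
rewrite -(ler_pXn2r (_ : (0 < 2)%N)) ?nnegrE ?mulr_ge0 ?sqrtr_ge0 ?(ltW U0) ?(ltW U1)//.
rewrite !exprMn !sqr_sqrtr ?(ltW p1) ?(ltW p2)// -subr_ge0.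
have -> : (1 + U) ^+ 2 * (1 + k * U ^+ 2 * Y) - U ^+ 2 * (1 + k * Y) =
  1 + 2 * U + k * U ^+ 2 * Y * (2 * U + U ^+ 2) by ring.
have U2 : 0 <= 2 * U + U ^+ 2 by rewrite addr_ge0 ?sqr_ge0// mulr_ge0// ltW.
have kU : 0 <= k * U ^+ 2 * Y by rewrite mulr_ge0// mulr_ge0 ?sqr_ge0// ltW.
by rewrite addr_ge0 ?(mulr_ge0 kU U2)// addr_ge0// mulr_ge0// ltW.
Qed.

(** Here a = 1 / (4 k u^2) is the parameter of the transform of exp(-k u^2 |x|^2). With w = 2 sqrt k
    |u| the bound for a single Gaussian is w^(2 sigma + n) (1 + k u^2 |x|^2)^(-(n+1)/2). The weight
    (pi / k)^(n/2) reduces the power of k to k^sigma, and the powers of |u| are collected in (1 +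
    |u|)^N, where N exceeds 2 sigma - 1 by at least n + 1. *)
Lemma riesz_mix (R : realType) (n : nat) (sigma : R) : 1 <= sigma ->
  exists2 C : R, 0 < C & exists N : nat, forall (k u : R) (x : 'rV[R]_n), 0 < k -> u != 0 ->
    mixweight n k u * `|\int[lebesgue_rV n]_xi (euclid_norm xi `^ (2 * sigma) *
        (cos (dot_rV xi x) * expR (- ((4 * k * u ^+ 2)^-1 * dot_rV xi xi))))| <=
    C * Num.sqrt k `^ (2 * sigma) * (1 + `|u|) ^+ N * profile k x.
Proof.
move=> s1; have [C C0 HC] := riesz_heat n s1.
pose K := (Num.truncn (2 * sigma)).+1.
have KS : 2 * sigma - 1 <= K%:R by have := ltW (truncnS_gt (2 * sigma)); rewrite -/K => h; lra.
exists (C * Num.sqrt pi ^+ n * 2 `^ (2 * sigma - 1) * 2 ^+ n.+1).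
  by rewrite !mulr_gt0 ?exprn_gt0 ?powR_gt0// sqrtr_gt0 pi_gt0.
exists (K + n.+1)%N => k u x k0 u0.
set s := Num.sqrt k; have s0 : 0 < s by rewrite sqrtr_gt0.
have kE : k = s ^+ 2 by rewrite sqr_sqrtr// ltW.
set U := `|u|; have U0 : 0 < U by rewrite normr_gt0.
have uE : u ^+ 2 = U ^+ 2 by rewrite -normrX ger0_norm// sqr_ge0.
pose w := 2 * s * U; have w0 : 0 < w by rewrite !mulr_gt0.
have aE : (4 * k * u ^+ 2)^-1 = w^-1 ^+ 2.
  by rewrite kE uE /w; field; rewrite !gt_eqF.
have a0 : 0 < (4 * k * u ^+ 2)^-1 by rewrite aE exprn_gt0// invr_gt0.
have [_] := HC _ x a0.
move: `|_| => I h.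
have qa : Num.sqrt (4 * k * u ^+ 2)^-1 = w^-1 by rewrite aE sqrtr_sqr gtr0_norm// invr_gt0.
set Y := dot_rV x x in h *; have Y0 : 0 <= Y by exact: dot_rV_ge0.
pose T := (Num.sqrt (1 + k * U ^+ 2 * Y))^-1.
have qb : Num.sqrt ((4 * k * u ^+ 2)^-1 + Y / 4) = w^-1 * T^-1.
  rewrite (_ : _ + _ = w^-1 ^+ 2 * (1 + k * U ^+ 2 * Y)); last first.
    by rewrite kE uE /w; field; rewrite !gt_eqF.
  rewrite sqrtrM ?sqr_ge0// sqrtr_sqr gtr0_norm ?invr_gt0// invrK//.
have wT : (w^-1 * T^-1)^-1 = w * T by rewrite invfM !invrK.
rewrite qa qb wT in h.
have T0 : 0 <= T by rewrite invr_ge0 sqrtr_ge0.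
have wp : w^-1 `^ (1 - 2 * sigma) = 2 `^ (2 * sigma - 1) * s `^ (2 * sigma - 1) * U `^ (2 * sigma - 1).
  rewrite -!powRM ?mulr_ge0 ?(ltW s0) ?(ltW U0)// -/w -powR_inv1 ?(ltW w0)// -powRrM.
  by congr powR; ring.
have sp : s `^ (2 * sigma) = s `^ (2 * sigma - 1) * s.
  rewrite -{3}(powRr1 (ltW s0)) -powRD; last by rewrite (gt_eqF s0) implybT.
  by congr powR; ring.
rewrite mixweightE// sqrtrM ?pi_ge0// sqrtrV ?(ltW k0)// -/s.
have W0 : 0 <= (Num.sqrt pi * s^-1) ^+ n by rewrite exprn_ge0// mulr_ge0 ?sqrtr_ge0// invr_ge0 ltW.
apply: (le_trans (ler_wpM2l W0 h)).
rewrite wp sp.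
have PE : profile k x = (Num.sqrt (1 + k * Y))^-1 ^+ n.+1 by [].
have UT : U ^+ n.+1 * T ^+ n.+1 <= (1 + U) ^+ n.+1 * profile k x.
  rewrite PE -!exprMn lerXn2r ?nnegrE ?mulr_ge0 ?addr_ge0 ?invr_ge0 ?sqrtr_ge0 ?(ltW U0)//.
  exact: shift_profile_le.
have UP : U `^ (2 * sigma - 1) <= (1 + U) ^+ K.
  have U1 : 0 <= 1 + U by rewrite addr_ge0// ltW.
  rewrite -powR_mulrn//; apply: (@le_trans _ _ ((1 + U) `^ (2 * sigma - 1))).
    by rewrite ge0_ler_powR ?nnegrE ?(ltW U0)// ?lerDr//; lra.
  by rewrite ler_powR// lerDl ltW.
have -> : (Num.sqrt pi * s^-1) ^+ n *
    (C * (2 `^ (2 * sigma - 1) * s `^ (2 * sigma - 1) * U `^ (2 * sigma - 1)) * (w * T) ^+ n.+1) =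
    C * Num.sqrt pi ^+ n * 2 `^ (2 * sigma - 1) * 2 ^+ n.+1 * (s `^ (2 * sigma - 1) * s) *
     (U `^ (2 * sigma - 1) * (U ^+ n.+1 * T ^+ n.+1)).
  have sn : s^-1 ^+ n * s ^+ n.+1 = s by rewrite exprVn exprSr mulrA mulVf ?mul1r// expf_neq0// gt_eqF.
  rewrite -[X in _ = _ * (_ * X) * _]sn /w !exprMn.
  move: (2 `^ _) (s `^ _) (U `^ _) (T ^+ _) (U ^+ _) (2 ^+ _) (s ^+ _) (s^-1 ^+ _) (Num.sqrt pi ^+ n) => A1 A2 A3 A4 A5 A6 A7 A8 A9.
  by ring.
rewrite exprD -[leRHS]mulrA; apply: ler_wpM2l.
  by rewrite !mulr_ge0 ?exprn_ge0 ?powR_ge0 ?sqrtr_ge0 ?(ltW C0) ?(ltW s0).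
by rewrite -[leRHS]mulrA ler_pM ?powR_ge0 ?mulr_ge0 ?exprn_ge0 ?(ltW U0).
Qed.

Lemma profile_fourier (R : realType) n (k : R) (xi : 'rV[R]_n) : (0 < n)%N -> 0 < k ->
  [/\ lebesgue_measure.-integrable setT (EFin \o (fun u : R => expR (- u ^+ 2) * (mixweight n k u *
         expR (- ((4 * k * u ^+ 2)^-1 * dot_rV xi xi))))),
     subord R n * \int[lebesgue_rV n]_x (cos (dot_rV x xi) * profile k x) =
     \int[lebesgue_measure]_u (expR (- u ^+ 2) * (mixweight n k u *
         expR (- ((4 * k * u ^+ 2)^-1 * dot_rV xi xi)))),
     (lebesgue_rV n).-integrable setT (EFin \o (fun x => cos (dot_rV x xi) * profile k x)) &
     \int[lebesgue_rV n]_x (sin (dot_rV x xi) * profile k x) = 0].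
Proof.
move=> n0 k0; split.
- have i : lebesgue_measure.-integrable setT
      (EFin \o (fun u : R => Num.sqrt (pi / k) ^+ n * ((1 + `|u|) ^+ 0 * expR (- u ^+ 2)))).
    exact: (integrableZl measurableT (Num.sqrt (pi / k) ^+ n) (integrable_pow1_gauss R 0)).
  apply: (integrable_domR _ _ i) => [|u]; first by rewrite /mixweight; solve_measurable.
  have /andP[w0 w1] := mixweight_le u n0 k0.
  rewrite expr0 mul1r [leRHS]mulrC normrM (ger0_norm (expR_ge0 _)) ler_wpM2l ?expR_ge0//.
  rewrite normrM (ger0_norm (expR_ge0 _)) (ger0_norm w0) -[leRHS]mulr1 ler_pM ?expR_ge0//.
  rewrite -expR0 ler_expR oppr_le0 mulr_ge0 ?dot_rV_ge0// invr_ge0 mulr_ge0 ?sqr_ge0//.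
  by rewrite mulr_ge0// ltW.
- have c1 (r : R) : `|cos r| <= 1 by rewrite ler_norml cos_geN1 cos_le1.
  have [_ ->] := profile_fubini xi n0 k0 (cos_measurable (@measurable_id _ R setT)) c1.
  apply: eq_RintegralT => u; have [->|u0] := eqVneq u 0.
    by rewrite /mixweight normr0 expr0n eqn0Ngt n0 !mul0r mulr0.
  have ku : 0 < k * u ^+ 2 by rewrite mulr_gt0// exprn_even_gt0.
  have [_ _ -> _] := gauss_fourier xi ku.
  rewrite mulrA [_ * expR (- u ^+ 2)]mulrC /mixweight -!mulrA; congr (_ * (_ * (_ * expR (- _)))).
  by rewrite mulrC.
- have c1 (r : R) : `|cos r| <= 1 by rewrite ler_norml cos_geN1 cos_le1.
  by have [] := profile_fubini xi n0 k0 (cos_measurable (@measurable_id _ R setT)) c1.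
- have c1 (r : R) : `|sin r| <= 1 by rewrite ler_norml sin_geN1 sin_le1.
  have [_ E] := profile_fubini xi n0 k0 (sin_measurable (@measurable_id _ R setT)) c1.
  have sn0 : subord R n != 0 by rewrite gt_eqF// subord_gt0.
  apply: (mulfI sn0); rewrite mulr0 E; apply: Rintegral_eq0 => u.
  have [->|u0] := eqVneq u 0; first by rewrite normr0 expr0n eqn0Ngt n0 !mul0r.
  have ku : 0 < k * u ^+ 2 by rewrite mulr_gt0// exprn_even_gt0.
  by have [_ _ _ ->] := gauss_fourier xi ku; rewrite mulr0.
Qed.

(** The symbol is applied to each Gaussian of the mixture before integrating over u. Each slice is
    at most the profile times a polynomial in |u|, and exp(-u^2) makes that polynomial
    integrable. *)
Lemma profile_riesz (R : realType) (n : nat) (sigma : R) :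
  (0 < n)%N -> 1 <= sigma ->
  exists2 C : R, 0 < C & forall (k : R) (x : 'rV[R]_n), 0 < k ->
    let A xi := \int[lebesgue_rV n]_x (cos (dot_rV x xi) * profile k x) in
    (lebesgue_rV n).-integrable setT
      (EFin \o (fun xi => cos (dot_rV x xi) * (euclid_norm xi `^ (2 * sigma) * A xi))) /\
    `|\int[lebesgue_rV n]_xi (cos (dot_rV x xi) * (euclid_norm xi `^ (2 * sigma) * A xi))| <=
     C * Num.sqrt k `^ (2 * sigma) * profile k x.
Proof.
move=> n0 s1; have [C C0 [N HC]] := riesz_mix n s1; have [C' C'0 HC'] := riesz_heat n s1.
pose M := \int[lebesgue_measure]_u ((1 + `|u : R|) ^+ N * expR (- u ^+ 2)).
have s0 := subord_gt0 R n.
have M0 : 0 <= M by apply: Rintegral_ge0 => u _; rewrite mulr_ge0 ?expR_ge0// exprn_ge0// addr_ge0.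
have M1 : 0 < M + 1 by rewrite ltr_wpDl.
exists ((subord R n)^-1 * C * (M + 1)).
  by rewrite mulr_gt0// mulr_gt0 ?invr_gt0.
move=> k x k0 A.
pose s := Num.sqrt k `^ (2 * sigma); have sg0 : 0 <= s by exact: powR_ge0.
pose e (u : R) (xi : 'rV[R]_n) := expR (- ((4 * k * u ^+ 2)^-1 * dot_rV xi xi)).
pose K (z : measurableTypeR R * 'rV[R]_n) : R := expR (- z.1 ^+ 2) * (mixweight n k z.1 *
    (euclid_norm z.2 `^ (2 * sigma) * (cos (dot_rV z.2 x) * e z.1 z.2))).
have mK : measurable_fun setT K by rewrite /K /mixweight /euclid_norm /e; solve_measurable.
pose g (y : 'rV[R]_n) (u : R) : R := C * s * profile k y * ((1 + `|u|) ^+ N * expR (- u ^+ 2)).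
have ig y : lebesgue_measure.-integrable setT (EFin \o g y).
  exact: (integrableZl measurableT (C * s * profile k y) (integrable_pow1_gauss R N)).
have w00 : mixweight n k 0 = 0 by rewrite /mixweight normr0 expr0n eqn0Ngt n0 mul0r.
have w0 u : 0 <= mixweight n k u by have /andP[] := mixweight_le u n0 k0.
have K0 xi : K (0, xi) = 0 by rewrite /K/= w00 mul0r mulr0.
have a0 (u : R) : u != 0 -> 0 < (4 * k * u ^+ 2)^-1.
  by move=> u0; rewrite invr_gt0 mulr_gt0 ?exprn_even_gt0// mulr_gt0.
have bnd y (u : R) : expR (- u ^+ 2) * (mixweight n k u * `|\int[lebesgue_rV n]_xi
      (euclid_norm xi `^ (2 * sigma) * (cos (dot_rV xi y) * e u xi))|) <= g y u.
  have [->|u0] := eqVneq u 0.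
    rewrite w00 mul0r mulr0; apply: mulr_ge0; last first.
      by rewrite mulr_ge0 ?expR_ge0// exprn_ge0// addr_ge0.
    exact: mulr_ge0 (mulr_ge0 (ltW C0) sg0) (ltW (profile_gt0 _ k0)).
  rewrite /g mulrA [leRHS]mulrA [leRHS]mulrC -mulrA; apply: ler_wpM2l; first exact: expR_ge0.
  by rewrite [leRHS]mulrAC; exact: HC.
have sec (u : R) : \int[lebesgue_rV n]_xi K (u, xi) = expR (- u ^+ 2) * (mixweight n k u *
      \int[lebesgue_rV n]_xi (euclid_norm xi `^ (2 * sigma) * (cos (dot_rV xi x) * e u xi))).
  have [->|u0] := eqVneq u 0; first by rewrite (Rintegral_eq0 _ K0) w00 mul0r mulr0.
  have [i _] := HC' _ x (a0 _ u0).
  by rewrite -!RintegralZl//; exact: (integrableZl measurableT (mixweight n k u) i).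
(* As for one Gaussian, the nonnegative kernel at x = 0 dominates the kernel at x. *)
have dom u : (\int[lebesgue_rV n]_xi `|K (u, xi)|%:E <= (g 0 u)%:E)%E.
  have [->|u0] := eqVneq u 0.
    rewrite integral0_eq => [|xi _]; last by rewrite K0 normr0.
    by rewrite lee_fin; apply: le_trans (bnd 0 0); rewrite w00 mul0r mulr0.
  have [i _] := HC' _ 0 (a0 _ u0).
  have i1 := integrableZl measurableT (mixweight n k u) i.
  have i2 := integrableZl measurableT (expR (- u ^+ 2)) i1.
  apply: (@le_trans _ _ (\int[lebesgue_rV n]_xi (expR (- u ^+ 2) * (mixweight n k u *
     (euclid_norm xi `^ (2 * sigma) * (cos (dot_rV xi 0) * e u xi))))%:E)%E).
    apply: ge0_le_integral_nomeas => xi _; rewrite lee_fin//.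
    rewrite /K/= dot_rV0 cos0 mul1r normrM (ger0_norm (expR_ge0 _)) ler_wpM2l ?expR_ge0//.
    rewrite normrM (ger0_norm (w0 u)) ler_wpM2l// normrM (ger0_norm (powR_ge0 _ _)) ler_wpM2l ?powR_ge0//.
    rewrite normrM (ger0_norm (expR_ge0 _)) ler_piMl ?expR_ge0//.
    by rewrite ler_norml cos_geN1 cos_le1.
  rewrite Rintegral_EFin; last exact: i2.
  rewrite lee_fin; apply: le_trans (bnd 0 u).
  rewrite RintegralZl//.
  rewrite ler_wpM2l ?expR_ge0// RintegralZl//.
  by rewrite ler_wpM2l// ler_norm.
have KE (u : R) xi : K (u, xi) = euclid_norm xi `^ (2 * sigma) * cos (dot_rV xi x) *
    (expR (- u ^+ 2) * (mixweight n k u * e u xi)).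
  rewrite /K/=; move: (expR _) (mixweight _ _ _) (_ `^ _) (cos _) (e _ _) => A1 A2 A3 A4 A5.
  by ring.
have iu xi : lebesgue_measure.-integrable setT (EFin \o (fun u => K (u, xi))).
  have [i _ _ _] := profile_fourier xi n0 k0.
  have := integrableZl measurableT (euclid_norm xi `^ (2 * sigma) * cos (dot_rV xi x)) i.
  by congr (_.-integrable _ _); apply/funext => u; rewrite /= -EFinM KE.
have Ey xi : \int[lebesgue_measure]_u K (u, xi) =
    subord R n * (cos (dot_rV x xi) * (euclid_norm xi `^ (2 * sigma) * A xi)).
  have [i E _ _] := profile_fourier xi n0 k0.
  transitivity (\int[lebesgue_measure]_u (euclid_norm xi `^ (2 * sigma) * cos (dot_rV xi x) *
      (expR (- u ^+ 2) * (mixweight n k u * e u xi)))).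
    by apply: eq_RintegralT => u; exact: KE.
  rewrite RintegralZl//.
  rewrite -E -/(A xi) (dot_rVC x).
  move: (A xi) (subord _ _) (_ `^ _) (cos _) => A1 A2 A3 A4.
  by ring.
have [E i1 i2] := Rfubini mK dom (ig 0) iu.
have i3 : (lebesgue_rV n).-integrable setT
      (EFin \o (fun xi => cos (dot_rV x xi) * (euclid_norm xi `^ (2 * sigma) * A xi))).
  have := integrableZl measurableT (subord R n)^-1 i2.
  congr (_.-integrable _ _); apply/funext => xi; rewrite /= Ey -EFinM mulKf//.
  by rewrite gt_eqF.
split; first exact: i3.
have -> : \int[lebesgue_rV n]_xi (cos (dot_rV x xi) * (euclid_norm xi `^ (2 * sigma) * A xi)) =
    (subord R n)^-1 * \int[lebesgue_measure]_u \int[lebesgue_rV n]_xi K (u, xi).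
  rewrite E (eq_RintegralT _ Ey) RintegralZl//.
  by rewrite mulKf// gt_eqF.
rewrite normrM (gtr0_norm (_ : 0 < (subord R n)^-1)) ?invr_gt0// -!mulrA.
rewrite ler_pM2l ?invr_gt0//.
apply: (le_trans (le_normr_Rintegral measurableT i1)).
apply: (@le_trans _ _ (\int[lebesgue_measure]_u g x u)).
  apply: le_Rintegral => //; first exact: (integrable_norm i1).
  move=> u _; apply: le_trans (bnd x u).
  by rewrite sec normrM (ger0_norm (expR_ge0 _)) normrM (ger0_norm (w0 u)).
rewrite RintegralZl//; last exact: integrable_pow1_gauss.
rewrite -/M -/s.
rewrite [leRHS](_ : _ = C * s * profile k x * (M + 1)); last by ring.
rewrite ler_wpM2l ?lerDl// mulr_ge0 ?(ltW (profile_gt0 _ _))//.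
by rewrite mulr_ge0// ltW.
Qed.

(** The constant c will be the value of the time factor at a fixed t, so homogeneity in c is what
    lets the operator pass through a tensor product. C does not depend on k. The profile is even,
    hence its Fourier transform is real and reduces to the cosine integral. *)
Lemma profile_fractional_laplacian (R : realType) (n : nat) (sigma : R) :
  (0 < n)%N -> 1 <= sigma ->
  exists2 C : R, 0 < C & forall k : R, 0 < k -> exists L : 'rV[R]_n -> R,
    (forall x, `|L x| <= C * Num.sqrt k `^ (2 * sigma) * profile k x) /\
    forall (c : R) x, fractional_laplacian sigma (fun y => c * profile k y) x = c * L x.
Proof.
move=> n0 s1; have [C C0 HC] := profile_riesz n0 s1.
pose P : R := ((2 * pi) ^+ n)^-1.
have P0 : 0 < P by rewrite invr_gt0 exprn_gt0// mulr_gt0// pi_gt0.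
exists (P * C); first by rewrite mulr_gt0.
move=> k k0; pose A (xi : 'rV[R]_n) := \int[lebesgue_rV n]_x (cos (dot_rV x xi) * profile k x).
exists (fun x => P * \int[lebesgue_rV n]_xi (cos (dot_rV x xi) * (euclid_norm xi `^ (2 * sigma) * A xi))).
split => [x|c x].
  have [_ h] := HC k x k0.
  by rewrite normrM (gtr0_norm P0) -!mulrA ler_pM2l// !mulrA.
have F xi : fourier (fun y => (c * profile k y)%:C%C) xi = (c * A xi)%:C%C.
  rewrite /fourier /integral_complex /expi.
  have [_ _ i E] := profile_fourier xi n0 k0.
  have e1 : \int[lebesgue_rV n]_y complex.Re ((cos (- dot_rV y xi) +i* sin (- dot_rV y xi)) * (c * profile k y)%:C)%C = c * A xi.
    transitivity (\int[lebesgue_rV n]_y (c * (cos (dot_rV y xi) * profile k y))); last first.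
      by rewrite RintegralZl//; exact: i.
    by apply: eq_RintegralT => y /=; rewrite cosN mulr0 subr0 mulrCA.
  have e2 : \int[lebesgue_rV n]_y complex.Im ((cos (- dot_rV y xi) +i* sin (- dot_rV y xi)) * (c * profile k y)%:C)%C = 0.
    have s1' (r : R) : `|sin r| <= 1 by rewrite ler_norml sin_geN1 sin_le1.
    have [j _] := profile_fubini xi n0 k0 (sin_measurable (@measurable_id _ R setT)) s1'.
    transitivity (\int[lebesgue_rV n]_y (- c * (sin (dot_rV y xi) * profile k y))); last first.
      by rewrite RintegralZl ?E ?mulr0//; exact: j.
    by apply: eq_RintegralT => y /=; rewrite sinN mulr0 add0r !mulNr mulrCA.
  by rewrite e1 e2.
have [i _] := HC k x k0.
have FE : (fun xi => (euclid_norm xi `^ (2 * sigma))%:C%C * fourier (fun y => (c * profile k y)%:C%C) xi) =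
    (fun xi => (c * (euclid_norm xi `^ (2 * sigma) * A xi))%:C%C).
  by apply/funext => xi; rewrite F -rmorphM/= mulrCA.
rewrite /fractional_laplacian /fourier_multiplier FE /inverse_fourier -/P /= mul0r subr0 mulrCA.
congr (_ * _); transitivity (\int[lebesgue_rV n]_xi (c * (cos (dot_rV x xi) *
    (euclid_norm xi `^ (2 * sigma) * A xi)))); last first.
  by rewrite RintegralZl//; exact: i.
by apply: eq_RintegralT => xi; rewrite mulr0 subr0 mulrCA.
Qed.

(** * The profile as a test function *)

Lemma is_derive_line (R : realType) n (f : 'rV[R]_n -> R) (x v : 'rV[R]_n) (d : R) :
  is_derive (0 : R) (1 : R) (fun h : R => f (h *: v + x)) d -> is_derive x v f d.
Proof.
move=> df; have fD : derivable f x v by apply/derivable1P; exact: ex_derive.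
apply: DeriveDef => //; rewrite -(@derive_val _ _ _ _ _ _ _ df) /derive.
set g1 := fun h => h^-1 *: _; set g2 := fun h => h^-1 *: _.
suff -> : g1 = g2 by [].
by apply/funext => h; rewrite /g1 /g2/= addr0 scale0r add0r [_%:A]mulr1.
Qed.

(** The algebra generated by s = (1 + k |x|^2)^(-1/2) and the products x_i s, all of them bounded.
    It is closed under partial derivatives, and every derivative of the profile is the profile times
    a member; this gives smoothness, boundedness and integrability for all orders at once. *)
Inductive profile_symbol (R : realType) n (k : R) : ('rV[R]_n -> R) -> Prop :=
| symbol_cst c : profile_symbol k (fun=> c)
| symbol_root : profile_symbol k (fun x => (Num.sqrt (1 + k * dot_rV x x))^-1)
| symbol_coord i : profile_symbol k (fun x => x ord0 i * (Num.sqrt (1 + k * dot_rV x x))^-1)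
| symbol_add f g : profile_symbol k f -> profile_symbol k g -> profile_symbol k (fun x => f x + g x)
| symbol_mul f g : profile_symbol k f -> profile_symbol k g -> profile_symbol k (fun x => f x * g x).

Lemma continuous_dotxx (R : realType) n : continuous (fun x : 'rV[R]_n => dot_rV x x).
Proof.
move=> x; rewrite /dot_rV.
apply: (@continuous_big _ _ +%R) => [|i _ y]; first exact: add_continuous.
have c : {for y, continuous (fun x : 'rV[R]_n => x ord0 i)} by exact: coord_continuous.
exact: (continuousM c c).
Qed.

Lemma continuous_root (R : realType) n (k : R) : 0 < k ->
  continuous (fun x : 'rV[R]_n => (Num.sqrt (1 + k * dot_rV x x))^-1).
Proof.
move=> k0 x.
have c1 : {for x, continuous (fun x : 'rV[R]_n => 1 + k * dot_rV x x)}.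
  have c := @cst_continuous 'rV[R]_n R k x.
  exact: (continuousD (@cst_continuous 'rV[R]_n R 1 x) (continuousM c (@continuous_dotxx _ _ x))).
have c2 := continuous_comp c1 (@sqrt_continuous R _).
by apply: (continuousV _ c2); rewrite gt_eqF//= profile_base_gt0.
Qed.

Lemma symbol_continuous (R : realType) n (k : R) (f : 'rV[R]_n -> R) : 0 < k ->
  profile_symbol k f -> continuous f.
Proof.
move=> k0; elim=> [c||i|g h _ cg _ ch|g h _ cg _ ch].
- exact: cst_continuous.
- exact: continuous_root.
- move=> x; have c : {for x, continuous (fun x : 'rV[R]_n => x ord0 i)} by exact: coord_continuous.
  have c2 := @continuous_root _ n k k0 x.
  have := continuousM c c2.
  exact.
- by move=> x; exact: (continuousD (cg x) (ch x)).
- by move=> x; exact: (continuousM (cg x) (ch x)).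
Qed.

Lemma symbol_measurable (R : realType) n (k : R) (f : 'rV[R]_n -> R) :
  profile_symbol k f -> measurable_fun setT f.
Proof.
elim=> [c||i|g h _ mg _ mh|g h _ mg _ mh]; try by solve_measurable.
by apply: measurable_funM; [exact: measurable_coord|solve_measurable].
Qed.

Lemma symbol_bounded (R : realType) n (k : R) (f : 'rV[R]_n -> R) : 0 < k ->
  profile_symbol k f -> exists2 C : R, 0 <= C & forall x, `|f x| <= C.
Proof.
move=> k0; elim=> [c||i|g h _ [C C0 Cg] _ [D D0 Dh]|g h _ [C C0 Cg] _ [D D0 Dh]].
- by exists `|c|.
- exists 1 => // x; have b0 := profile_base_gt0 x k0.
  rewrite ger0_norm ?invr_ge0 ?sqrtr_ge0// invf_le1//.
  by rewrite -{1}sqrtr1; apply: ler_wsqrtr; rewrite lerDl mulr_ge0 ?dot_rV_ge0// ltW.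
- exists (Num.sqrt k)^-1; first by rewrite invr_ge0 sqrtr_ge0.
  move=> x; have b0 := profile_base_gt0 x k0.
  rewrite normrM (ger0_norm (_ : 0 <= _^-1)) ?invr_ge0 ?sqrtr_ge0//.
  rewrite ler_pdivrMr// mulrC ler_pdivlMr ?sqrtr_gt0// -sqrtr_sqr -sqrtrM ?sqr_ge0//.
  apply: ler_wsqrtr; rewrite mulrC; apply: (@le_trans _ _ (k * dot_rV x x)); last by rewrite lerDr.
  rewrite ler_pM2l// /dot_rV (bigD1 i)//= -expr2 lerDl; apply: sumr_ge0 => j _.
  by rewrite -expr2 sqr_ge0.
- by exists (C + D) => [|x]; [exact: addr_ge0|rewrite (le_trans (ler_normD _ _))// lerD].
- by exists (C * D) => [|x]; [exact: mulr_ge0|rewrite normrM ler_pM].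
Qed.

Lemma dot_basis (R : realType) n (h : R) (i : 'I_n) (x : 'rV[R]_n) :
  dot_rV (h *: basis_rV i + x) (h *: basis_rV i + x) = dot_rV x x + 2 * h * x ord0 i + h ^+ 2.
Proof.
rewrite /dot_rV (bigD1 i)//= [in RHS](bigD1 i)//= !mxE !eqxx/=.
rewrite (eq_bigr (fun j => x ord0 j * x ord0 j)); last first.
  by move=> j ji; rewrite !mxE (negbTE ji) andbF mulr0 add0r.
by rewrite mulr1; ring.
Qed.

Lemma root_derive (R : realType) n (k : R) (i : 'I_n) (x : 'rV[R]_n) : 0 < k ->
  is_derive x (basis_rV i) (fun x => (Num.sqrt (1 + k * dot_rV x x))^-1)
   (- k * (x ord0 i * (Num.sqrt (1 + k * dot_rV x x))^-1) *
     ((Num.sqrt (1 + k * dot_rV x x))^-1 * (Num.sqrt (1 + k * dot_rV x x))^-1)).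
Proof.
move=> k0; apply: is_derive_line; have b0 := profile_base_gt0 x k0.
under eq_fun do rewrite dot_basis.
have E : dot_rV x x + 2 * 0 * x ord0 i + 0 ^+ 2 = dot_rV x x by rewrite expr0n/=; ring.
have p0 : 0 < 1 + k * (dot_rV x x + 2 * 0 * x ord0 i + 0 ^+ 2).
  by rewrite E -sqrtr_gt0.
pose g (h : R) := 1 + k * (dot_rV x x + 2 * h * x ord0 i + h ^+ 2).
have d1 : is_derive (0 : R) (1 : R) g (k * (2 * x ord0 i)) by solve_derive; ring.
have s0 : Num.sqrt (g 0) != 0 by rewrite gt_eqF// sqrtr_gt0.
have dd := inv_is_derive (f := fun h => Num.sqrt (g h)) s0 (sqrt_is_derive (f := g) p0 d1).
eapply is_derive_eq; [exact: dd|].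
rewrite /g E; set s := Num.sqrt _ in b0 *.
by field; rewrite gt_eqF.
Qed.

Lemma symbol_derive (R : realType) n (k : R) (i : 'I_n) (f : 'rV[R]_n -> R) : 0 < k ->
  profile_symbol k f -> exists2 g, profile_symbol k g &
    forall x, is_derive x (basis_rV i) f (g x).
Proof.
move=> k0; elim=> [c||j|g h Sg [g' Sg' dg] Sh [h' Sh' dh]|g h Sg [g' Sg' dg] Sh [h' Sh' dh]].
- by exists (fun=> 0); [exact: symbol_cst|move=> x; exact: is_derive_cst].
- eexists; last by move=> x; exact: root_derive.
  by repeat constructor.
- pose s (x : 'rV[R]_n) := (Num.sqrt (1 + k * dot_rV x x))^-1.
  (* Each coordinate is paired with its own factor s, which keeps the derivative inside the
     class. *)
  exists (fun x => (j == i)%:R * s x + (- k) * ((x ord0 j * s x) * ((x ord0 i * s x) * s x))).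
    by rewrite /s; repeat constructor.
  move=> x; have dc : is_derive x (basis_rV i) (fun y : 'rV[R]_n => y ord0 j) (j == i)%:R.
    apply: is_derive_line; under eq_fun do rewrite !mxE eqxx/=.
    by solve_derive; ring.
  have := is_deriveM dc (root_derive i x k0); rewrite -/(s x) => dd.
  apply: (@is_derive_eq _ _ _ _ _ _ _ _ dd); rewrite /GRing.scale/=; ring.
- exists (fun x => g' x + h' x); first by constructor.
  by move=> x; exact: is_deriveD.
- exists (fun x => g x * h' x + h x * g' x); first by repeat constructor.
  by move=> x; exact: is_deriveM.
Qed.

Lemma profile_derive (R : realType) n (k : R) (i : 'I_n) (f : 'rV[R]_n -> R) : 0 < k ->
  profile_symbol k f -> exists2 g, profile_symbol k g &
    forall x, is_derive x (basis_rV i) (fun x => f x * profile k x) (g x * profile k x).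
Proof.
move=> k0 Sf; have [f' Sf' df] := symbol_derive i k0 Sf.
pose s (x : 'rV[R]_n) := (Num.sqrt (1 + k * dot_rV x x))^-1.
exists (fun x => f' x + f x * (n.+1%:R * (- k * ((x ord0 i * s x) * s x)))).
  by rewrite /s; repeat constructor.
move=> x; have dr := root_derive i x k0; rewrite -/(s x) in dr.
have dp : is_derive x (basis_rV i) (fun x : 'rV[R]_n => profile k x)
    (n.+1%:R * s x ^+ n * (- k * (x ord0 i * s x) * (s x * s x))).
  have := is_deriveX n.+1 dr; rewrite (_ : _ ^+ n.+1 = fun x => profile k x); last first.
    by apply/funext => y; rewrite fctE.
  move=> dd; apply: (@is_derive_eq _ _ _ _ _ _ _ _ dd).
  by rewrite -mulr_natl /GRing.scale/= -/(s x).
have dd := is_deriveM (df x) dp.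
apply: (@is_derive_eq _ _ _ _ _ _ _ _ dd); rewrite /GRing.scale/= /profile -/(s x) exprS.
by move: (s x) => S; move: (S ^+ n) => Sn; ring.
Qed.

Lemma iter_partial_profile (R : realType) n (k : R) (s : seq 'I_n) : 0 < k ->
  exists2 f, profile_symbol k f & iter_partial s (@profile R n k) = (fun x => f x * profile k x).
Proof.
move=> k0; elim: s => [|i s [f Sf Ef]].
  exists (fun=> 1); first exact: symbol_cst.
  by apply/funext => x; rewrite mul1r.
have [g Sg dg] := profile_derive i k0 Sf.
exists g => //; rewrite /= -/(iter_partial s _) Ef.
by apply/funext => x; exact: derive_val.
Qed.

Lemma continuous_profile (R : realType) n (k : R) : 0 < k -> continuous (@profile R n k).
Proof.
move=> k0 x.
have c1 : {for x, continuous (fun x : 'rV[R]_n => (Num.sqrt (1 + k * dot_rV x x))^-1)}.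
  exact: continuous_root.
exact: (continuous_comp c1 (@exprn_continuous R n.+1 _)).
Qed.

Lemma measurable_profile (R : realType) n (k : R) : measurable_fun setT (@profile R n k).
Proof. by rewrite /profile; solve_measurable. Qed.

Lemma profile_le1 (R : realType) n (k : R) (x : 'rV[R]_n) : 0 < k -> profile k x <= 1.
Proof.
move=> k0; have b0 := profile_base_gt0 x k0.
rewrite exprn_ile1 ?invr_ge0 ?sqrtr_ge0// invf_le1//.
by rewrite -{1}sqrtr1; apply: ler_wsqrtr; rewrite lerDl mulr_ge0 ?dot_rV_ge0// ltW.
Qed.

Lemma profile_antitone (R : realType) n (k l : R) (x : 'rV[R]_n) : 0 < k -> k <= l ->
  profile l x <= profile k x.
Proof.
move=> k0 kl; have l0 := lt_le_trans k0 kl.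
rewrite lerXn2r ?nnegrE ?invr_ge0 ?sqrtr_ge0// lef_pV2 ?posrE ?profile_base_gt0//.
by apply: ler_wsqrtr; rewrite lerD2l ler_wpM2r// dot_rV_ge0.
Qed.

Lemma integrable_profile (R : realType) n (k : R) : (0 < n)%N -> 0 < k ->
  (lebesgue_rV n).-integrable setT (EFin \o (@profile R n k)).
Proof.
move=> n0 k0; have [_ _ i _] := profile_fourier 0 n0 k0.
move: i; congr (_.-integrable _ _); apply/funext => x /=.
by rewrite dot_rV0 cos0 mul1r.
Qed.

(** The transform formula at xi = 0, where the mixture weight is at most (pi / k)^(n/2). *)
Lemma integral_profile (R : realType) n : (0 < n)%N -> exists2 C : R, 0 < C & forall k : R, 0 < k ->
  \int[lebesgue_rV n]_x profile k x <= C * (Num.sqrt k)^-1 ^+ n.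
Proof.
move=> n0; have s0 := subord_gt0 R n.
exists ((subord R n)^-1 * Num.sqrt pi ^+ n * Num.sqrt pi).
  by rewrite !mulr_gt0 ?invr_gt0 ?exprn_gt0// sqrtr_gt0 pi_gt0.
move=> k k0; have [i E _ _] := profile_fourier (0 : 'rV[R]_n) n0 k0.
have -> : \int[lebesgue_rV n]_x profile k x =
    (subord R n)^-1 * (subord R n * \int[lebesgue_rV n]_x (cos (dot_rV x 0) * profile k x)).
  rewrite mulKf ?gt_eqF//; apply: eq_RintegralT => x.
  by rewrite dot_rV0 cos0 mul1r.
rewrite E -!mulrA ler_pM2l ?invr_gt0//.
have g1 : (fun u : R => `|u| ^+ 0 * expR (- (1 * u ^+ 2))) = (fun u => expR (- u ^+ 2)).
  by apply/funext => u; rewrite expr0 !mul1r.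
have ig : lebesgue_measure.-integrable setT (EFin \o (fun u : R => expR (- u ^+ 2))).
  by have := integrable_gauss 0 (@ltr01 R); rewrite g1.
have ig2 : lebesgue_measure.-integrable setT
    (EFin \o (fun u : R => Num.sqrt (pi / k) ^+ n * expR (- u ^+ 2))).
  exact: (integrableZl measurableT (Num.sqrt (pi / k) ^+ n) ig).
apply: (@le_trans _ _ (\int[lebesgue_measure]_u (Num.sqrt (pi / k) ^+ n * expR (- u ^+ 2)))).
  apply: le_Rintegral => // u _; rewrite mulrC ler_wpM2r ?expR_ge0//.
  have /andP[w0 w1] := mixweight_le u n0 k0.
  rewrite dot_rV0 mulr0 oppr0 expR0 mulr1//.
rewrite RintegralZl// /Rintegral.
under eq_integral do rewrite -[X in expR (- X)]mul1r.
rewrite integral_gauss//= divr1 sqrtrM ?pi_ge0// sqrtrV ?(ltW k0)// exprMn.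
by rewrite mulrAC mulrA.
Qed.

Lemma space_test_profile (R : realType) n (k : R) : (0 < n)%N -> 0 < k ->
  space_test_function (@profile R n k).
Proof.
move=> n0 k0; split => s; have [f Sf ->] := iter_partial_profile s k0.
  split=> [x|i x].
    have c1 : {for x, continuous f} by exact: symbol_continuous Sf _.
    have c2 : {for x, continuous (@profile R n k)} by exact: continuous_profile.
    exact: (continuousM c1 c2).
  by have [g _ dg] := profile_derive i k0 Sf; exact: ex_derive.
have [C C0 fC] := symbol_bounded k0 Sf.
have mf : measurable_fun setT (fun x => f x * profile k x).
  by apply: measurable_funM; [exact: symbol_measurable Sf|exact: measurable_profile].
split.
  apply/Lfun1_integrable.
  apply: (integrable_dom mf (g := fun x => C * profile k x)).
    by move=> x; rewrite normrM (gtr0_norm (profile_gt0 x k0)) ler_wpM2r// ltW// profile_gt0.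
  exact: (integrableZl measurableT C (integrable_profile n0 k0)).
rewrite inE; apply/andP; split; rewrite inE/=; first exact: mf.
rewrite /finite_norm unlock /Lnorm; case: ifPn => // _.
apply: (@le_lt_trans _ _ C%:E); last exact: ltry.
apply/ess_supP; apply: nearW => x; rewrite /= lee_fin normrM.
rewrite -[leRHS]mulr1 ler_pM// ger0_norm ?profile_le1// ltW// profile_gt0//.
Qed.

(** Dominated convergence is about sequences: a failure for arbitrarily small k yields a sequence of
    parameters tending to 0, along which the profiles tend to 1 pointwise and stay below 1. This
    keeps the initial data terms away from 0 for large T. *)
Lemma cvg_integral_profile (R : realType) n (f : 'rV[R]_n -> R) (c : R) :
  (lebesgue_rV n).-integrable setT (EFin \o f) -> c < \int[lebesgue_rV n]_x f x ->
  exists2 l : R, 0 < l & forall k, 0 < k -> k <= l ->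
    c < \int[lebesgue_rV n]_x (f x * profile k x).
Proof.
move=> fi cf; apply: contrapT => H.
have {}H (j : nat) : exists k : R, 0 < k <= j.+1%:R^-1 /\
    \int[lebesgue_rV n]_x (f x * profile k x) <= c.
  apply: contrapT => Hj; apply: H; exists j.+1%:R^-1; first by rewrite invr_gt0.
  move=> k k0 kj; rewrite ltNge; apply/negP => fc; apply: Hj; exists k.
  by rewrite k0 kj.
have [ks Hk] := choice H.
have k0 j : 0 < ks j by have [/andP[]] := Hk j.
have kcvg : ks j @[j --> \oo] --> (0 : R).
  apply: (@squeeze_cvgr _ _ _ _ (fun=> 0) (fun j => j.+1%:R^-1)).
  - by apply: nearW => j; have [/andP[/ltW -> ->]] := Hk j.
  - exact: cvg_cst.
  - exact: cvg_harmonic.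
have pcvg (x : 'rV[R]_n) : profile (ks j) x @[j --> \oo] --> (1 : R).
  pose h (k : R) := (Num.sqrt (1 + k * dot_rV x x))^-1 ^+ n.+1.
  have [a dh] : exists a, is_derive (0 : R) (1 : R) h a.
    pose g (k : R) := 1 + k * dot_rV x x.
    have d1 : is_derive (0 : R) (1 : R) g (dot_rV x x) by solve_derive; ring.
    have g0 : 0 < g 0 by rewrite /g mul0r addr0.
    have s0 : Num.sqrt (g 0) != 0 by rewrite gt_eqF// sqrtr_gt0.
    have d2 := inv_is_derive (f := fun h => Num.sqrt (g h)) s0 (sqrt_is_derive (f := g) g0 d1).
    by eexists; exact: (expn_is_derive n.+1 d2).
  have h0 : h 0 = 1 by rewrite /h mul0r addr0 sqrtr1 invr1 expr1n.
  have hc : h y @[y --> (0 : R)] --> (1 : R).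
    by rewrite -[X in _ --> X]h0; exact: (is_derive_continuous dh).
  exact: (cvg_comp _ _ kcvg hc).
have mf : measurable_fun setT f by case/integrableP : fi => /measurable_EFinP.
have pj1 j (x : 'rV[R]_n) : `|profile (ks j) x| <= 1.
  by rewrite ger0_norm ?profile_le1// ltW// profile_gt0.
have fpi j : (lebesgue_rV n).-integrable setT (EFin \o (fun x => f x * profile (ks j) x)).
  apply: (integrable_dom (g := fun x => `|f x|)).
  - by apply: measurable_funM => //; exact: measurable_profile.
  - by move=> x; rewrite normrM ler_piMr.
  - exact: (integrable_norm fi).
have dc : (\int[lebesgue_rV n]_x (f x * profile (ks j) x)%:E)%E @[j --> \oo] -->
    (\int[lebesgue_rV n]_x (f x)%:E)%E.
  apply: (@dominated_cvg _ _ _ (lebesgue_rV n) setT measurableT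
    (fun j x => (f x * profile (ks j) x)%:E) (EFin \o f) (fun x => (`|f x|)%:E)).
  - by move=> j; exact: measurable_int (fpi j).
  - move=> x _; apply: cvg_EFin; first exact: nearW.
    rewrite -[X in _ --> X]mulr1; apply: cvgM; first exact: cvg_cst.
    exact: pcvg.
  - by [].
  - exact: (integrable_norm fi).
  - by move=> j x _; rewrite /= lee_fin normrM ler_piMr.
have : (\int[lebesgue_rV n]_x (f x)%:E <= c%:E)%E.
  apply: (cvge_le _ dc); apply: nearW => j.
  by rewrite Rintegral_EFin// lee_fin; have [] := Hk j.
by rewrite Rintegral_EFin// lee_fin leNgt cf.
Qed.

(** * The time cutoff *)

(** Meant for the gluing point of the cutoff, where neither of its two formulas holds on a
    neighbourhood. *)
Lemma is_derive_quadratic (R : realType) (f : R -> R) (x C : R) :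
  (forall y, `|f y| <= C * (y - x) ^+ 2) -> is_derive x (1 : R) f 0.
Proof.
move=> fC; have fx : f x = 0.
  by apply/eqP; rewrite -normr_le0 (le_trans (fC x))// subrr expr0n mulr0.
have cv : (fun h : R => h^-1 *: ((f \o shift x) h%:A - f x)) h @[h --> 0^'] --> (0 : R).
  apply/cvgrPdist_le => /= e e0.
  have C0 : 0 <= C by have := fC (x + 1); rewrite addrAC subrr add0r expr1n mulr1; exact: le_trans.
  near=> h.
  have h0 : h != 0 by near: h; exact: nbhs_dnbhs_neq.
  have he : `|h| <= e / (C + 1).
    by near: h; apply: dnbhs0_le; rewrite divr_gt0// ltr_wpDl.
  rewrite sub0r normrN fx subr0 [_%:A]mulr1 normrZ normfV ler_pdivrMl ?normr_gt0//.
  rewrite (le_trans (fC _))// addrK -real_normK ?num_real// expr2 mulrA mulrC ler_wpM2l//.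
  rewrite (le_trans (ler_wpM2l C0 he))// mulrA ler_pdivrMr ?ltr_wpDl// mulrC.
  by rewrite ler_pM2l// lerDl.
by apply: DeriveDef; [exact: cvgP cv|exact: cvg_lim cv].
Unshelve. all: by end_near. Qed.

(** The polynomial Q, evaluated at X = 1 / (1 - t/T), makes the family closed under differentiation,
    so a single first-order computation gives smoothness of every order. The test function itself is
    Q = 1. *)
Definition cutoff (R : realType) (Q : {poly R}) (T t : R) : R :=
  if t < T then Q.[(1 - t / T)^-1] * expR (- (1 - t / T)^-1) else 0.

(** From X' = X^2 / T, the derivative of Q(X) exp(-X) is T^(-1) (Q' - Q)(X) X^2 exp(-X). *)
Definition cutoff_deriv (R : realType) (T : R) (Q : {poly R}) : {poly R} :=
  T^-1 *: ((Q^`() - Q) * 'X^2).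

Lemma cutoff_base_gt0 (R : realType) (T t : R) : 0 < T -> t < T -> 0 < 1 - t / T.
Proof. by move=> T0 tT; rewrite subr_gt0 ltr_pdivrMr// mul1r. Qed.

Lemma derive_cutoff (R : realType) (Q : {poly R}) (T t : R) : 0 < T ->
  is_derive t (1 : R) (cutoff Q T) (cutoff (cutoff_deriv T Q) T t).
Proof.
move=> T0; have [tT|tT|->] := ltgtP t T.
- have -> : cutoff (cutoff_deriv T Q) T t =
      (cutoff_deriv T Q).[(1 - t / T)^-1] * expR (- (1 - t / T)^-1) by rewrite /cutoff tT.
  have s0 := cutoff_base_gt0 T0 tT.
  pose X (t : R) := (1 - t / T)^-1.
  have dX : is_derive t (1 : R) X (T^-1 * X t ^+ 2).
    pose s (t : R) := 1 - t / T.
    have ds : is_derive t (1 : R) s (- T^-1) by solve_derive; ring.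
    have s1 : s t != 0 by rewrite gt_eqF.
    have dd := inv_is_derive s1 ds; eapply is_derive_eq; first exact: dd.
    by rewrite mulrNN mulrC /X exprVn.
  have dd := mul_is_derive (horner_is_derive Q dX) (expR_is_derive (opp_is_derive dX)).
  apply: (near_eq_is_derive (f := fun t => Q.[X t] * expR (- X t))); last first.
  + eapply is_derive_eq; first exact: dd.
    rewrite /cutoff_deriv hornerZ hornerM hornerD hornerN hornerXn -/(X t).
    by ring.
  + near=> y; rewrite /cutoff ifT//; near: y; exact: lt_nbhsl.
- have -> : cutoff (cutoff_deriv T Q) T t = 0 by rewrite /cutoff ltNge ltW.
  have d0 := cst_is_derive t (0 : R).
  apply: (near_eq_is_derive _ d0).
  by near=> y; rewrite /cutoff ifF//; apply/negbTE; rewrite -leNgt ltW//; near: y; exact: lt_nbhsr.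
- have -> : cutoff (cutoff_deriv T Q) T T = 0 by rewrite /cutoff ltxx.
  (* Since Q(X) X^2 exp(-X) is bounded for X >= 0, the cutoff at y < T is at most C X^(-2) = C (1 -
     y/T)^2, which is quadratic in y - T. *)
  have [C C0 HC] : exists2 C : R, 0 <= C & forall x, 0 <= x -> `|(Q * 'X^2).[x]| * expR (- x) <= C.
    have [C C0 HC] := poly_exp_bound (Q * 'X^2) 0.
    by exists C => [|x x0]; [exact: ltW|have := HC x x0; rewrite expr0 mulr1].
  apply: (@is_derive_quadratic _ _ _ (C / T ^+ 2)) => y; rewrite /cutoff; case: ifPn => yT; last first.
    by rewrite normr0 mulr_ge0 ?sqr_ge0// divr_ge0 ?sqr_ge0.
  have s0 := cutoff_base_gt0 T0 yT; set s := 1 - y / T in s0 *.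
  have -> : C / T ^+ 2 * (y - T) ^+ 2 = C * s ^+ 2 by rewrite /s; field; rewrite gt_eqF.
  have := HC s^-1; rewrite invr_ge0 (ltW s0) => /(_ isT).
  rewrite hornerM hornerXn !normrM (ger0_norm (expR_ge0 _)) mulrAC.
  rewrite (gtr0_norm (_ : 0 < s^-1)) ?invr_gt0// -invfM ler_pdivrMr ?mulr_gt0//.
Unshelve. all: by end_near. Qed.

Lemma derive1n_cutoff (R : realType) (Q : {poly R}) (T : R) k : 0 < T ->
  derive1n k (cutoff Q T) = cutoff (iter k (cutoff_deriv T) Q) T.
Proof.
move=> T0; elim: k => [//|k IH]; rewrite derive1nS IH; apply/funext => t.
by rewrite derive1E; apply: derive_val; exact: derive_cutoff.
Qed.

Lemma time_test_cutoff (R : realType) (Q : {poly R}) (T : R) : 0 < T ->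
  time_test_function +oo%E (cutoff Q T).
Proof.
move=> T0; split.
  move=> k t; rewrite derive1n_cutoff//.
  exact: (@ex_derive _ _ _ _ _ _ _ (derive_cutoff (iter k (cutoff_deriv T) Q) t T0)).
by exists T; [exact: ltry|move=> t tT; rewrite /cutoff ltNge tT].
Qed.

Lemma pow_exp_le (R : realType) (k : nat) (c x : R) : 0 < c -> 0 <= x ->
  x ^+ k <= c^-1 ^+ k * k`!%:R * expR (c * x).
Proof.
move=> c0 x0; have := expR_ge_pow k (mulr_ge0 (ltW c0) x0).
rewrite exprMn => h; rewrite -mulrA exprVn ler_pdivlMl// exprn_gt0//.
Qed.

(** In exp(-X) = exp(-(1 - 1/r) X) exp(-X/r) the first factor absorbs any power of X, at the cost of
    a constant K_k for X^k. The derivatives bring X^2 / T and (X^4 - 2 X^3) / T^2, whence the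
    constants K_2, K_4 and 2 K_3. *)
Lemma cutoff_bounds (R : realType) (r : R) : 1 < r -> exists2 C : R, 1 <= C & forall T t : R, 0 < T ->
  [/\ 0 <= cutoff 1 T t,
      cutoff 1 T t <= cutoff 1 T t `^ r^-1,
      `|cutoff (cutoff_deriv T 1) T t| <= C * T^-1 * cutoff 1 T t `^ r^-1 &
      `|cutoff (cutoff_deriv T (cutoff_deriv T 1)) T t| <= C * T^-1 ^+ 2 * cutoff 1 T t `^ r^-1].
Proof.
move=> r1; have r0 : 0 < r by exact: lt_trans r1.
pose c := 1 - r^-1; have c0 : 0 < c by rewrite subr_gt0 invf_lt1.
pose K k : R := c^-1 ^+ k * k`!%:R.
have K0 k : 0 <= K k by rewrite mulr_ge0// exprn_ge0// invr_ge0 ltW.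
exists (1 + K 2 + K 4 + 2 * K 3).
  by rewrite -!addrA lerDl !addr_ge0// mulr_ge0.
move=> T t T0; have rn : r != 0 by rewrite gt_eqF.
rewrite /cutoff; case: ifPn => tT; last first.
  by rewrite !normr0 powR0 ?invr_eq0// !mulr0 lexx.
have s0 := cutoff_base_gt0 T0 tT; set X := (1 - t / T)^-1.
have X0 : 0 <= X by rewrite invr_ge0 ltW.
have KX k : X ^+ k * expR (- X) <= K k * expR (- X * r^-1).
  have -> : expR (- X) = expR (- (c * X)) * expR (- X * r^-1).
    by rewrite -expRD; congr expR; rewrite /c; ring.
  rewrite mulrA ler_wpM2r ?expR_ge0// expRN ler_pdivrMr ?expR_gt0//.
  exact: pow_exp_le.
have P : (1%R : {poly R}).[X] * expR (- X) = expR (- X) by rewrite hornerC mul1r.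
rewrite P -expRM; split.
- exact: expR_ge0.
- by rewrite ler_expR mulNr lerN2 ler_piMr// invf_le1// ltW.
- rewrite /cutoff_deriv derivC sub0r hornerZ mulN1r hornerN hornerXn mulrN mulNr normrN.
  rewrite ger0_norm; last by rewrite mulr_ge0 ?expR_ge0// mulr_ge0 ?exprn_ge0// invr_ge0 ltW.
  rewrite -mulrA [leRHS]mulrAC [leRHS]mulrC; apply: ler_wpM2l; first by rewrite invr_ge0 ltW.
  apply: le_trans (KX 2) _; apply: ler_wpM2r; first exact: expR_ge0.
  have := K0 3; have := K0 4; lra.
- have -> : (cutoff_deriv T (cutoff_deriv T 1)).[X] = T^-1 ^+ 2 * (X ^+ 4 - 2 * X ^+ 3).
    have -> : cutoff_deriv T 1 = - (T^-1 *: 'X^2).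
      by rewrite /cutoff_deriv derivC sub0r mulN1r scalerN.
    rewrite /cutoff_deriv derivN derivZ derivXn hornerZ hornerM hornerXn hornerD !hornerN.
    rewrite !hornerZ hornerMn !hornerXn -mulr_natl.
    by ring.
  have Ti : 0 <= T^-1 ^+ 2 by rewrite exprn_ge0// invr_ge0 ltW.
  move: (T^-1 ^+ 2) Ti => W Ti.
  rewrite normrM (ger0_norm (expR_ge0 _)) normrM (ger0_norm Ti) -[leLHS]mulrA [leRHS]mulrAC [leRHS]mulrC; apply: ler_wpM2l.
    by [].
  apply: (@le_trans _ _ (X ^+ 4 * expR (- X) + 2 * (X ^+ 3 * expR (- X)))).
    rewrite mulrA -mulrDl; apply: ler_wpM2r; first exact: expR_ge0.
    rewrite (le_trans (ler_normB _ _))// ger0_norm ?exprn_ge0// ger0_norm//.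
    by rewrite mulr_ge0// exprn_ge0.
  have h4 := KX 4; have h3 := KX 3.
  apply: (@le_trans _ _ ((K 4 + 2 * K 3) * expR (- X / r))); first lra.
  apply: ler_wpM2r; first exact: expR_ge0.
  have := K0 2; lra.
Qed.

(** * Scaled estimates *)

(** Young's inequality for d^(1/r) a and d^(-1/r) M with conjugate exponents r and s: the factors
    1/r and 1/s are dropped, and -s/r = 1 - s. *)
Lemma young_scaled (R : realType) (a M d r : R) : 0 <= a -> 0 <= M -> 0 < d -> 1 < r ->
  a * M <= d * a `^ r + d `^ (1 - (1 - r^-1)^-1) * M `^ (1 - r^-1)^-1.
Proof.
move=> a0 M0 d0 r1; have r0 : 0 < r by exact: lt_trans r1.
set s := (1 - r^-1)^-1; have rV1 : r^-1 < 1 by rewrite invf_lt1.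
have s0 : 0 < s by rewrite invr_gt0 subr_gt0.
have s1 : 1 <= s by rewrite invf_ge1 ?subr_gt0// gerBl invr_ge0 ltW.
have rs : r^-1 + s^-1 = 1 by rewrite /s invrK addrC subrK.
have h := @conjugate_powR _ (d `^ r^-1 * a) (d `^ (- r^-1) * M) r s
  (mulr_ge0 (powR_ge0 _ _) a0) (mulr_ge0 (powR_ge0 _ _) M0) r0 s0 rs.
rewrite mulrACA -powRD ?(gt_eqF d0) ?implybT// subrr powRr0 mul1r in h.
apply: (le_trans h); apply: lerD.
  rewrite powRM ?powR_ge0// -powRrM mulVf ?gt_eqF// powRr1 ?(ltW d0)//.
  by rewrite ler_pdivrMr// ler_peMr ?(ltW r1)// mulr_ge0 ?powR_ge0// ltW.
rewrite powRM ?powR_ge0// -powRrM.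
have -> : - r^-1 * s = 1 - s.
  have sE : s * (1 - r^-1) = 1 by rewrite mulVf// gt_eqF// subr_gt0.
  by rewrite -[X in X - s]sE; ring.
by rewrite ler_pdivrMr// ler_peMr// mulr_ge0 ?powR_ge0.
Qed.

(** Young's inequality is applied to |w| eta^(1/r) against M, so that the r-th power restores the
    time weight eta. The space weight multiplies both sides and is never raised to a power, which is
    why the image of the profile has to be dominated by the profile itself. The remainder lives on
    [0, T], whence the factor T. *)
Lemma young_estimate (R : realType) n (w Psi : R -> 'rV[R]_n -> R) (T k M d r B : R) :
  0 < T -> 0 < k -> 0 <= M -> 0 < d -> 1 < r -> (0 < n)%N ->
  \int[lebesgue_rV n]_x profile k x <= B ->
  (forall t x, `|Psi t x| <= M * cutoff 1 T t `^ r^-1 * profile k x) ->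
  (\int[lebesgue_measure]_(t in time_interval +oo%E) \int[lebesgue_rV n]_x (w t x * Psi t x)%:E <=
   d%:E * \int[lebesgue_measure]_(t in time_interval +oo%E) \int[lebesgue_rV n]_x
       (`|w t x| `^ r * (cutoff 1 T t * profile k x))%:E +
   (d `^ (1 - (1 - r^-1)^-1) * M `^ (1 - r^-1)^-1 * B * T)%:E)%E.
Proof.
move=> T0 k0 M0 d0 r1 n0 HB HPsi; have r0 : 0 < r by exact: lt_trans r1.
set K := d `^ _ * M `^ _; have K0 : 0 <= K by rewrite mulr_ge0 ?powR_ge0.
have eta0 t : 0 <= cutoff 1 T t.
  by rewrite /cutoff; case: ifPn => // _; rewrite hornerC mul1r expR_ge0.
have B0 : 0 <= B.
  by apply: le_trans HB; apply: Rintegral_ge0 => x _; exact/ltW/profile_gt0.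
have pt t x : w t x * Psi t x <=
    d * (`|w t x| `^ r * (cutoff 1 T t * profile k x)) + K * (t < T)%R%:R * profile k x.
  apply: (le_trans (ler_norm _)); rewrite normrM.
  apply: (le_trans (ler_wpM2l (normr_ge0 _) (HPsi t x))).
  have [tT|tT] := ltP t T; last first.
    have -> : cutoff 1 T t = 0 by rewrite /cutoff ltNge tT.
    by rewrite powR0 ?invr_neq0 ?gt_eqF// !(mul0r, mulr0) add0r.
  have := @young_scaled _ (`|w t x| * cutoff 1 T t `^ r^-1) M d r (mulr_ge0 (normr_ge0 _) (powR_ge0 _ _)) M0 d0 r1.
  rewrite -/K powRM ?powR_ge0// -powRrM mulVf ?gt_eqF// powRr1// => h.
  have e1 (W b' m P : R) : W * (m * b' * P) = W * b' * m * P by ring.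
  have e2 (e W b c P : R) : e * (W * (b * P)) + c * P = (e * (W * b) + c) * P by ring.
  by rewrite mulr1 e1 e2 ler_wpM2r// ltW// profile_gt0.
clearbody K.
pose I (t : R) : \bar R := (\int[lebesgue_rV n]_x (`|w t x| `^ r * (cutoff 1 T t * profile k x))%:E)%E.
have I0 t : (0 <= I t)%E.
  apply: integral_ge0 => x _; rewrite lee_fin mulr_ge0 ?powR_ge0// mulr_ge0//.
  exact/ltW/profile_gt0.
have inner t : (\int[lebesgue_rV n]_x (w t x * Psi t x)%:E <= d%:E * I t + (K * (t < T)%R%:R * B)%:E)%E.
  have f0 x : (0 <= (`|w t x| `^ r * (cutoff 1 T t * profile k x))%:E)%E.
    rewrite lee_fin mulr_ge0 ?powR_ge0// mulr_ge0//; exact/ltW/profile_gt0.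
  have f1 x : (0 <= d%:E * (`|w t x| `^ r * (cutoff 1 T t * profile k x))%:E)%E.
    by rewrite mule_ge0 ?f0// lee_fin ltW.
  have g0 (x : 'rV[R]_n) : 0 <= K * (t < T)%R%:R * profile k x.
    by apply: mulr_ge0; [exact: mulr_ge0|exact: ltW (profile_gt0 x k0)].
  have mg : measurable_fun setT (fun x : 'rV[R]_n => K * (t < T)%R%:R * profile k x).
    by apply: measurable_funM; [exact: measurable_cst|exact: measurable_profile].
  apply: (@le_trans _ _ (\int[lebesgue_rV n]_x (d%:E * (`|w t x| `^ r * (cutoff 1 T t * profile k x))%:E +
      (K * (t < T)%R%:R * profile k x)%:E))%E).
    apply: le_integral_pos_nomeas => x _; first by rewrite adde_ge0 ?f1// lee_fin.
    by rewrite -EFinM -EFinD lee_fin.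
  apply: (le_trans (ge0_integralD_nomeas _ f1 g0 mg)); apply: leeD.
    exact: ge0_integralZl_nomeas.
  rewrite ge0_EintegralZl ?mulr_ge0//; last 2 first.
  - exact: measurable_profile.
  - by move=> x; exact/ltW/profile_gt0.
  rewrite Rintegral_EFin; last exact: integrable_profile.
  by rewrite -EFinM lee_fin ler_wpM2l// mulr_ge0.
pose D : set R := time_interval +oo%E.
rewrite -/D integral_mkcond [X in (_ <= d%:E * X + _)%E]integral_mkcond.
pose g (t : R) : R := K * B * \1_(`[0, T]%classic : set R) t.
have g0 t : 0 <= g t by rewrite mulr_ge0 ?mulr_ge0.
have mg : measurable_fun setT g.
  by apply: measurable_funM; [exact: measurable_cst|exact: measurable_indic].
have f0 t : (0 <= (I \_ D) t)%E by rewrite patchE; case: ifP.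
have f1 t : (0 <= d%:E * (I \_ D) t)%E by rewrite mule_ge0// lee_fin ltW.
apply: (@le_trans _ _ (\int[lebesgue_measure]_t (d%:E * (I \_ D) t + (g t)%:E))%E).
  apply: le_integral_pos_nomeas => t _; first by rewrite adde_ge0// lee_fin.
  rewrite !patchE; case: ifPn => [/set_mem[t0 _]|tD]; last by rewrite mule0 add0e lee_fin.
  apply: (le_trans (inner t)); rewrite leeD2l// lee_fin /g indicE mulrAC ler_wpM2l ?mulr_ge0//.
  have [tT|//] := ltP t T.
  by rewrite mem_set//= in_itv/= t0 ltW.
apply: le_trans; first by apply: ge0_integralD_nomeas; [exact: f1|exact: g0|exact: mg].
apply: leeD; first by apply: ge0_integralZl_nomeas; [exact: f0|].
rewrite /g ge0_EintegralZl ?mulr_ge0//.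
have E : lebesgue_measure (`[0, T]%classic : set R) = T%:E.
  by rewrite lebesgue_measure_itv/= lte_fin T0 -EFinD subr0.
by rewrite integral_indic// setIT [X in (_ * X)%E]E -EFinM.
Qed.

(** Both weights are at most 1, so J is the integral of |U|^q over space-time. Only U is jointly
    measurable; the comparison with u goes through two almost-everywhere inequalities, in x for
    almost every t and then in t. *)
Lemma spacetime_bound (R : realType) n (q : R) (u : R -> 'rV[R]_n -> R) : 0 <= q ->
  spacetime_Lq +oo%E q u -> exists2 J : R, 0 <= J & forall T k : R, 0 < T -> 0 < k ->
    (\int[lebesgue_measure]_(t in time_interval +oo%E) \int[lebesgue_rV n]_x
       (`|u t x| `^ q * (cutoff 1 T t * profile k x))%:E <= J%:E)%E.
Proof.
move=> q0 [U [mU Uoo Uu]].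
pose D : set R := time_interval +oo%E.
have DE : D = `[0, +oo[%classic.
  apply/seteqP; split => t; rewrite /D /time_interval/= in_itv/= andbT.
    by case.
  by move=> t0; rewrite ltry.
have mD : measurable D by rewrite DE; exact: measurable_itv.
have mS : measurable (@spacetime R n +oo%E).
  rewrite (_ : spacetime _ = D `*` setT); first exact: measurableX.
  by apply/seteqP; split => z /= []//; split.
pose h : measurableTypeR R * 'rV[R]_n -> \bar R := (fun z => (`|U z| `^ q)%:E) \_ (@spacetime R n +oo%E).
have mh : measurable_fun setT h.
  apply/(measurable_restrictT _ mS)/measurable_EFinP.
  apply: (measurableT_comp (measurable_powR _)).
  exact: (measurableT_comp (@normr_measurable R setT)).
have h0 z : (0 <= h z)%E by rewrite /h patchE; case: ifPn => // _; rewrite lee_fin powR_ge0.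
have hD t x : D t -> h (t, x) = (`|U (t, x)| `^ q)%:E.
  by move=> Dt; rewrite /h patchE mem_set.
have I0 : (0 <= \int[(lebesgue_measure \x lebesgue_rV n)%E]_z h z)%E by exact: integral_ge0.
have Ioo : (\int[(lebesgue_measure \x lebesgue_rV n)%E]_z h z < +oo)%E.
  by rewrite /h -integral_mkcond.
exists (fine (\int[(lebesgue_measure \x lebesgue_rV n)%E]_z h z)); first exact: fine_ge0.
move=> T k T0 k0; rewrite fineK ?ge0_fin_numE// fubini_tonelli1//.
rewrite -/D.
apply: (@le_trans _ _ (\int[lebesgue_measure]_(t in D) \int[lebesgue_rV n]_x h (t, x))%E); last first.
  rewrite integral_mkcond; apply: ge0_le_integral_nomeas => t _.
    by rewrite patchE; case: ifPn => // _; exact: integral_ge0.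
  by rewrite patchE; case: ifPn => // _; exact: integral_ge0.
have b01 t : 0 <= cutoff 1 T t <= 1.
  rewrite /cutoff; case: ifPn => [tT|_]; last by rewrite lexx ler01.
  rewrite hornerC mul1r expR_ge0 -[leRHS]expR0 ler_expR oppr_le0 invr_ge0.
  exact/ltW/cutoff_base_gt0.
have f0 t (x : 'rV[R]_n) : 0 <= `|u t x| `^ q * (cutoff 1 T t * profile k x).
  have /andP[b0 _] := b01 t.
  by rewrite mulr_ge0 ?powR_ge0// mulr_ge0// ltW// profile_gt0.
apply: ge0_ae_le_integral_nomeas => //.
- by apply: measurable_funTS; exact: measurable_fun_fubini_tonelli_F.
- by move=> t Dt; apply: integral_ge0 => x _; rewrite lee_fin.
- by move=> t Dt; exact: integral_ge0.
- move: Uu => [Z [mZ Z0 ZU]]; exists Z; split => // t /= nt; apply: ZU => /= tU.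
  apply: nt => Dt.
  apply: ge0_ae_le_integral_nomeas => //.
  + exact: measurableT_comp mh (@measurable_pair1 _ _ _ _ t).
  + by move=> x _; rewrite lee_fin.
  + move: (tU Dt) => [Y [mY Y0 YU]]; exists Y; split => // x /= nx; apply: YU => /= Ux.
    apply: nx => _; rewrite hD// Ux lee_fin.
    have /andP[b0 b1] := b01 t.
    rewrite ler_piMr ?powR_ge0// mulr_ile1// ?profile_le1// ltW// profile_gt0//.
Qed.

Lemma powR_small (R : realType) (a K e : R) : a < 0 -> 0 <= K -> 0 < e ->
  exists2 T0 : R, 1 <= T0 & forall T, T0 <= T -> K * T `^ a < e.
Proof.
(* For T >= A^(-1/a) one has T^a <= 1/A = e / (K + 1); the added 1 makes the final inequality strict
   and covers K = 0. *)
move=> a0 K0 e0; pose A := (K + 1) / e.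
have A0 : 0 < A by rewrite divr_gt0// ltr_wpDl.
exists (Num.max 1 (A `^ (- a^-1))); first by rewrite le_max lexx.
move=> T; rewrite ge_max => /andP[T1 TA].
have T0 : 0 < T by exact: lt_le_trans T1.
have : A <= T `^ (- a).
  rewrite -[leLHS](powRr1 (ltW A0)) (_ : 1 = - a^-1 * - a); last first.
    by rewrite mulrNN mulVf// lt_eqF.
  by rewrite powRrM ge0_ler_powR ?nnegrE ?powR_ge0 ?(ltW T0)// oppr_ge0 ltW.
rewrite powRN -{1}[A]invrK lef_pV2 ?posrE ?invr_gt0 ?powR_gt0// => h.
apply: (le_lt_trans (ler_wpM2l K0 h)).
by rewrite /A invf_div mulrA ltr_pdivrMr ?ltr_wpDl// mulrC ltr_pM2l// ltrDl.
Qed.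

(** If A < 0 the equation for u alone gives the contradiction; if A + B < 0 the two equations
    together do. The first entry of the maximum encodes q (A + B) < 0. The second encodes p q A + B
    < 0, which implies A + B < 0 when A >= 0, as p q > 1. If d <= sigma then N <= 1/2, and A < 0. *)
Lemma exponent_condition (R : realType) (sigma p q d : R) :
  0 < sigma -> 1 < p -> 1 < q -> 0 < d ->
  d <= sigma \/
  (sigma < d /\
   d / (2 * sigma) <
     Num.max ((2 * q + 1) / (p * q + q - 2))
             ((p * q + p + 1) / (2 * p * q - p - 1))) ->
  let N := d / (2 * sigma) in
  let A := - 2 + (1 + 2 * N) * (1 - q^-1) in
  let B := - p + (1 + N) * (p - 1) in
  A < 0 \/ A + B < 0.
Proof.
move=> s0 p1 q1 d0 H N A B.
have p0 : 0 < p by exact: lt_trans p1. have q0 : 0 < q by exact: lt_trans q1.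
have N0 : 0 < N by rewrite divr_gt0// mulr_gt0.
have pq1 : 1 < p * q by rewrite -[ltLHS]mulr1 ltr_pM.
have qA : q * A = - q - 1 + 2 * N * (q - 1).
  by rewrite /A; field; rewrite gt_eqF.
have pqp : p < p * q by rewrite ltr_pMr.
have sgA : (q * A < 0) = (A < 0) by rewrite pmulr_rlt0.
have sgAB : (q * (A + B) < 0) = (A + B < 0) by rewrite pmulr_rlt0.
have qAB : q * (A + B) = N * (p * q + q - 2) - (2 * q + 1).
  by rewrite mulrDr qA /B; ring.
case: H => [ds|[sd]].
  left; rewrite -sgA qA; have N1 : 2 * N <= 1.
    by rewrite /N mulrA ler_pdivrMr ?mulr_gt0// mul1r ler_pM2l.
  have : 2 * N * (q - 1) <= 1 * (q - 1) by rewrite ler_wpM2r// subr_ge0 ltW.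
  lra.
rewrite -/N lt_max => /orP[h|h].
  right; rewrite -sgAB qAB subr_lt0 -ltr_pdivlMr//; lra.
have [A0|A0] := ltP A 0; first by left.
right; have key : p * q * A + B < 0.
  have -> : p * q * A + B = N * (2 * p * q - p - 1) - (p * q + p + 1).
    by rewrite -mulrA qA /B; ring.
  by rewrite subr_lt0 -ltr_pdivlMr//; lra.
apply: le_lt_trans key; by rewrite lerD2r ler_peMl// ltW.
Qed.

Lemma dt_tensor (R : realType) n (T : R) (Q : {poly R}) (f : 'rV[R]_n -> R) : 0 < T ->
  dt (tensor (cutoff Q T) f) = tensor (cutoff (cutoff_deriv T Q) T) f.
Proof.
move=> T0; apply/funext => t; apply/funext => x; rewrite /dt /tensor derive1E.
have dd := mul_is_derive (derive_cutoff Q t T0) (cst_is_derive t (f x)).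
have -> := @derive_val _ _ _ _ _ _ _ dd.
by rewrite mulr0 add0r mulrC.
Qed.

(** Young's parameter is d = T^a with a left free. With r' conjugate to r, the exponent of the
    remainder adds a (1 - r') from d^(1 - r'), -j r' from the size of Psi, 1 from the length of the
    time interval and j N from the mass of the profile. *)
Lemma scaled_estimate (R : realType) n (w Psi : R -> 'rV[R]_n -> R) (T k r j C Ci a N : R) :
  1 <= T -> 0 < k -> 0 <= C -> 0 <= Ci -> 1 < r -> (0 < n)%N ->
  \int[lebesgue_rV n]_x profile k x <= Ci * T `^ (j * N) ->
  (forall t x, `|Psi t x| <= C * T `^ (- j) * cutoff 1 T t `^ r^-1 * profile k x) ->
  (\int[lebesgue_measure]_(t in time_interval +oo%E) \int[lebesgue_rV n]_x (w t x * Psi t x)%:E <=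
   (T `^ a)%:E * \int[lebesgue_measure]_(t in time_interval +oo%E) \int[lebesgue_rV n]_x
       (`|w t x| `^ r * (cutoff 1 T t * profile k x))%:E +
   (C `^ (1 - r^-1)^-1 * Ci *
      T `^ (a * (1 - (1 - r^-1)^-1) - j * (1 - r^-1)^-1 + 1 + j * N))%:E)%E.
Proof.
move=> T1 k0 C0 Ci0 r1 n0 HB HP; have T0 : 0 < T by exact: lt_le_trans T1.
have M0 : 0 <= C * T `^ (- j) by rewrite mulr_ge0 ?powR_ge0.
have d0 : 0 < T `^ a by exact: powR_gt0.
apply: (le_trans (young_estimate w T0 k0 M0 d0 r1 n0 HB HP)).
rewrite leeD2l// lee_fin powRM ?powR_ge0// -!powRrM.
set s := (1 - r^-1)^-1.
have -> : T `^ (a * (1 - s) - j * s + 1 + j * N) =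
    T `^ (a * (1 - s)) * T `^ (- j * s) * T `^ 1 * T `^ (j * N).
  by rewrite -!powRD ?(gt_eqF T0) ?implybT//; congr powR; ring.
rewrite (powRr1 (ltW T0)).
rewrite le_eqVlt; apply/orP; left; apply/eqP.
by move: (T `^ (a * (1 - s))) (T `^ (- j * s)) (T `^ (j * N)) (C `^ s) => X Y Z W; ring.
Qed.

(* With this k the bound k^sigma of the fractional Laplacian is T^(-j). *)
Definition profile_scale (R : realType) (sigma j T : R) : R := (T `^ (- (j / (2 * sigma)))) ^+ 2.

Lemma scale_gt0 (R : realType) (sigma j T : R) : 0 < T -> 0 < profile_scale sigma j T.
Proof. by move=> T0; rewrite exprn_gt0// powR_gt0. Qed.

Lemma sqrt_scale (R : realType) (sigma j T : R) :
  Num.sqrt (profile_scale sigma j T) = T `^ (- (j / (2 * sigma))).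
Proof. by rewrite sqrtr_sqr ger0_norm// powR_ge0. Qed.

Lemma sqrt_scale_powR (R : realType) (sigma j T : R) : 0 < sigma ->
  Num.sqrt (profile_scale sigma j T) `^ (2 * sigma) = T `^ (- j).
Proof.
by move=> s0; rewrite sqrt_scale -powRrM; congr powR; field; rewrite gt_eqF.
Qed.

Lemma sqrt_scale_expV (R : realType) (sigma j T : R) (n : nat) :
  (Num.sqrt (profile_scale sigma j T))^-1 ^+ n = T `^ (j * (n%:R / (2 * sigma))).
Proof.
rewrite sqrt_scale -powRN opprK -powR_mulrn ?powR_ge0// -powRrM.
by congr powR; ring.
Qed.

Lemma scale_antitone (R : realType) (sigma T : R) : 0 < sigma -> 1 <= T ->
  profile_scale sigma 2 T <= profile_scale sigma 1 T.
Proof.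
move=> s0 T1; rewrite lerXn2r ?nnegrE ?powR_ge0// ler_powR// lerN2.
by rewrite ler_pM2r ?invr_gt0 ?mulr_gt0// ler1n.
Qed.

Lemma scale_small (R : realType) (sigma j l : R) : 0 < sigma -> 0 < j -> 0 < l ->
  exists2 T0 : R, 1 <= T0 & forall T, T0 <= T -> profile_scale sigma j T <= l.
Proof.
move=> s0 j0 l0; have a0 : - (j / (2 * sigma)) < 0 by rewrite oppr_lt0 divr_gt0// mulr_gt0.
have q0 : 0 < Num.sqrt l by rewrite sqrtr_gt0.
have [T0 T01 HT] := powR_small a0 ler01 q0.
exists T0 => // T TT; have := HT T TT; rewrite mul1r => h.
rewrite -[leRHS](sqr_sqrtr (ltW l0)) lerXn2r ?nnegrE ?powR_ge0 ?sqrtr_ge0//; exact: ltW.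
Qed.

Lemma initial_datum (R : realType) n (f : 'rV[R]_n -> R) (T k : R) : 0 < T -> 0 < k ->
  (lebesgue_rV n).-integrable setT (EFin \o f) ->
  (\int[lebesgue_rV n]_x (f x * tensor (cutoff 1 T) (profile k) 0 x)%:E =
   (expR (- 1) * \int[lebesgue_rV n]_x (f x * profile k x))%:E)%E.
Proof.
move=> T0 k0 fi; have mf : measurable_fun setT f by case/integrableP : fi => /measurable_EFinP.
have i : (lebesgue_rV n).-integrable setT (EFin \o (fun x => f x * profile k x)).
  apply: (integrable_dom (g := fun x => `|f x|)).
  - by apply: measurable_funM => //; exact: measurable_profile.
  - move=> x; rewrite normrM ler_piMr// ger0_norm ?profile_le1//; exact/ltW/profile_gt0.
  - exact: (integrable_norm fi).
have b0 : cutoff 1 T 0 = expR (- 1).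
  by rewrite /cutoff T0 mul0r subr0 invr1 hornerC mul1r.
have E x : f x * tensor (cutoff 1 T) (profile k) 0 x = expR (- 1) * (f x * profile k x).
  by rewrite /tensor b0 mulrCA.
rewrite (eq_integral (fun x => (expR (- 1) * (f x * profile k x))%:E)); last first.
  by move=> x _; rewrite E.
rewrite Rintegral_EFin; last exact: (integrableZl measurableT (expR (- 1)) i).
by rewrite RintegralZl.
Qed.

(** * Contradiction *)

Lemma ler_norm3 (R : realType) (x y z X Y Z : R) : `|x| <= X -> `|y| <= Y -> `|z| <= Z ->
  `|x - y + z| <= X + Y + Z.
Proof.
move=> xX yY zZ; rewrite (le_trans (ler_normD _ _))// lerD//.
by rewrite (le_trans (ler_normB _ _))// lerD.
Qed.

(** With j = 2 both the second time derivative and (-Delta)^sigma are of size T^(-2); the structural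
    damping is of size T^(-3), hence harmless for T >= 1. The integral of |u|^q against the weight
    is bounded independently of T. *)
Lemma u_equation (R : realType) n (sigma p q : R) (u1 v1 : 'rV[R]_n -> R) (u v : R -> 'rV[R]_n -> R) :
  (0 < n)%N -> 1 <= sigma -> 1 < q ->
  (lebesgue_rV n).-integrable setT (EFin \o u1) -> 0 < \int[lebesgue_rV n]_x u1 x ->
  global_weak_solution sigma p q u1 v1 u v -> spacetime_Lq +oo%E q u ->
  let A := - 2 + (1 + 2 * (n%:R / (2 * sigma))) * (1 - q^-1) in
  exists2 c : R, 0 < c & exists2 K : R, 0 <= K & exists2 T0 : R, 1 <= T0 & forall T, T0 <= T ->
    (\int[lebesgue_measure]_(t in time_interval +oo%E) \int[lebesgue_rV n]_x
        (`|v t x| `^ p * (cutoff 1 T t * profile (profile_scale sigma 2 T) x))%:E + c%:E <=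
     (K * T `^ A)%:E)%E.
Proof.
move=> n0 s1 q1 iu1 Iu1 [_ _ H] uq A; have q0 : 0 < q by exact: lt_trans q1.
have s0 : 0 < sigma by exact: lt_le_trans s1.
pose N : R := n%:R / (2 * sigma).
have [CL CL0 HL] := profile_fractional_laplacian n0 s1.
have [Cb Cb1 Hb] := cutoff_bounds q1.
have [Ci Ci0 Hi] := integral_profile R n0.
have [J J0 HJ] := spacetime_bound (ltW q0) uq.
pose I1 := \int[lebesgue_rV n]_x u1 x.
have I12 : I1 / 2 < I1 by rewrite ltr_pdivrMr// ltr_pMr// ltr1n.
have [l l0 Hl] := cvg_integral_profile iu1 I12.
have [T0 T01 HT] := scale_small s0 (ltr0Sn R 1) l0.
pose C := Cb + Cb * CL + CL.
have Cb0 : 0 <= Cb by exact: le_trans Cb1.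
have C0 : 0 <= C by rewrite !addr_ge0 ?mulr_ge0// ltW.
pose s := (1 - q^-1)^-1.
exists (expR (- 1) * (I1 / 2)); first by rewrite mulr_gt0 ?expR_gt0// divr_gt0.
exists (J + C `^ s * Ci); first by rewrite addr_ge0// mulr_ge0 ?powR_ge0// ltW.
exists T0 => // T TT; have T1 : 1 <= T by exact: le_trans TT.
have Tp : 0 < T by exact: lt_le_trans T1.
set k := profile_scale sigma 2 T; have k0 : 0 < k by exact: scale_gt0.
have [L [LB LE]] := HL k k0.
have [E1 _] := H (cutoff 1 T) (profile k) (profile k) (time_test_cutoff 1 Tp)
  (space_test_profile n0 k0) (space_test_profile n0 k0).
have FL : frac_lap_x sigma (tensor (cutoff 1 T) (@profile R n k)) = tensor (cutoff 1 T) L.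
  by apply/funext => t; apply/funext => x; rewrite /frac_lap_x /tensor LE.
rewrite FL !dt_tensor// initial_datum// in E1.
have kB : Num.sqrt k `^ (2 * sigma) = T `^ (- 2) by exact: sqrt_scale_powR.
have T2 : T `^ (- 2) = T^-1 ^+ 2 by rewrite powRN powR_mulrn ?(ltW Tp)// exprVn.
have Ti : 0 <= T^-1 by rewrite invr_ge0 ltW.
have HPsi t x : `|tensor (cutoff (cutoff_deriv T (cutoff_deriv T 1)) T) (@profile R n k) t x -
    tensor (cutoff (cutoff_deriv T 1) T) L t x + tensor (cutoff 1 T) L t x| <=
    C * T `^ (- 2) * cutoff 1 T t `^ q^-1 * profile k x.
  have [b0 b1 b2 b3] := Hb T t Tp; have P0 := ltW (profile_gt0 x k0).
  have LP := LB x; rewrite kB in LP.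
  have W0 : 0 <= cutoff 1 T t `^ q^-1 by exact: powR_ge0.
  have T20 : 0 <= T `^ (- 2) by exact: powR_ge0.
  have Ti1 : T^-1 <= 1 by rewrite invf_le1.
  have -> : C * T `^ (- 2) * cutoff 1 T t `^ q^-1 * profile k x =
      Cb * T `^ (- 2) * cutoff 1 T t `^ q^-1 * profile k x +
      Cb * cutoff 1 T t `^ q^-1 * (CL * T `^ (- 2) * profile k x) +
      cutoff 1 T t `^ q^-1 * (CL * T `^ (- 2) * profile k x).
    move: (T `^ _) (cutoff 1 T t `^ _) (profile k x) => X Y Z; rewrite /C; ring.
  apply: ler_norm3; rewrite normrM.
  - by rewrite (ger0_norm P0) ler_wpM2r// T2.
  - rewrite ler_pM// (le_trans b2)// ler_wpM2r// ler_piMr//.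
  - by rewrite ler_pM// (ger0_norm b0).
have PB : \int[lebesgue_rV n]_x profile k x <= Ci * T `^ (2 * N).
  by have := Hi k k0; rewrite sqrt_scale_expV.
(* A is the fixed point of a -> a (1 - q') - 2 q' + 1 + 2 N, where 1/q + 1/q' = 1; this choice gives
   both terms of Young's inequality the same power of T. *)
have := scaled_estimate u A T1 k0 C0 (ltW Ci0) q1 n0 PB HPsi.
have -> : A * (1 - (1 - q^-1)^-1) - 2 * (1 - q^-1)^-1 + 1 + 2 * N = A.
  have y0 : 1 - q^-1 != 0 by rewrite gt_eqF// subr_gt0 invf_lt1.
  by rewrite /A -/N; move: (1 - q^-1) y0 => y y0; field.
rewrite -E1 => h.
apply: le_trans (le_trans _ h) _.
  rewrite leeD2l// lee_fin ler_wpM2l ?expR_ge0//; apply: ltW; apply: Hl => //.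
  exact: HT.
rewrite mulrDl EFinD; apply: leeD => //; rewrite mulrC EFinM.
by rewrite lee_wpmul2l ?lee_fin ?powR_ge0// HJ.
Qed.

(** With j = 1 the damping and (-Delta)^sigma are both of size T^(-1), and the second time
    derivative is smaller. The conclusion nevertheless carries the weight of scale j = 2, which is
    the larger one, because that is the integral which the equation for u bounds. The exponent e
    remains to be chosen. *)
Lemma v_equation (R : realType) n (sigma p q e : R) (u1 v1 : 'rV[R]_n -> R) (u v : R -> 'rV[R]_n -> R) :
  (0 < n)%N -> 1 <= sigma -> 1 < p ->
  (lebesgue_rV n).-integrable setT (EFin \o v1) -> 0 < \int[lebesgue_rV n]_x v1 x ->
  global_weak_solution sigma p q u1 v1 u v ->
  exists2 c : R, 0 < c & exists2 K : R, 0 <= K & exists2 T0 : R, 1 <= T0 & forall T, T0 <= T ->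
    (c%:E <= (T `^ (- e))%:E * \int[lebesgue_measure]_(t in time_interval +oo%E) \int[lebesgue_rV n]_x
        (`|v t x| `^ p * (cutoff 1 T t * profile (profile_scale sigma 2 T) x))%:E +
     (K * T `^ (- e * (1 - (1 - p^-1)^-1) - (1 - p^-1)^-1 + 1 + n%:R / (2 * sigma)))%:E)%E.
Proof.
move=> n0 s1 p1 iv1 Iv1 [_ _ H].
have s0 : 0 < sigma by exact: lt_le_trans s1.
pose N : R := n%:R / (2 * sigma).
have [CL CL0 HL] := profile_fractional_laplacian n0 s1.
have [Cb Cb1 Hb] := cutoff_bounds p1.
have [Ci Ci0 Hi] := integral_profile R n0.
pose I1 := \int[lebesgue_rV n]_x v1 x.
have I12 : I1 / 2 < I1 by rewrite ltr_pdivrMr// ltr_pMr// ltr1n.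
have [l l0 Hl] := cvg_integral_profile iv1 I12.
have [T0 T01 HT] := scale_small s0 (@ltr01 R) l0.
pose C := Cb + Cb + CL.
have Cb0 : 0 <= Cb by exact: le_trans Cb1.
have C0 : 0 <= C by rewrite !addr_ge0// ltW.
exists (expR (- 1) * (I1 / 2)); first by rewrite mulr_gt0 ?expR_gt0// divr_gt0.
exists (C `^ (1 - p^-1)^-1 * Ci); first by rewrite mulr_ge0 ?powR_ge0// ltW.
exists T0 => // T TT; have T1 : 1 <= T by exact: le_trans TT.
have Tp : 0 < T by exact: lt_le_trans T1.
set k := profile_scale sigma 1 T; have k0 : 0 < k by exact: scale_gt0.
have [L [LB LE]] := HL k k0.
have [_ E2] := H (cutoff 1 T) (profile k) (profile k) (time_test_cutoff 1 Tp)
  (space_test_profile n0 k0) (space_test_profile n0 k0).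
have FL : frac_lap_x sigma (tensor (cutoff 1 T) (@profile R n k)) = tensor (cutoff 1 T) L.
  by apply/funext => t; apply/funext => x; rewrite /frac_lap_x /tensor LE.
rewrite FL !dt_tensor// initial_datum// in E2.
have kB : Num.sqrt k `^ (2 * sigma) = T `^ (- 1) by exact: sqrt_scale_powR.
have TV : T `^ (- 1) = T^-1 by rewrite powR_inv1// ltW.
have Ti : 0 <= T^-1 by rewrite invr_ge0 ltW.
have HPsi t x : `|tensor (cutoff (cutoff_deriv T (cutoff_deriv T 1)) T) (@profile R n k) t x -
    tensor (cutoff (cutoff_deriv T 1) T) (@profile R n k) t x + tensor (cutoff 1 T) L t x| <=
    C * T `^ (- 1) * cutoff 1 T t `^ p^-1 * profile k x.
  have [b0 b1 b2 b3] := Hb T t Tp; have P0 := ltW (profile_gt0 x k0).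
  have LP := LB x; rewrite kB in LP.
  have W0 : 0 <= cutoff 1 T t `^ p^-1 by exact: powR_ge0.
  have Ti1 : T^-1 <= 1 by rewrite invf_le1.
  have -> : C * T `^ (- 1) * cutoff 1 T t `^ p^-1 * profile k x =
      Cb * T `^ (- 1) * cutoff 1 T t `^ p^-1 * profile k x +
      Cb * T `^ (- 1) * cutoff 1 T t `^ p^-1 * profile k x +
      cutoff 1 T t `^ p^-1 * (CL * T `^ (- 1) * profile k x).
    move: (T `^ _) (cutoff 1 T t `^ _) (profile k x) => X Y Z; rewrite /C; ring.
  apply: ler_norm3; rewrite normrM ?(ger0_norm P0) ?(ger0_norm b0).
  - rewrite ler_wpM2r// TV (le_trans b3)// ler_wpM2r// ler_wpM2l//.
    by rewrite expr2 ler_piMr.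
  - by rewrite ler_wpM2r// TV.
  - by rewrite ler_pM.
have PB : \int[lebesgue_rV n]_x profile k x <= Ci * T `^ (1 * N).
  by have := Hi k k0; rewrite sqrt_scale_expV.
have := scaled_estimate v (- e) T1 k0 C0 (ltW Ci0) p1 n0 PB HPsi.
rewrite !mul1r -/N -E2 => h.
have e0 t : 0 <= cutoff 1 T t by have [] := Hb T t Tp.
have c1 : ((expR (- 1) * (I1 / 2))%:E <= (expR (- 1) * \int[lebesgue_rV n]_x (v1 x * profile k x))%:E)%E.
  by rewrite lee_fin ler_wpM2l ?expR_ge0//; apply: ltW; apply: Hl => //; exact: HT.
(* The integral of |u|^q against the test function is nonnegative and is dropped. *)
apply: (le_trans c1); apply: le_trans (le_trans _ h) _.
  rewrite leeDr//; apply: integral_ge0 => t _; apply: integral_ge0 => x _.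
  by rewrite lee_fin mulr_ge0 ?powR_ge0// mulr_ge0// ltW// profile_gt0.
apply: leeD; last exact: lexx.
have Te0 : (0 <= (T `^ (- e))%:E)%E by rewrite lee_fin powR_ge0.
apply: (lee_wpmul2l Te0).
have k20 : 0 < profile_scale sigma 2 T by exact: scale_gt0.
apply: ge0_le_integral_nomeas => t _.
  apply: integral_ge0 => x _.
  by rewrite lee_fin mulr_ge0 ?powR_ge0// mulr_ge0// ltW// profile_gt0.
apply: ge0_le_integral_nomeas => x _; rewrite lee_fin.
  by rewrite mulr_ge0 ?powR_ge0// mulr_ge0// ltW// profile_gt0.
by rewrite ler_wpM2l ?powR_ge0// ler_wpM2l// profile_antitone// scale_antitone.
Qed.

Theorem theorem1p2 (R : realType) (n : nat) (sigma p q : R)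
    (u1 v1 : 'rV[R]_n -> R) :
  (1 <= n)%N -> 1 <= sigma -> 1 < p -> 1 < q ->
  u1 \in Lfun (lebesgue_rV n) 1%E -> v1 \in Lfun (lebesgue_rV n) 1%E ->
  0 < \int[lebesgue_rV n]_x u1 x -> 0 < \int[lebesgue_rV n]_x v1 x ->
  n%:R <= sigma \/
  (sigma < n%:R /\
   n%:R / (2 * sigma) <
     Num.max ((2 * q + 1) / (p * q + q - 2))
             ((p * q + p + 1) / (2 * p * q - p - 1))) ->
  ~ exists u v : R -> 'rV[R]_n -> R,
      spacetime_Lq +oo%E q u /\ global_weak_solution sigma p q u1 v1 u v.
Proof.
move=> n0 s1 p1 q1 /Lfun1_integrable iu1 /Lfun1_integrable iv1 Iu1 Iv1 cond [u [v [uq sol]]].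
have s0 : 0 < sigma by exact: lt_le_trans s1.
have n0R : 0 < n%:R :> R by rewrite ltr0n.
pose N : R := n%:R / (2 * sigma); pose A := - 2 + (1 + 2 * N) * (1 - q^-1).
pose B := - p + (1 + N) * (p - 1).
have AB : A < 0 \/ A + B < 0 by exact: exponent_condition.
have [cu cu0 [Ku Ku0 [Tu Tu1 Hu]]] := u_equation n0 s1 q1 iu1 Iu1 sol uq.
pose I (T : R) : \bar R := (\int[lebesgue_measure]_(t in time_interval +oo%E) \int[lebesgue_rV n]_x
        (`|v t x| `^ p * (cutoff 1 T t * profile (profile_scale sigma 2 T) x))%:E)%E.
have I0 T : 0 < T -> (0 <= I T)%E.
  move=> T0; apply: integral_ge0 => t _; apply: integral_ge0 => x _.
  rewrite lee_fin mulr_ge0 ?powR_ge0// mulr_ge0//; last by rewrite ltW// profile_gt0// scale_gt0.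
  by have [C _ Hb] := cutoff_bounds p1; have [] := Hb T t T0.
have {}Hu T : Tu <= T -> (I T + cu%:E <= (Ku * T `^ A)%:E)%E by exact: Hu.
(* For A < 0 the integral of |v|^p is dropped, and the positive constant cu would be at most Ku T^A,
   which tends to 0. *)
case: AB => [A0|AB0].
  have [T0 T01 HT] := powR_small A0 Ku0 cu0.
  pose T := Num.max Tu T0; have TT : Tu <= T by rewrite le_max lexx.
  have Tp : 0 < T by rewrite (lt_le_trans _ (le_trans Tu1 TT)).
  have := HT T; rewrite le_max lexx orbT => /(_ isT); apply/negP; rewrite -leNgt -lee_fin.
  by apply: le_trans (Hu T TT); rewrite leeDr// I0.
(* Inserting the first bound into the second leaves the powers A - e and (e + B) / (p - 1) of T.
   Both are negative exactly for A < e < -B, an interval that is nonempty as A + B < 0; e is its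
   midpoint. *)
pose e := (A - B) / 2.
have [cv cv0 [Kv Kv0 [Tv Tv1 Hv]]] := v_equation e n0 s1 p1 iv1 Iv1 sol.
have Ae : A - e < 0 by rewrite /e; move: AB0; lra.
have cv2 : 0 < cv / 2 by rewrite divr_gt0.
have [T1 T11 HT1] := powR_small Ae Ku0 cv2.
pose E2 := - e * (1 - (1 - p^-1)^-1) - (1 - p^-1)^-1 + 1 + N.
have E20 : E2 < 0.
  have pp : 0 < p - 1 by rewrite subr_gt0.
  have -> : E2 = (A + B) / 2 / (p - 1).
    rewrite /E2 /e /B; have pn : p - 1 != 0 by rewrite gt_eqF.
    have pn0 : p != 0 by rewrite gt_eqF// (lt_trans _ p1).
    have -> : (1 - p^-1)^-1 = p / (p - 1).
      by rewrite -[RHS]invf_div; congr (_^-1); rewrite mulrBl divff// mul1r.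
    by field.
  by rewrite pmulr_llt0 ?invr_gt0// pmulr_llt0.
have [T2 T21 HT2] := powR_small E20 Kv0 cv2.
pose T := Num.max (Num.max Tu Tv) (Num.max T1 T2).
have [TTu TTv TT1 TT2] : [/\ Tu <= T, Tv <= T, T1 <= T & T2 <= T].
  by rewrite /T !le_max !lexx !orbT.
have Tp : 0 < T by rewrite (lt_le_trans _ (le_trans Tu1 TTu)).
have := Hv T TTv; rewrite -/(I T) -/N -/E2; apply/negP; rewrite -ltNge.
have IT : (I T <= (Ku * T `^ A)%:E)%E.
  by apply: le_trans (Hu T TTu); rewrite leeDl// lee_fin ltW.
apply: (@le_lt_trans _ _ ((T `^ (- e))%:E * (Ku * T `^ A)%:E + (Kv * T `^ E2)%:E)%E).
  by rewrite leeD2r// lee_wpmul2l// lee_fin powR_ge0.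
rewrite -EFinM -EFinD lte_fin mulrCA -powRD ?(gt_eqF Tp) ?implybT// (addrC (- e)).
rewrite [ltRHS](splitr cv) ltrD//; [exact: HT1|exact: HT2].
Qed.
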